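(* Let $d\ge2$ and let $Q$ be a qplex. The following are equivalent: (1) the preservation group $\mathcal{G}(Q)$ contains a subgroup isomorphic to the projective unitary group $\mathrm{PU}(d)$; (2) $Q$ is a Hilbert qplex.
   Context: Fix an integer $d\ge 2$. $\langle\cdot,\cdot\rangle$ is the standard inner product on $\mathbb{R}^{d^2}$, $\|\cdot\|$ the Euclidean norm. $\Delta=\{p\in\mathbb{R}^{d^2}: p(i)\ge0,\ \sum_ip(i)=1\}$; $H=\{u\in\mathbb{R}^{d^2}:\sum_i u(i)=1\}$; $c=(1/d^2,\dots,1/d^2)$. For $A\subseteq H$ the polar is $A^*=\{u\in H:\langle u,v\rangle\ge\frac{1}{d(d+1)}\ \forall v\in A\}$. Out-ball $B_{\rm o}=\{u\in H:\|u-c\|\le r_{\rm o}\}$, $r_{\rm o}^2=\frac{d-1}{d^2(d+1)}$. A qplex is a set $Q\subseteq\Delta\cap B_{\rm o}$ with $Q^*=Q$. A measurement is an array $r(i|j)\ge0$ with $\sum_i r(i|j)=1$ for every $j$; for $q\in Q$, $q_r(i)=\sum_j[(d+1)q(j)-\frac1d]r(i|j)$; it is $Q$-preserving if $\{q_r:q\in Q\}=Q$; its stretched measurement matrix is $R_{ij}=(d+1)r(i|j)-\frac1d\sum_k r(i|k)$. The preservation group $\mathcal{G}(Q)$ is the set of stretched measurement matrices of $Q$-preserving measurements. Let $B_H$ be the real vector space of Hermitian operators on $\mathbb{C}^d$ and $S$ the set of density matrices. A qplex $Q$ is a Hilbert qplex if there is an $\mathbb{R}$-linear bijection $f:B_H\to\mathbb{R}^{d^2}$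 with $f(S)=Q$ and $\langle f(\rho),f(\rho')\rangle=\frac{\mathrm{Tr}(\rho\rho')+1}{d(d+1)}$ for all $\rho,\rho'\in S$. $\mathrm{PU}(d)=\mathrm{U}(d)/\{e^{i\theta}I\}$ is the projective unitary group. *)

(* Defs.v *)
From Stdlib Require Import Reals.
From mathcomp Require Import all_boot.

Set Implicit Arguments.
Unset Strict Implicit.
Unset Printing Implicit Defensive.

Local Open Scope R_scope.

Definition vec (n : nat) := 'I_n -> R.
Definition rmat (n : nat) := 'I_n -> 'I_n -> R.

Definition rsum (n : nat) (F : 'I_n -> R) : R := \big[Rplus/0]_(i < n) F i.

Definition dot (n : nat) (u v : vec n) : R := rsum (fun i => u i * v i).
Definition vnorm (n : nat) (u : vec n) : R := sqrt (dot u u).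

Definition rmatmul (n : nat) (A B : rmat n) : rmat n :=
  fun i j => rsum (fun k => A i k * B k j).
Definition rid (n : nat) : rmat n :=
  fun i j => if (nat_of_ord i == nat_of_ord j)%N then 1 else 0.

Definition D (d : nat) : nat := (d * d)%N.
Definition dR (d : nat) : R := INR d.

Definition simplex (d : nat) (p : vec (D d)) : Prop :=
  (forall i, 0 <= p i) /\ rsum p = 1.
Definition hyp (d : nat) (u : vec (D d)) : Prop := rsum u = 1.
Definition centre (d : nat) : vec (D d) := fun _ => 1 / (dR d * dR d).
Definition polar (d : nat) (A : vec (D d) -> Prop) (u : vec (D d)) : Prop :=
  hyp u /\ forall v, A v -> dot u v >= 1 / (dR d * (dR d + 1)).
Definition r_out (d : nat) : R := sqrt ((dR d - 1) / (dR d * dR d * (dR d + 1))).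
Definition out_ball (d : nat) (u : vec (D d)) : Prop :=
  hyp u /\ vnorm (fun i => u i - @centre d i) <= r_out d.

Definition qplex (d : nat) (Q : vec (D d) -> Prop) : Prop :=
  (forall u, Q u -> simplex u /\ out_ball u) /\
  (forall u, polar Q u <-> Q u).

(* measurements: r i j = r(i|j) *)
Definition measurement (d : nat) (r : rmat (D d)) : Prop :=
  (forall i j, 0 <= r i j) /\ (forall j, rsum (fun i => r i j) = 1).

Definition q_r (d : nat) (r : rmat (D d)) (q : vec (D d)) : vec (D d) :=
  fun i => rsum (fun j => ((dR d + 1) * q j - 1 / dR d) * r i j).

Definition Q_preserving (d : nat) (Q : vec (D d) -> Prop) (r : rmat (D d)) : Prop :=
  (forall q, Q q -> Q (q_r r q)) /\
  (forall q', Q q' -> exists q, Q q /\ q_r r q = q').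

Definition stretched (d : nat) (r : rmat (D d)) : rmat (D d) :=
  fun i j => (dR d + 1) * r i j - (1 / dR d) * rsum (fun k => r i k).

(* the preservation group G(Q), as a set of matrices (group law: matrix product) *)
Definition preservation_group (d : nat) (Q : vec (D d) -> Prop) (M : rmat (D d)) : Prop :=
  exists r, measurement r /\ Q_preserving Q r /\ M = stretched r.

Definition is_subgroup (n : nat) (G Hs : rmat n -> Prop) : Prop :=
  (forall M, Hs M -> G M) /\
  Hs (@rid n) /\
  (forall A B, Hs A -> Hs B -> Hs (rmatmul A B)) /\
  (forall A, Hs A -> exists B, Hs B /\ rmatmul A B = @rid n /\ rmatmul B A = @rid n).

Record C := mkC { Re : R; Im : R }.
Definition C0 : C := mkC 0 0.
Definition C1 : C := mkC 1 0.
Definition Cadd (x y : C) : C := mkC (Re x + Re y) (Im x + Im y).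
Definition Cmul (x y : C) : C :=
  mkC (Re x * Re y - Im x * Im y) (Re x * Im y + Im x * Re y).
Definition Cconj (x : C) : C := mkC (Re x) (- Im x).
Definition RtoC (a : R) : C := mkC a 0.
Definition Cexpi (t : R) : C := mkC (cos t) (sin t).

Definition csum (n : nat) (F : 'I_n -> C) : C := \big[Cadd/C0]_(i < n) F i.

Definition cmat (d : nat) := 'I_d -> 'I_d -> C.
Definition cmatmul (d : nat) (A B : cmat d) : cmat d :=
  fun i j => csum (fun k => Cmul (A i k) (B k j)).
Definition cadj (d : nat) (A : cmat d) : cmat d := fun i j => Cconj (A j i).
Definition cid (d : nat) : cmat d :=
  fun i j => if (nat_of_ord i == nat_of_ord j)%N then C1 else C0.
Definition cscale (d : nat) (a : C) (A : cmat d) : cmat d := fun i j => Cmul a (A i j).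
Definition ctrace (d : nat) (A : cmat d) : C := csum (fun i => A i i).
Definition clincomb (d : nat) (a b : R) (A B : cmat d) : cmat d :=
  fun i j => Cadd (Cmul (RtoC a) (A i j)) (Cmul (RtoC b) (B i j)).

Definition hermitian (d : nat) (A : cmat d) : Prop := forall i j, A i j = Cconj (A j i).
Definition density (d : nat) (A : cmat d) : Prop :=
  hermitian A /\
  (forall v : 'I_d -> C,
      0 <= Re (csum (fun i => csum (fun j => Cmul (Cmul (Cconj (v i)) (A i j)) (v j))))) /\
  ctrace A = C1.

Definition hilbert_qplex (d : nat) (Q : vec (D d) -> Prop) : Prop :=
  exists f : cmat d -> vec (D d),
    (forall (a b : R) (A B : cmat d), hermitian A -> hermitian B ->
        f (clincomb a b A B) = (fun i => a * f A i + b * f B i)) /\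
    (forall A B, hermitian A -> hermitian B -> f A = f B -> A = B) /\
    (forall v, exists A, hermitian A /\ f A = v) /\
    (forall rho, density rho -> Q (f rho)) /\
    (forall q, Q q -> exists rho, density rho /\ f rho = q) /\
    (forall rho rho', density rho -> density rho' ->
        dot (f rho) (f rho') =
        (Re (ctrace (cmatmul rho rho')) + 1) / (dR d * (dR d + 1))).

Definition unitary (d : nat) (U : cmat d) : Prop :=
  cmatmul U (cadj U) = @cid d /\ cmatmul (cadj U) U = @cid d.

(* A group of matrices Hs is isomorphic to PU(d) = U(d)/{e^{i t} I} via phi:
   phi is a homomorphism U(d) -> Hs, onto Hs, whose fibres are exactly the
   cosets of the phase subgroup {e^{i t} I}; i.e. phi induces a well-defined
   injective and surjective homomorphism PU(d) -> Hs. *)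
Definition iso_PU (d : nat) (Hs : rmat (D d) -> Prop) (phi : cmat d -> rmat (D d)) : Prop :=
  (forall U, unitary U -> Hs (phi U)) /\
  (forall U V, unitary U -> unitary V -> phi (cmatmul U V) = rmatmul (phi U) (phi V)) /\
  (forall U V, unitary U -> unitary V ->
      (phi U = phi V <-> exists t : R, U = cscale (Cexpi t) V)) /\
  (forall M, Hs M -> exists U, unitary U /\ phi U = M).

Definition contains_PU (d : nat) (G : rmat (D d) -> Prop) : Prop :=
  exists (Hs : rmat (D d) -> Prop) (phi : cmat d -> rmat (D d)),
    is_subgroup G Hs /\ iso_PU Hs phi.

(* Main.v *)
(** Every element of the preservation group is orthogonal and fixes the barycentre, so
    a copy of PU(d) in it is an orthogonal representation of U(d) on R^(d^2) containing
    the trivial one. Continuity is not assumed but follows: products of a torus element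
    with conjugates of its inverse sweep out whole arcs of the torus, which bounds the
    image of a neighbourhood of the identity. The torus then acts with integral weights,
    the representation can be differentiated, and since its dimension is at most d^2
    its weights are those of the adjoint representation. This gives an equivariant linear
    bijection between Hermitian matrices and R^(d^2), an isometry after rescaling the
    traceless part, and Q becomes a unitarily invariant self-dual set of trace-one
    Hermitian matrices. It contains some A with Tr A^2 = 1; comparing A with the matrices
    obtained by permuting its spectrum shows that A is a rank-one projection or its
    reflection in I/d, hence Q or its reflection consists of the density matrices.
    Conversely, for a Hilbert qplex, U(d) acts on Q by conjugation with kernel the phases. *)

Require Import Defs.
From Stdlib Require Import Reals.
From mathcomp Require Import all_boot all_order all_algebra fingroup perm.
From mathcomp Require Import ring lra zify spectral sesquilinear.
From mathcomp Require Import boolp reals topology normedtype trigo.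
From mathcomp Require Import complex Rstruct.

Set Implicit Arguments.
Unset Strict Implicit.
Unset Printing Implicit Defensive.

Import Order.TTheory GRing.Theory Num.Theory.
Local Open Scope ring_scope.
Local Open Scope sesquilinear_scope.
(* Otherwise [+] or [/] under an annotation [: R] is parsed as Stdlib's operation. *)
Bind Scope ring_scope with Rdefinitions.R.

(** The given isomorphism is abstract: nothing relates the topology of U(d) to that of its image.
    What replaces continuity is in the spirit of van der Waerden's theorem on bounded
    representations of compact simple groups. The distance [tau] from an image to the identity is a
    class function, so its smallness at a single torus element, which the pigeonhole principle
    provides, passes to every product of conjugates of that element and its inverse. No exponential
    map is set up. A derivative is a pair of matrices approximated to second order by a unitary and
    its image, and the way back from the derived action to the group goes through diagonalisation.
    Highest weights and complete reducibility are avoided too. A weight other than zero and the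
    roots would have at least d rearrangements, too many for dimension d^2; once only these small
    weights remain, an intertwiner can be written down from a single root vector. The reflection in
    I/d appears because the invariant form fixes the intertwiner on traceless matrices only up to
    sign. *)

Local Notation Re := (@complex.Re _) (only parsing).
Local Notation Im := (@complex.Im _) (only parsing).

(** * An explicit intertwiner from the matrix units into a gl_d-module with small weights *)

Section LieIntertwiner.
Variables (C : numFieldType) (d n : nat) (E : 'I_d -> 'I_d -> 'M[C]_n).
Hypothesis bracket : forall i j k l,
  E i j *m E k l - E k l *m E i j = (j == k)%:R *: E i l - (l == i)%:R *: E k j.
Definition act (i j : 'I_d) (x : 'cV[C]_n) : 'cV[C]_n := E i j *m x.
Local Notation e := act.

Lemma act0 i j : e i j 0 = 0. Proof. exact: mulmx0. Qed.
Lemma actD i j x y : e i j (x + y) = e i j x + e i j y. Proof. exact: mulmxDr. Qed.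
Lemma actN i j x : e i j (- x) = - e i j x. Proof. exact: mulmxN. Qed.
Lemma actZ i j c x : e i j (c *: x) = c *: e i j x. Proof. by rewrite /act scalemxAr. Qed.
Lemma act_sum i j (I : Type) (r : seq I) (P : pred I) F :
  e i j (\sum_(k <- r | P k) F k) = \sum_(k <- r | P k) e i j (F k).
Proof. exact: mulmx_sumr. Qed.

Ltac vring := repeat (match goal with |- context [act ?a ?b ?x] => generalize (act a b x); intro end);
  repeat (match goal with |- context [@eq_op ?T ?a ?b] =>
    match goal with |- context [@eq_op _ b a] => tryif constr_eq a b then fail else rewrite [b == a]eq_sym end end);
  repeat (match goal with |- context [@eq_op ?T ?a ?b] => generalize (@eq_op T a b); intro end);
  apply/matrixP => ? ?; rewrite ?mxE /=; ring.

Definition wtv (x : 'cV[C]_n) (mu : 'I_d -> int) :=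
  forall k, e k k x = (mu k)%:~R *: x.
Definition root (i j : 'I_d) : 'I_d -> int := fun k => (k == i)%:R - (k == j)%:R.

Lemma Ecomm i j k l (x : 'cV[C]_n) : e i j (e k l x) =
  e k l (e i j x) + (j == k)%:R *: e i l x - (l == i)%:R *: e k j x.
Proof.
rewrite /act !mulmxA !scalemxAl -addrA; apply/eqP; rewrite -mulmxBl addrC -subr_eq -mulmxBl.
by rewrite bracket.
Qed.

Lemma wtv_E i j x mu : wtv x mu -> wtv (e i j x) (fun k => mu k + root i j k).
Proof.
move=> hx k; rewrite Ecomm hx actZ /root intrD intrB scalerDl scalerBl addrA.
rewrite !natz.
have -> : (k == i)%:R *: (e k j x) = ((k == i)%:Z)%:~R *: (e i j x).
  by case: eqP => [->|_]; rewrite ?scale1r ?scale0r.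
by rewrite [j == k]eq_sym; case: (eqVneq k j) => [->|_]; rewrite ?scale0r.
Qed.

(** Zero and the roots e_i - e_j satisfy both bounds: no coordinate, and no sum of two distinct
    coordinates, exceeds 1 in absolute value. A product of operators whose total weight breaks a
    bound therefore kills the vector. *)
Hypothesis small1 : forall x mu k, wtv x mu -> (1 < `|mu k|)%N -> x = 0.
Hypothesis small2 : forall x mu k l, wtv x mu -> k != l -> (1 < `|(mu k + mu l)%R|)%N -> x = 0.

Lemma wtv_ext x mu nu : mu =1 nu -> wtv x mu -> wtv x nu.
Proof. by move=> h hx k; rewrite hx h. Qed.

Lemma wtv_sum (I : Type) (r : seq I) (P : pred I) F mu :
  (forall i, P i -> wtv (F i) mu) -> wtv (\sum_(i <- r | P i) F i) mu.
Proof.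
move=> h k; rewrite act_sum scaler_sumr; apply: eq_bigr => i /h; exact.
Qed.

Lemma wtv_zero x mu k : wtv x mu -> mu k = 0 -> e k k x = 0.
Proof. by move=> -> ->; rewrite scale0r. Qed.

Variables (s t : 'I_d) (v : 'cV[C]_n).
Hypothesis st : s != t.
Hypothesis hv : wtv v (root s t).

(** In the adjoint representation with v = E_st this sum equals d E_ss - I, that is, d times the
    traceless part of E_ss. *)
Definition wvec : 'cV[C]_n := \sum_j e j s (e t j v).

Ltac rt := rewrite /root ?eqxx ?[t == s]eq_sym ?(negPf st);
  repeat match goal with H : is_true (?a != ?b) |- _ => rewrite ?[b == a]eq_sym ?(negPf H); clear H end; try by [].

Lemma wvec_wt : wtv wvec (fun=> 0).
Proof.
apply: wtv_sum => j _; apply: wtv_ext (wtv_E j s (wtv_E t j hv)) => k.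
rewrite /root; ring.
Qed.

(** The model is [E_ab, d E_ss - I] = 0. Moving E_ab through the defining sum leaves corrections
    that cancel over j, up to one extra sum when b = t; each remaining term has a forbidden weight
    or is hit by a diagonal operator acting by zero. *)
Lemma wvec_E a b : a != s -> b != s -> e a b wvec = 0.
Proof.
move=> as_ bs; case: (eqVneq a b) => [<-|ab].
  by rewrite wvec_wt scale0r.
have -> : e a b wvec = \sum_j e j s (e t j (e a b v)) + (b == t)%:R *: \sum_j e j s (e a j v).
  rewrite /wvec act_sum scaler_sumr -big_split /=.
  apply/eqP; rewrite -subr_eq0 -sumrB.
  rewrite (eq_bigr (fun j => (b == j)%:R *: e a s (e t j v) - (j == a)%:R *: e j s (e t b v))); last first.
    move=> j _; rewrite (Ecomm a b j s) (Ecomm a b t j) [s == a]eq_sym (negPf as_) scale0r subr0.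
    by rewrite !actD actN !actZ; vring.
  rewrite sumrB (bigD1 b) //= (bigD1 a (P := predT)) //= !eqxx !scale1r !big1 ?addr0 ?subrr //.
    by move=> j /negPf->; rewrite scale0r.
  by move=> j; rewrite eq_sym => /negPf->; rewrite scale0r.
case: (eqVneq b t) => [bt|bt]; last first.
  rewrite scale0r addr0; case: (eqVneq a t) => [a_t|a_t].
    have hy := wtv_E a b hv; rewrite {}a_t in as_ ab hy *.
    rewrite big1 // => j _; case: (eqVneq j s) => [->|js].
      by apply: (wtv_zero (wtv_E t s hy)); rt.
    have [->|jt] := eqVneq j t.
      by rewrite (wtv_zero hy) ?act0 //; rt.
    by rewrite (small2 (k := s) (l := t) (wtv_E t j hy)) ?act0 //; rt.
  rewrite (small2 (k := s) (l := a) (wtv_E a b hv)) 1?eq_sym //; last by rt.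
  by rewrite big1 // => j _; rewrite !act0.
subst b; rewrite scale1r (small1 (k := t) (wtv_E a t hv)); last by rt.
rewrite big1 ?add0r; last by move=> j _; rewrite !act0.
rewrite big1 // => j _; case: (eqVneq j s) => [->|js].
  by apply: (wtv_zero (wtv_E a s hv)); rt.
have [->|ja] := eqVneq j a.
  by rewrite (wtv_zero hv) ?act0 //; rt.
by rewrite (small2 (k := s) (l := a) (wtv_E a j hv)) ?act0 1?eq_sym //; rt.
Qed.

(** The commutators all return multiples of [v]: one copy from the first sum against d + 1 copies
    from the second. The nonzero factor d later shows that the intertwiner does not vanish. *)
Lemma wvec_st : e s t wvec = - (d%:R *: v).
Proof.
have ev0 j : j != t -> e j t v = 0.
  by move=> jt; apply: (small1 (k := t) (wtv_E j t hv)); rt.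
have -> : e s t wvec = \sum_j e j s (e s j v) - \sum_j e j t (e t j v).
  rewrite /wvec act_sum; apply/eqP; rewrite -subr_eq0 opprB addrA -big_split -sumrB /=.
  have hst : e s s (e t t v) = - v.
    by rewrite hv actZ hv; apply/matrixP => x y; rewrite !mxE; rt; rewrite /=; ring.
  rewrite (eq_bigr (fun j => (t == j)%:R *: e s s (e t j v) - (j == s)%:R *: e j s (e t t v))).
    rewrite sumrB (bigD1 t) //= (bigD1 s (P := predT)) //= !eqxx !scale1r !big1 ?addr0 ?subrr //.
      by move=> j /negPf->; rewrite scale0r.
    by move=> j; rewrite eq_sym => /negPf->; rewrite scale0r.
  move=> j _; rewrite (Ecomm s t j s) (Ecomm s t t j) !eqxx (ev0 _ st) !actD actN !actZ !act0.
  by rewrite !scale1r; vring.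
rewrite (bigD1 s) //= big1 => [|j js]; last first.
  by rewrite (small1 (k := s) (wtv_E s j hv)) ?act0 //; rt.
rewrite addr0 hv actZ hv scalerA.
have hj j : j != t -> e j t (e t j v) = (1 + (j == s)%:R) *: v.
  move=> jt; rewrite Ecomm eqxx (ev0 _ jt) act0 !hv; rt.
  by apply/matrixP => x y; rewrite !mxE; case: (j == s) => /=; ring.
rewrite (bigD1 t) //= (eq_bigr _ hj) -scaler_suml big_split /= sumr_const.
rewrite (eq_bigr (fun j => (s == j)%:R)); last by move=> j _; rewrite eq_sym.
rewrite (bigD1 s) //= eqxx big1 ?addr0 => [|j /andP[_]]; last by rewrite eq_sym => /negPf->.
rewrite hv actZ hv scalerA.
have -> : (#|[pred i | i != t]| = d.-1)%N by rewrite cardC1 card_ord.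
have -> : d%:R = d.-1%:R + 1 :> C by rewrite natr1 prednK //; case: (d) s => [[]|].
by apply/matrixP => x y; rewrite !mxE; rt; rewrite /=; ring.
Qed.

(** Candidate image of E_ab. With d E_ss - I in place of [wvec], the three terms add up in the
    adjoint representation to d E_ab - delta_ab I. *)
Definition fvec a b : 'cV[C]_n :=
  (b == s)%:R *: e a s wvec - e a s (e s b wvec) + (a == b)%:R *: wvec.

Lemma wvec_diag a : e a a wvec = 0.
Proof. by rewrite wvec_wt scale0r. Qed.

Lemma wvec_up q b : q != s -> b != s -> e s q (e s b wvec) = 0.
Proof.
move=> qs bs; apply: (small1 (k := s) (wtv_E s q (wtv_E s b wvec_wt))); rt.
Qed.

Lemma wvec_down q a : q != s -> a != s -> e q s (e a s wvec) = 0.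
Proof.
move=> qs as_; apply: (small1 (k := s) (wtv_E q s (wtv_E a s wvec_wt))); rt.
Qed.

Lemma fvec_st : fvec s t = d%:R *: v.
Proof.
rewrite /fvec [t == s]eq_sym (negPf st) !scale0r sub0r addr0.
rewrite (wtv_E s t wvec_wt) wvec_st; rt; rewrite /=; vring.
Qed.

Lemma fvec_ss : fvec s s = wvec.
Proof. by rewrite /fvec eqxx !wvec_diag act0 scaler0 subr0 add0r scale1r. Qed.
Lemma fvec_as a : a != s -> fvec a s = e a s wvec.
Proof. by move=> as_; rewrite /fvec eqxx !wvec_diag act0 subr0 scale1r (negPf as_) scale0r addr0. Qed.
Lemma fvec_sb b : b != s -> fvec s b = - e s b wvec.
Proof.
move=> bs; rewrite /fvec (negPf bs) [s == b]eq_sym (negPf bs) !scale0r addr0 sub0r.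
by rewrite (wtv_E s b wvec_wt); rt; rewrite /=; vring.
Qed.
Lemma fvec_ab a b : b != s -> fvec a b = (a == b)%:R *: wvec - e a s (e s b wvec).
Proof. by move=> bs; rewrite /fvec (negPf bs) scale0r sub0r addrC. Qed.

Lemma fvec_wt a b : wtv (fvec a b) (root a b).
Proof.
have h0 := wvec_wt.
case: (eqVneq b s) => [->|bs].
  case: (eqVneq a s) => [->|as_].
    by rewrite fvec_ss; apply: wtv_ext h0 => k; rewrite /root subrr.
  by rewrite fvec_as //; apply: wtv_ext (wtv_E a s h0) => k; rewrite add0r.
move=> k; rewrite fvec_ab // actD actN actZ h0 scale0r scaler0 sub0r.
rewrite (wtv_E a s (wtv_E s b h0)) scalerBr.
have -> : (root a b k)%:~R *: ((a == b)%:R *: wvec) = 0.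
  by case: (eqVneq a b) => [->|]; rewrite /root ?scale0r ?scaler0 // subrr scale0r.
rewrite sub0r; congr (- (_ *: _)); congr (_%:~R); rewrite /root; ring.
Qed.

(** This is the commutator [E_pq, E_ab] carried over to the vectors [fvec]. Since [fvec] is built
    from operators passing through the index [s], the cases are split by which indices equal [s];
    only the weight bounds and the action on [wvec] are needed. *)
Lemma fvecE p q a b :
  e p q (fvec a b) = (q == a)%:R *: fvec p b - (b == p)%:R *: fvec a q.
Proof.
case: (eqVneq p q) => [<-|pq].
  rewrite fvec_wt /root intrB scalerBl.
  congr (_ - _).
    by case: (eqVneq p a) => [->|]; rewrite ?scale0r.
  by rewrite [b == p]eq_sym; case: (eqVneq p b) => [->|]; rewrite ?scale0r.
case: (eqVneq p s) => [ps|ps].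
  subst p; have qs : q != s by rewrite eq_sym.
  case: (eqVneq b s) => [->|bs].
    rewrite fvec_ss (fvec_ab _ qs).
    case: (eqVneq a s) => [->|as_].
      by rewrite fvec_ss [s == q]eq_sym (negPf qs) (wtv_E s q wvec_wt); rt; rewrite /=; vring.
    rewrite fvec_as // Ecomm eqxx wvec_diag (wvec_E as_ qs); vring.
  rewrite scale0r subr0 fvec_sb //.
  case: (eqVneq a s) => [->|as_].
    by rewrite fvec_sb // actN wvec_up // (negPf qs) scale0r oppr0.
  rewrite fvec_ab // actD actN actZ Ecomm wvec_up // act0 eqxx scale1r.
  rewrite (wtv_E s b wvec_wt) (Ecomm a q s b) (wvec_E as_ qs) act0.
  rewrite ?(negPf qs); rt.
  by rewrite /=; vring.
case: (eqVneq q s) => [qs|qs].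
  subst q; case: (eqVneq a s) => [->|as_].
    rewrite ?eqxx scale1r fvec_ss; case: (eqVneq b s) => [->|bs].
      by rewrite fvec_ss fvec_as // ?[s == p]eq_sym ?(negPf ps) ?scale0r ?subr0; vring.
    by rewrite fvec_sb // fvec_ab // actN; vring.
  case: (eqVneq b s) => [->|bs].
    rewrite fvec_as // wvec_down // ?[s == p]eq_sym ?(negPf ps); vring.
  have h1 : e p s (e s b wvec) = e s b (e p s wvec).
    by rewrite Ecomm eqxx (wvec_E ps bs) wvec_diag; vring.
  have h2 : e a b (e p s wvec) = (b == p)%:R *: e a s wvec.
    by rewrite Ecomm (wvec_E as_ bs) act0 ?[s == a]eq_sym ?(negPf as_); vring.
  rewrite fvec_ab // fvec_as // actD actN actZ (Ecomm p s a s) ?[s == a]eq_sym ?(negPf as_).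
  rewrite ?[s == p]eq_sym ?(negPf ps) h1 (Ecomm a s s b) wvec_down // act0 eqxx h2.
  rewrite (wtv_E p s wvec_wt); rt.
  by rewrite /=; vring.
case: (eqVneq a s) => [->|as_].
  case: (eqVneq b s) => [->|bs].
    by rewrite fvec_ss (wvec_E ps qs) ?[s == p]eq_sym ?(negPf ps) ?(negPf qs); vring.
  by rewrite !fvec_sb // actN Ecomm (wvec_E ps qs) act0 ?(negPf qs); vring.
case: (eqVneq b s) => [->|bs].
  by rewrite !fvec_as // Ecomm (wvec_E ps qs) act0 ?[s == p]eq_sym ?(negPf ps); vring.
rewrite !fvec_ab // actD actN actZ (wvec_E ps qs) Ecomm (Ecomm p q s b) (wvec_E ps qs) act0.
rewrite ?(negPf qs) ?[s == p]eq_sym ?(negPf ps) !actD actN !actZ.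
rewrite act0; vring.
Qed.

End LieIntertwiner.

(** * Weights of a unitary representation of dimension at most d^2 *)

Lemma sqn_ge0 (C : numClosedFieldType) n (x : 'cV[C]_n) : 0 <= (x ^t* *m x) 0 0.
Proof.
rewrite mxE; apply: sumr_ge0 => k _; rewrite !mxE mulrC -normCK; exact: exprn_ge0.
Qed.

Lemma sqn_gt0 (C : numClosedFieldType) n (x : 'cV[C]_n) : x != 0 -> 0 < (x ^t* *m x) 0 0.
Proof.
move=> x0; rewrite lt_neqAle sqn_ge0 andbT eq_sym; apply: contra x0; rewrite mxE.
rewrite psumr_eq0 => [/allP h|k _]; last by rewrite !mxE mulrC -normCK; exact: exprn_ge0.
apply/eqP/matrixP => k j; rewrite ord1 mxE.
by have := h k (mem_index_enum _); rewrite /= !mxE mulrC -normCK sqrf_eq0 normr_eq0 => /eqP.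
Qed.

Section Weights.
Variables (C : numClosedFieldType) (d n : nat) (E : 'I_d -> 'I_d -> 'M[C]_n).
Hypothesis bracket : forall i j k l,
  E i j *m E k l - E k l *m E i j = (j == k)%:R *: E i l - (l == i)%:R *: E k j.
Hypothesis adj : forall i j, (E i j) ^t* = E j i.
Hypothesis trE : \sum_k E k k = 0.
Variables (P : 'M[C]_n) (wt : 'I_n -> 'I_d -> int).
Hypothesis Pu : P \in unitmx.
Hypothesis diagE : forall k, P *m E k k = diag_mx (\row_a (wt a k)%:~R) *m P.
Hypothesis weyl : forall s : 'S_d, exists2 S : 'M[C]_n, S \in unitmx &
  forall i j, S *m E i j = E (s i) (s j) *m S.
Hypothesis fix1 : exists2 c : 'cV[C]_n, c != 0 & forall i j, E i j *m c = 0.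
Hypothesis nontriv : exists k, E k k != 0.
Hypothesis dim : (n <= d * d)%N.

Definition isW (mu : 'I_d -> int) := exists2 x, x != 0 & wtv E x mu.

Lemma isW_wt mu : isW mu <-> exists a, wt a = mu.
Proof.
split=> [[x x0 hx]|[a <-]].
  have Px0 : P *m x != 0.
    by apply: contra x0 => /eqP h; rewrite -(mulKmx Pu x) h mulmx0.
  have [a Pxa] : exists a, (P *m x) a 0 != 0.
    apply/existsP; rewrite -negb_forall; apply: contra Px0 => /forallP h.
    by apply/eqP/matrixP => i j; rewrite ord1 (eqP (h i)) mxE.
  exists a; apply/funext => k.
  have /(congr1 (fun M : 'cV_n => (P *m M) a 0)) := hx k; rewrite /act mulmxA diagE -mulmxA.
  rewrite mul_diag_mx -scalemxAr !mxE => /eqP.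
  by move: Pxa; rewrite !mxE => Pxa; rewrite -subr_eq0 -mulrBl mulf_eq0 (negPf Pxa) orbF subr_eq0 eqr_int => /eqP.
exists (invmx P *m delta_mx a 0).
  apply/eqP => /(congr1 (mulmx P)); rewrite mulKVmx // mulmx0 => /matrixP/(_ a 0).
  by rewrite !mxE !eqxx => /eqP; rewrite oner_eq0.
move=> k; rewrite /act.
apply: (can_inj (mulKmx Pu)); rewrite mulmxA diagE -mulmxA mulKVmx // -scalemxAr mulKVmx //.
apply/matrixP => i j; rewrite mul_diag_mx !mxE; case: (eqVneq i a) => [->|] //=.
by rewrite ?mulr0.
Qed.

Lemma isW_sum mu : isW mu -> \sum_k mu k = 0.
Proof.
move=> [x x0 hx]; have : (\sum_k E k k) *m x = 0 by rewrite trE mul0mx.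
rewrite mulmx_suml (eq_bigr _ (fun k _ => hx k)) -scaler_suml => /eqP.
by rewrite scaler_eq0 (negPf x0) orbF -rmorph_sum /= intr_eq0 => /eqP.
Qed.

(** E_ij and E_ji are adjoint to each other, so a weight vector x with E_ji x = 0 would satisfy 0 =
    |E_ij x|^2 + (mu_i - mu_j) |x|^2, where the right side is positive. *)
Lemma isW_string mu i j : isW mu -> mu j < mu i -> isW (fun k => mu k + root j i k).
Proof.
move=> [x x0 hx] ij; exists (act E j i x); last exact: wtv_E.
apply/eqP => h.
have hE : act E i j (act E j i x) = act E j i (act E i j x) + (mu i - mu j)%:~R *: x.
  by rewrite Ecomm // !eqxx !scale1r -addrA !hx -scalerBl intrB.
rewrite h act0 in hE.
have /(congr1 (fun M : 'cV_n => (x ^t* *m M) 0 0)) := esym hE.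
rewrite mulmx0 mulmxDr [RHS]mxE -scalemxAr [LHS]mxE [X in _ + X]mxE.
have -> : x ^t* *m act E j i (act E i j x) = (act E i j x) ^t* *m act E i j x.
  by rewrite {3}/act trmx_mul map_mxM adj mulmxA.
move/eqP; apply/negP; rewrite gt_eqF // ltr_wpDl ?sqn_ge0 // mulr_gt0 ?sqn_gt0 //.
by rewrite ltr0z subr_gt0.
Qed.

Lemma isW_perm mu (s : 'S_d) : isW mu -> isW (fun k => mu (s k)).
Proof.
move=> [x x0 hx]; have [S Su hS] := weyl (s^-1)%g; exists (S *m x).
  by apply: contra x0 => /eqP h; rewrite -(mulKmx Su x) h mulmx0.
move=> k; rewrite /act mulmxA.
have := hS (s k) (s k); rewrite !permK => <-.
by rewrite -mulmxA -/(act E _ _ _) hx -scalemxAr.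
Qed.

Lemma isW_0 : isW (fun=> 0).
Proof. by have [c c0 hc] := fix1; exists c => // k; rewrite scale0r; exact: hc. Qed.

(** Descent on the l1 norm. The coordinates sum to zero, so a nonzero weight has a positive and a
    negative one; transferring a unit between them lowers the norm by two, and the last weight
    before zero is a root. *)
Lemma isW_root0 mu : isW mu -> mu <> (fun=> 0) -> exists i j, i != j /\ isW (root i j).
Proof.
have [N] := ubnP (\sum_k `|mu k|)%N; elim: N mu => // N IH mu hN hW mu0.
have hs := isW_sum hW.
have [k0 hk0] : exists k, mu k != 0.
  apply: contrapT => /forallNP h; apply: mu0; apply/funext => k.
  by apply/eqP; rewrite -[_ == _]negbK; apply/negP/h.
have [i hi] : exists i, 0 < mu i.
  apply: contrapT => /forallNP h.
  have /eqP := hs; rewrite -oppr_eq0 -sumrN psumr_eq0 => [/allP/(_ k0 (mem_index_enum _))|k _].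
    by rewrite /= oppr_eq0 (negPf hk0).
  by rewrite oppr_ge0 leNgt; apply/negP.
have [j hj] : exists j, mu j < 0.
  apply: contrapT => /forallNP h.
  have /eqP := hs; rewrite psumr_eq0 => [/allP/(_ k0 (mem_index_enum _))|k _].
    by rewrite /= (negPf hk0).
  by rewrite leNgt; apply/negP.
have ij : i != j by apply/eqP => e; move: hi hj; rewrite e; lia.
have hW' := isW_string hW (lt_trans hj hi).
have [e|mu'0] := pselect ((fun k => mu k + root j i k) = (fun=> 0)).
  exists i, j; split=> //; suff -> : root i j = mu by [].
  apply/funext => k; have /(congr1 (fun f => f k)) /= := e; rewrite /root; lia.
apply: (IH _ _ hW' mu'0); rewrite -ltnS; apply: leq_trans hN.
rewrite ltnS (bigD1 i) //= [in ltnRHS](bigD1 i) //= (bigD1 j) 1?eq_sym //=.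
rewrite [in ltnRHS](bigD1 j) 1?eq_sym //=.
rewrite (eq_bigr (fun k => `|mu k|%N)); last first.
  by move=> k /andP[ki kj]; rewrite /root (negPf ki) (negPf kj) subrr addr0.
rewrite /root !eqxx [j == i]eq_sym (negPf ij).
by move: (\sum_(_ < _ | _) _)%N => X; lia.
Qed.

(** A nonzero diagonal operator supplies a nonzero weight, the descent turns it into some root, and
    permutations act transitively on roots. *)
Lemma isW_root i j : i != j -> isW (root i j).
Proof.
move=> ij.
have [k hk] := nontriv.
have [a ha] : exists a, wt a k != 0.
  apply: contrapT => /forallNP h; move/eqP: hk; apply.
  apply: (can_inj (mulKmx Pu)); rewrite diagE mulmx0.
  apply/matrixP => x y; rewrite mul_diag_mx !mxE.
  by have /negP := h x; rewrite negbK => /eqP->; rewrite mul0r.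
have /isW_root0 : isW (wt a) by apply/isW_wt; exists a.
case=> [e|i' [j' [ij' h]]]; first by move: ha; rewrite e eqxx.
pose s := (tperm i i' * tperm (tperm i i' j) j')%g.
have si : s i = i'.
  rewrite permM tpermL tpermD //; last by rewrite eq_sym.
  by apply: contra ij => /eqP jj; rewrite -(inj_eq (@perm_inj _ (tperm i i'))) tpermL jj.
have sj : s j = j' by rewrite permM tpermL.
have := isW_perm s h; congr isW; apply/funext => x.
by rewrite /root -si -sj !(inj_eq perm_inj).
Qed.

(** Counting: zero, the d(d - 1) roots and d rearrangements of a further weight would be d^2 + 1
    distinct weights, more than the dimension. *)
Lemma isW_roots mu : isW mu -> mu = (fun=> 0) \/ exists i j, i != j /\ mu = root i j.
Proof.
move=> hW; apply: contrapT => /not_orP[mu0 /forallNP nroot].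
have hs := isW_sum hW.
have [a [b ab]] : exists a b, mu a != mu b.
  apply: contrapT => /forallNP h; apply: mu0; apply/funext => k.
  have e x : mu x = mu k.
    by have /forallNP/(_ k)/negP := h x; rewrite negbK => /eqP.
  move: hs; rewrite (eq_bigr (fun=> mu k)) // sumr_const card_ord => /eqP.
  by rewrite mulrn_eq0 => /orP[/eqP d0|/eqP //]; have := leq_ltn_trans (leq0n k) (ltn_ord k); rewrite d0.
(* These d permutations give pairwise distinct rearrangements of mu: the identity for k = b,
   otherwise a transposition that changes the value at k by exchanging it with whichever of
   positions a, b carries a different one. *)
pose tau k : 'S_d := if k == b then 1%g else if mu k == mu a then tperm k b else tperm k a.
(* The index type has d^2 + 1 elements: [None] is the zero weight, off-diagonal pairs are the roots,
   and the d diagonal pairs are free to carry the rearrangements of mu. *)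
pose F (o : option ('I_d * 'I_d)) : 'I_d -> int := match o with
  | None => fun=> 0
  | Some (i, j) => if i == j then fun k => mu (tau i k) else root i j end.
have FW o : isW (F o).
  case: o => [[i j]|] /=; last exact: isW_0.
  by case: eqVneq => [_|ij]; [exact: isW_perm | exact: isW_root].
have tau_self k : k != b -> mu (tau k k) != mu k.
  move=> kb; rewrite /tau (negPf kb); case: (eqVneq (mu k) (mu a)) => [->|h]; rewrite tpermL.
    by rewrite eq_sym.
  by rewrite eq_sym.
have tau_other k l : l != b -> k != l -> mu (tau k l) != mu l -> l = a /\ mu k != mu a.
  move=> lb kl; rewrite /tau; case: (eqVneq k b) => [_|kb]; first by rewrite perm1 eqxx.
  case: (eqVneq (mu k) (mu a)) => [e|h].
    by rewrite tpermD ?eqxx // eq_sym.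
  case: (eqVneq l a) => [//|la].
  by rewrite tpermD ?eqxx // eq_sym.
have tau_inj k l : (fun x => mu (tau k x)) = (fun x => mu (tau l x)) -> k = l.
  move=> e; apply/eqP/negPn/negP => kl; have {}e x := congr1 (fun f => f x) e; rewrite /= in e.
  wlog kb : k l kl e / k != b.
    move=> IH; case: (eqVneq k b) => [kb|kb]; last exact: (IH k l).
    by apply: (IH l k); [rewrite eq_sym | move=> x; rewrite e | rewrite -kb eq_sym].
  have h := tau_self _ kb; rewrite e in h.
  have [ka la] := tau_other l k kb (ltac:(by rewrite eq_sym)) h.
  case: (eqVneq l b) => [lb|lb].
    by move: h; rewrite lb /tau eqxx perm1 eqxx.
  have h' := tau_self _ lb; rewrite -e in h'.
  by have [l_a _] := tau_other k l lb kl h'; move: la; rewrite l_a eqxx.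
have sym_nz (s : 'S_d) : (fun k => mu (s k)) <> (fun=> 0).
  move=> e; apply: mu0; apply/funext => k.
  by have := congr1 (fun f => f ((s^-1)%g k)) e; rewrite /= permKV.
have sym_root (s : 'S_d) i j : i != j -> (fun k => mu (s k)) <> root i j.
  move=> ij e; apply: (nroot (s i)); exists (s j); rewrite (inj_eq perm_inj); split=> //.
  apply/funext => k; have := congr1 (fun f => f ((s^-1)%g k)) e.
  by rewrite /= permKV /root !(canF_eq (permKV _)).
have root_nz i j : i != j -> root i j <> (fun=> 0).
  by move=> ij /(congr1 (fun f => f i)) /=; rewrite /root eqxx (negPf ij).
have root_inj i j i' j' : i != j -> root i j = root i' j' -> (i, j) = (i', j').
  move=> ij e; have := congr1 (fun f => f i) e; have := congr1 (fun f => f j) e.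
  rewrite /root !eqxx (negPf ij) [j == i]eq_sym (negPf ij) /=.
  do 4 case: eqP => //=; move=> *; subst; congr pair; try congruence.
have Finj : injective F.
  case=> [[i j]|] [[i' j']|] //=.
  - case: (eqVneq i j) => [<-|ij]; case: (eqVneq i' j') => [<-|ij'].
    + by move/tau_inj ->.
    + by move=> h; case: (sym_root _ _ _ ij' h).
    + by move/esym=> h; case: (sym_root _ _ _ ij h).
    + by move/(root_inj _ _ _ _ _ ij) ->.
  - case: (eqVneq i j) => [_|ij] h; first by case: (sym_nz _ h).
    by case: (root_nz _ _ _ ij h).
  - case: (eqVneq i' j') => [_|ij] /esym h; first by case: (sym_nz _ h).
    by case: (root_nz _ _ _ ij h).
have /choice[G hG] : forall o, exists a, wt a = F o by move=> o; apply/isW_wt.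
have Ginj : injective G by move=> x y e; apply: Finj; rewrite -!hG e.
have := leq_card G Ginj; rewrite card_option card_prod !card_ord.
by move=> /leq_trans/(_ dim); rewrite ltnn.
Qed.

Lemma wt_small1 x mu k : wtv E x mu -> (1 < `|mu k|)%N -> x = 0.
Proof.
move=> hx hk; apply/eqP/negPn/negP => x0.
have : isW mu by exists x.
case/isW_roots => [e|[i [j [_ e]]]]; move: hk; rewrite e // /root.
by do 2 case: eqP.
Qed.

Lemma wt_small2 x mu k l : wtv E x mu -> k != l -> (1 < `|(mu k + mu l)%R|)%N -> x = 0.
Proof.
move=> hx kl hk; apply/eqP/negPn/negP => x0.
have : isW mu by exists x.
case/isW_roots => [e|[i [j [ij e]]]]; move: hk; rewrite e // /root.
by do 4 case: eqP => //=; move=> *; subst; rewrite ?eqxx in kl ij.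
Qed.

End Weights.

(** * Characters of the real line with values in the unit circle *)

Section Characters.
Variable R : realType.
Local Notation C := R[i].
Implicit Types (z w : C) (x y t : R).

Lemma cconjCE (a b : R) : (Complex a b)^* = Complex a (- b) :> C.
Proof. by []. Qed.

Lemma cReD z w : Re (z + w) = Re z + Re w. Proof. by case: z w => [? ?] [? ?]. Qed.
Lemma cImD z w : Im (z + w) = Im z + Im w. Proof. by case: z w => [? ?] [? ?]. Qed.
Lemma cReN z : Re (- z) = - Re z. Proof. by case: z. Qed.
Lemma cImN z : Im (- z) = - Im z. Proof. by case: z. Qed.
Lemma cReM z w : Re (z * w) = Re z * Re w - Im z * Im w. Proof. by case: z w => [? ?] [? ?]. Qed.
Lemma cImM z w : Im (z * w) = Re z * Im w + Im z * Re w. Proof. by case: z w => [? ?] [? ?]. Qed.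
Lemma cRe_conj z : Re z^* = Re z. Proof. by case: z. Qed.
Lemma cIm_conj z : Im z^* = - Im z. Proof. by case: z. Qed.
Lemma complex_ext z w : Re z = Re w -> Im z = Im w -> z = w.
Proof. by case: z w => [? ?] [? ?] /= -> ->. Qed.

Definition unitc z := z * z^* = 1.

Lemma unitcE z : unitc z <-> Re z ^+ 2 + Im z ^+ 2 = 1.
Proof.
rewrite /unitc; split=> [/(congr1 (@complex.Re R))|h].
  by rewrite cReM cRe_conj cIm_conj => h; transitivity (Re (1 : C)) => //; rewrite -h; ring.
apply: complex_ext; rewrite ?cReM ?cImM cRe_conj cIm_conj /=; last by ring.
by rewrite -h; ring.
Qed.

Lemma unitcM z w : unitc z -> unitc w -> unitc (z * w).
Proof. by rewrite /unitc rmorphM => hz hw; rewrite mulrACA hz hw mulr1. Qed.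

Lemma unitc1 : unitc 1. Proof. by rewrite /unitc rmorph1 mulr1. Qed.

Definition expi x : C := Complex (cos x) (sin x).

Lemma expiD x y : expi (x + y) = expi x * expi y.
Proof. by apply: complex_ext; rewrite ?cReM ?cImM /= ?trigo.cosD ?trigo.sinD; ring. Qed.

Lemma expi0 : expi 0 = 1. Proof. by rewrite /expi cos0 sin0. Qed.

Lemma unitc_expi x : unitc (expi x).
Proof. by apply/unitcE; rewrite /= cos2Dsin2. Qed.

Lemma expiN x : expi (- x) = (expi x)^*.
Proof. by rewrite /expi cosN sinN. Qed.

Lemma expi_sum (I : Type) (r : seq I) (P : pred I) (F : I -> R) :
  expi (\sum_(i <- r | P i) F i) = \prod_(i <- r | P i) expi (F i).
Proof. by rewrite (big_morph expi expiD expi0). Qed.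

Lemma expi_pi2 : expi (pi *+ 2) = 1.
Proof. by rewrite /expi cos2pi sin2pi. Qed.

Lemma expi_int (m : int) : expi (m%:~R * (pi *+ 2)) = 1.
Proof.
have hn (k : nat) : expi (k%:R * (pi *+ 2)) = 1.
  elim: k => [|k IH]; first by rewrite mul0r expi0.
  by rewrite -natr1 mulrDl mul1r expiD IH expi_pi2 mulr1.
case: m => k; first exact: hn.
by rewrite NegzE rmorphN mulNr expiN /= -[_.+1%:~R]/(k.+1%:R) hn rmorph1.
Qed.

Lemma expi_eq1_int x : expi (x * (pi *+ 2)) = 1 -> exists m : int, x = m%:~R.
Proof.
move=> h; exists (Num.floor x); apply/eqP/negPn/negP => hx.
pose r := x - (Num.floor x)%:~R.
have hr0 : 0 < r by rewrite subr_gt0 lt_neqAle eq_sym hx Num.Theory.floor_le.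
have hr1 : r < 1.
  by have := lt_succ_floor x; rewrite /r intrD; lra.
have : expi (r * (pi *+ 2)) = 1.
  by rewrite mulrBl expiD h mul1r expiN expi_int rmorph1.
move/(congr1 (@complex.Re R)) => /=; rewrite mulrnAr cos_mulr2n.
have -> : r * pi = pi * r by ring.
have p0 := @pi_gt0 R.
have : 0 < sin (pi * r).
  apply: sin_gt0_pi; rewrite mulr_gt0 //= -[ltRHS]mulr1 ltr_pM2l //.
have := cos2Dsin2 (pi * r); rewrite mulr2n.
by move: (cos _) (sin _) => c s; nra.
Qed.

(** Squaring multiplies 1 - Re z by 2 (1 + Re z), at least 3 while Re z exceeds 1/2. A positive
    value of 1 - Re z would thus grow like 3^k, yet it stays below 1/2. *)
Lemma no_small_subgroup z : unitc z -> (forall k, 2^-1 < Re (z ^+ (2 ^ k))) -> z = 1.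
Proof.
move=> /unitcE hz h.
have hu k : Re (z ^+ (2 ^ k)) ^+ 2 + Im (z ^+ (2 ^ k)) ^+ 2 = 1.
  apply/unitcE; elim: (2 ^ k)%N => [|N IH]; first by rewrite expr0; exact: unitc1.
  by rewrite exprS; apply: unitcM => //; apply/unitcE.
have hk k : 3 ^+ k * (1 - Re z) <= 1 - Re (z ^+ (2 ^ k)).
  elim: k => [|k IH]; first by rewrite expr0 mul1r expn0 expr1.
  rewrite exprS expnSr exprM expr2 cReM.
  by have := h k; have := hu k; move: (Re (z ^+ _)) (Im (z ^+ _)) IH => a b; nra.
have hz1 : Re z = 1.
  apply/eqP; rewrite eq_le; apply/andP; split; first by nra.
  rewrite leNgt; apply/negP => hlt.
  have e0 : 0 < 1 - Re z by lra.
  have hb k : k%:R * (1 - Re z) <= 1.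
    have h1 := hk k; have h2 := h k.
    have : k%:R <= 3 ^+ k :> R by rewrite -natrX ler_nat ltnW // ltn_expl.
    by move: (3 ^+ k) (k%:R) h1 => a b; nra.
  have := archi_boundP (ltW (divr_gt0 ltr01 e0)).
  by rewrite ltr_pdivrMr // ltNge hb.
by apply: complex_ext => //=; apply/eqP; rewrite -sqrf_eq0; apply/eqP; rewrite -hz1 in hz *; nra.
Qed.

(** Dividing by the exponential that agrees with [chi] at [dl] leaves a character of period [dl]. It
    stays close to 1 on one period, hence everywhere, and the circle has no small subgroups. A bound
    on one interval thus does the work of continuity. *)
Lemma char_exp (chi : R -> C) (dl : R) :
  (forall x y, chi (x + y) = chi x * chi y) -> (forall x, unitc (chi x)) ->
  0 < dl -> (forall x, `|x| <= dl -> 9 / 10 <= Re (chi x)) ->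
  exists q, forall x, chi x = expi (q * x).
Proof.
move=> hM hu dl0 hs.
have chi0 : chi 0 = 1.
  have /(congr1 (fun z => z * (chi 0)^*)) := hM 0 0.
  by rewrite addr0 -mulrA hu mulr1.
have chiN x : chi (- x) * chi x = 1 by rewrite -hM addNr.
have hd := hs dl; rewrite ger0_norm ?(ltW dl0) // in hd; have {}hd := hd (lexx _).
have /unitcE hud := hu dl.
pose al := asin (Im (chi dl)).
have hI : -1 <= Im (chi dl) <= 1 by move: (Re _) (Im _) hd hud => a b *; apply/andP; split; nra.
have sal : sin al = Im (chi dl) by apply: asinK; rewrite in_itv.
have cal : cos al = Re (chi dl).
  rewrite cos_asin // -[RHS]ger0_norm -?sqrtr_sqr; last lra.
  by congr Num.sqrt; rewrite -hud; ring.
have al1 : - (pi / 2) <= al by apply: asin_geNpi2.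
have al2 : al <= pi / 2 by apply: asin_lepi2.
have p0 := @pi_gt0 R.
exists (al / dl) => x.
pose psi y := chi y * expi (- (al / dl * y)).
have psiM y y' : psi (y + y') = psi y * psi y'.
  by rewrite /psi hM mulrDr opprD expiD; ring.
have psiu y : unitc (psi y) by apply: unitcM => //; exact: unitc_expi.
have psid : psi dl = 1.
  rewrite /psi divfK ?gt_eqF // expiN.
  have -> : expi al = chi dl by apply: complex_ext.
  exact: hu.
have psi0 : psi 0 = 1 by rewrite /psi chi0 mulr0 oppr0 expi0 mulr1.
have psiN y : psi (- y) = (psi y)^*.
  have h : psi (- y) * psi y = 1 by rewrite -psiM addNr.
  by rewrite -[LHS]mulr1 -(psiu y) mulrA h mul1r.
have psin (k : nat) : psi (k%:R * dl) = 1.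
  elim: k => [|k IH]; first by rewrite mul0r.
  by rewrite -natr1 mulrDl mul1r psiM IH psid mulr1.
have psiz (k : int) : psi (k%:~R * dl) = 1.
  case: k => k; first exact: psin.
  by rewrite NegzE rmorphN mulNr psiN /= -[_.+1%:~R]/(k.+1%:R) psin rmorph1.
(* The threshold 9/10 leaves room for a product: both factors have real part at least 9/10, so the
   squares of their imaginary parts are at most 19/100, and the real part of the product is at least
   81/100 - 19/100. *)
have small y : `|y| <= dl -> 2^-1 < Re (psi y).
  move=> hy; rewrite /psi cReM /= cosN sinN.
  have h1 := hs _ hy; have /unitcE h2 := hu y.
  have h3 : cos al <= cos (al / dl * y).
    rewrite -(cos_norm al) -(cos_norm (_ * y)).
    have hb : `|al / dl * y| <= `|al|.
      rewrite normrM normrM normfV (ger0_norm (ltW dl0)) -mulrA.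
      by rewrite ler_piMr // mulrC ler_pdivrMr // mul1r.
    have ha : `|al| <= pi by rewrite ler_norml; apply/andP; split; lra.
    rewrite leNgt ltr_cos ?in_itv /= ?normr_ge0 ?ha ?(le_trans hb ha) //.
    by rewrite -leNgt.
  have := cos2Dsin2 (al / dl * y).
  move: h1 h2 h3; rewrite cal.
  move: (cos _) (sin _) (Re (chi y)) (Im (chi y)) => c s a b h1 h2 h3 h4.
  have hb : b ^+ 2 <= 19 / 100 by nra.
  have hs2 : s ^+ 2 <= 19 / 100 by nra.
  have hac : 81 / 100 <= a * c by nra.
  have hbs : - (b * s) <= (b ^+ 2 + s ^+ 2) / 2 by have := sqr_ge0 (b + s); nra.
  by lra.
have all y : 2^-1 < Re (psi y).
  pose k := Num.floor (y / dl).
  have -> : psi y = psi (y - k%:~R * dl).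
    by rewrite psiM psiN psiz rmorph1 mulr1.
  apply: small.
  have h1 : k%:~R <= y / dl by apply: Num.Theory.floor_le.
  have h2 : y / dl < k%:~R + 1 by have := lt_succ_floor (y / dl); rewrite intrD.
  rewrite ler_pdivlMr // in h1; rewrite ltr_pdivrMr // in h2.
  by rewrite ger0_norm; nra.
have : psi x = 1.
  apply: no_small_subgroup => // k.
  have -> : psi x ^+ (2 ^ k) = psi ((2 ^ k)%:R * x).
    elim: (2 ^ k)%N => [|N IH]; first by rewrite mul0r expr0.
    by rewrite exprS IH -psiM -natr1 mulrDl mul1r addrC.
  exact: all.
rewrite /psi expiN => h.
by rewrite -[LHS]mulr1 -(unitc_expi (al / dl * x)) mulrCA h mulr1.
Qed.

End Characters.

(** The family may be infinite. A finite subfamily with span of maximal dimension already spans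
    every member, so a basis diagonalising the subfamily diagonalises the whole family. *)
Lemma codiag_family (F : numClosedFieldType) n (T : Type) (f : T -> 'M[F]_n) :
  (forall t, f t \is unitarymx) -> (forall s t, f s *m f t = f t *m f s) ->
  exists2 P, P \in unitmx & forall t, is_diag_mx (P *m f t *m invmx P).
Proof.
move=> fU fC.
pose img (As : seq 'M[F]_n) := {in As, forall A, exists t, A = f t}.
pose Q k := `[< exists2 As, img As & \dim <<As>>%VS = k >].
have exQ : exists k, Q k by exists (\dim <<[::] : seq 'M[F]_n>>%VS : nat); apply/asboolP; exists [::].
have bQ k : Q k -> (k <= \dim {:'M[F]_n})%N.
  by move=> /asboolP[ts _ <-]; exact/dimvS/subvf.
case: (ex_maxnP exQ bQ) => _ /asboolP[As hAs <-] hmax.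
have span t : f t \in <<As>>%VS.
  have h : (\dim <<f t :: As>> <= \dim <<As>>)%N.
    apply: hmax; apply/asboolP; exists (f t :: As) => // A.
    by rewrite inE => /orP[/eqP ->|/hAs //]; exists t.
  have hs : (<<As>> <= <<f t :: As>>)%VS by rewrite span_cons addvSr.
  have /eqP -> : (<<As>> == <<f t :: As>>)%VS by rewrite eqEdim hs.
  by apply: memv_span; rewrite mem_head.
have diagf t : diagonalizable (f t).
  have : f t \is normalmx.
    apply/normalmxP; have /unitarymxP h := fU t; rewrite h.
    have : (f t)^t* \is unitarymx by rewrite trmxC_unitary.
    by move/unitarymxP; rewrite trmxCK.
  move/orthomx_spectralP => e; exists (spectralmx (f t)); first exact: spectral_unit.
  apply/diagonalizable_forPex; exists (spectral_diag (f t)).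
  apply/simmxP; first exact: spectral_unit.
  by rewrite {2}e !mulmxA mulmxV ?spectral_unit // mul1mx.
have /codiagonalizableP[P Pu /allP hP] :
    {in As &, forall A B, comm_mx A B} /\ {in As, forall A, diagonalizable A}.
  by split=> [_ _ /hAs[s ->] /hAs[t ->]|_ /hAs[t ->]]; [exact: fC|exact: diagf].
exists P => // t; rewrite (@coord_span _ _ _ (in_tuple As) _ (span t)) mulmx_sumr mulmx_suml.
apply/is_diag_mxP => i j ij; rewrite summxE big1 // => k _.
rewrite -scalemxAr -scalemxAl mxE.
have : As`_k \in As by rewrite mem_nth.
move/hP => /diagonalizable_forPex[D /(simmxP Pu) e].
by rewrite e mulmxK // mxE -val_eqE (negPf ij) mulr0n mulr0.
Qed.

Lemma perm2 (d : nat) (i j i' j' : 'I_d) : i != j -> i' != j' ->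
  exists s : 'S_d, s i = i' /\ s j = j'.
Proof.
move=> ij ij'; exists (tperm i i' * tperm (tperm i i' j) j')%g; split; last by rewrite permM tpermL.
have h1 : tperm i i' j != i'.
  by apply: contra ij => /eqP jj; rewrite -(inj_eq (@perm_inj _ (tperm i i'))) tpermL jj.
have h2 : j' != i' by rewrite eq_sym.
by rewrite permM tpermL (tpermD h1 h2).
Qed.

(** * Frobenius norm, a finite form of compactness, and embedded 2 by 2 blocks *)

Section Torus.
Variables (R : realType).
Local Notation C := R[i].

Definition F2 p q (A : 'M[C]_(p, q)) : R := \sum_i \sum_j (Re (A i j) ^+ 2 + Im (A i j) ^+ 2).

Lemma F2_ge0 p q (A : 'M[C]_(p, q)) : 0 <= F2 A.
Proof. by apply: sumr_ge0 => i _; apply: sumr_ge0 => j _; rewrite addr_ge0 ?sqr_ge0. Qed.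

Lemma F2D p q (A B : 'M[C]_(p, q)) : F2 (A + B) <= 2 * F2 A + 2 * F2 B.
Proof.
rewrite /F2 !mulr_sumr -big_split; apply: ler_sum => i _.
rewrite !mulr_sumr -big_split; apply: ler_sum => j _ /=.
rewrite mxE cReD cImD; have := sqr_ge0 (Re (A i j) - Re (B i j)).
by have := sqr_ge0 (Im (A i j) - Im (B i j)); nra.
Qed.

Lemma cRe_sum (I : Type) (r : seq I) (P : pred I) (F : I -> C) :
  Re (\sum_(i <- r | P i) F i) = \sum_(i <- r | P i) Re (F i).
Proof. by apply: (big_morph _ (@cReD R)). Qed.

Lemma F2_tr p q (A : 'M[C]_(p, q)) : F2 A = Re (\tr (A *m A ^t*)).
Proof.
rewrite cRe_sum; apply: eq_bigr => i _; rewrite mxE cRe_sum; apply: eq_bigr => j _.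
by rewrite !mxE cReM cRe_conj cIm_conj; ring.
Qed.

Lemma F2_adj p q (A : 'M[C]_(p, q)) : F2 (A ^t*) = F2 A.
Proof. by rewrite !F2_tr trmxCK mxtrace_mulC. Qed.

Lemma F2_mul p (U A : 'M[C]_p) : U \is unitarymx -> F2 (U *m A) = F2 A.
Proof.
move=> hU; rewrite !F2_tr trmx_mul map_mxM mulmxA mxtrace_mulC !mulmxA.
have : U^t* \is unitarymx by rewrite trmxC_unitary.
by move/unitarymxP; rewrite trmxCK => ->; rewrite mul1mx.
Qed.

Lemma unitarymx_adjl p (U : 'M[C]_p) : U \is unitarymx -> U ^t* *m U = 1%:M.
Proof. by rewrite -trmxC_unitary => /unitarymxP; rewrite trmxCK. Qed.

Lemma unitarymx_entry p (U : 'M[C]_p) i j : U \is unitarymx -> Re (U i j) ^+ 2 + Im (U i j) ^+ 2 <= 1.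
Proof.
move/unitarymxP => /matrixP/(_ i i); rewrite !mxE eqxx => /(congr1 (@complex.Re R)).
rewrite cRe_sum (bigD1 j) //= !mxE cReM cRe_conj cIm_conj => <-.
rewrite -[leLHS]addr0 lerD ?sumr_ge0 //; first by rewrite le_eqVlt; apply/orP; left; apply/eqP; ring.
by move=> k _; rewrite !mxE cReM cRe_conj cIm_conj; nra.
Qed.

(** Entries of a real unitary matrix lie in [-1, 1]; cutting this interval into cells of width 1/M
    leaves finitely many patterns, and matrices with the same pattern are close. N is fixed before
    the sequence, so sample points may be spaced according to N. *)
Lemma pigeonhole n (e : R) : 0 < e -> exists N : nat, forall U : nat -> 'M[C]_n,
  (forall k, U k \is unitarymx /\ map_mx Num.conj (U k) = U k) ->
  exists k l, [/\ (k < l)%N, (l <= N)%N & F2 (U k - U l) <= e].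
Proof.
(* With M > n^2 / e, the n^2 squared entry differences, each at most 1/M, add up to at most e. *)
move=> e0; pose M := (Num.bound ((n * n)%:R / e)).+1.
pose T := {ffun 'I_n * 'I_n -> 'I_(2 * M).+1}.
exists #|T| => U hU.
pose cell (x : R) : nat := Num.truncn ((x + 1) * M%:R).
have hM : 0 < M%:R :> R by rewrite ltr0n.
have entry k i j : -1 <= Re (U k i j) <= 1.
  have := unitarymx_entry i j (hU k).1; move: (Re _) (Im _) => a b h.
  by apply/andP; split; nra.
have imz k i j : Im (U k i j) = 0.
  have /matrixP/(_ i j) := (hU k).2; rewrite mxE => /(congr1 (@complex.Im R)).
  by rewrite cIm_conj; lra.
have cellP k i j : (cell (Re (U k i j)) < (2 * M).+1)%N.
  have /andP[h1 h2] := entry k i j.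
  have g : 0 <= (Re (U k i j) + 1) * M%:R by rewrite mulr_ge0 //; lra.
  rewrite ltnS -(ler_nat R) natrM; have /andP[/le_trans h _] := Num.Theory.truncn_itv g.
  by apply: h; rewrite ler_pM2r //; lra.
pose G (k : 'I_(#|T|).+1) : T := [ffun p => Ordinal (cellP k p.1 p.2)].
have : ~~ injectiveb G.
  apply/negP => /injectiveP /leq_card; by rewrite card_ord ltnn.
case/injectivePn => k [l kl eG].
wlog lt : k l kl eG / (k < l)%N.
  move=> IH; have [h|h|h] := ltngtP k l; first exact: (IH k l).
    by apply: (IH l k) => //; rewrite eq_sym.
  by move: kl; rewrite (val_inj h) eqxx.
exists k, l; split=> //; first by rewrite -ltnS.
have hd i j : (Re (U k i j) - Re (U l i j)) ^+ 2 <= M%:R^-1.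
  have /(congr1 (fun f : T => nat_of_ord (f (i, j)))) := eG; rewrite !ffunE /= /cell => h.
  have /andP[h1 h2] := entry k i j; have /andP[h3 h4] := entry l i j.
  have g1 : 0 <= (Re (U k i j) + 1) * M%:R by rewrite mulr_ge0 //; lra.
  have g2 : 0 <= (Re (U l i j) + 1) * M%:R by rewrite mulr_ge0 //; lra.
  have := Num.Theory.truncn_itv g1; have := Num.Theory.truncn_itv g2; rewrite h.
  move: (Num.truncn _) => c /andP[]; rewrite -natr1; move: (c%:R) => c' c1 c2 /andP[c3 c4].
  have M1 : 1 <= M%:R :> R by rewrite ler1n.
  rewrite -[leRHS]mul1r ler_pdivlMr //.
  move: (Re _) (Re _) M%:R hM M1 {h1 h2 h3 h4 g1 g2} c1 c2 c3 c4 => x y m hm m1 c1 c2 c3 c4.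
  have : ((x - y) * m) ^+ 2 <= 1 by nra.
  by rewrite exprMn; nra.
have : F2 (U k - U l) <= \sum_(i < n) \sum_(j < n) M%:R^-1.
  apply: ler_sum => i _; apply: ler_sum => j _; rewrite !mxE cReD cImD cReN cImN !imz subr0 expr0n addr0.
  exact: hd.
rewrite !sumr_const !card_ord -mulrnA => /le_trans; apply.
rewrite -[_^-1 *+ _]mulr_natl ler_pdivrMr // mulrC -ler_pdivrMr //.
apply/ltW/(lt_le_trans (archi_boundP _)); first by rewrite divr_ge0 // ltW.
by rewrite ler_nat.
Qed.

Definition dg d (f : 'I_d -> C) : 'M[C]_d := diag_mx (\row_i f i).

Lemma dgM d (f g : 'I_d -> C) : dg f *m dg g = dg (fun i => f i * g i).
Proof.
apply/matrixP => i j; rewrite mul_diag_mx !mxE.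
by case: eqVneq => [->|]; rewrite /= ?mulr1n ?mulr0n ?mulr0.
Qed.

Lemma dg_unitary d (f : 'I_d -> C) : (forall i, unitc (f i)) -> dg f \is unitarymx.
Proof.
move=> h; apply/unitarymxP; rewrite tr_diag_mx map_diag_mx.
have -> : map_mx Num.conj (\row_i f i) = \row_i (f i)^* by apply/matrixP => i j; rewrite !mxE.
rewrite -/(dg _) -/(dg _) dgM; apply/matrixP => i j; rewrite !mxE h.
by case: eqVneq.
Qed.

Definition mx2 (a b c e : C) : 'M[C]_2 := block_mx (a%:M : 'M_1) (b%:M : 'M_1) (c%:M : 'M_1) (e%:M : 'M_1).
(** With the dimension written as m + 2, the 2 + m block decomposition has the right type by
    computation. *)
Definition emb m (a b c e : C) : 'M[C]_(m.+2) := block_mx (mx2 a b c e) 0 0 (1%:M : 'M_m).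

Lemma emb_eq m a b c e a' b' c' e' : a = a' -> b = b' -> c = c' -> e = e' ->
  emb m a b c e = emb m a' b' c' e'.
Proof. by move=> -> -> -> ->. Qed.

Lemma mx2M a b c e a' b' c' e' : mx2 a b c e *m mx2 a' b' c' e' =
  mx2 (a * a' + b * c') (a * b' + b * e') (c * a' + e * c') (c * b' + e * e').
Proof. by rewrite /mx2 (@mulmx_block _ 1 1 1 1 1 1) -!scalar_mxM -!raddfD. Qed.

Lemma embM m a b c e a' b' c' e' : emb m a b c e *m emb m a' b' c' e' =
  emb m (a * a' + b * c') (a * b' + b * e') (c * a' + e * c') (c * b' + e * e').
Proof.
rewrite /emb -mx2M; move: (mx2 a b c e) (mx2 a' b' c' e') => A B.
have := @mulmx_block C 2 m 2 m 2 m A 0 0 1%:M B 0 0 1%:M.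
by rewrite !mul0mx !mulmx0 !addr0 !add0r mulmx1.
Qed.

Lemma emb1 m : emb m 1 0 0 1 = 1%:M.
Proof.
rewrite /emb; have -> : mx2 1 0 0 1 = 1%:M.
  by rewrite /mx2 raddf0 -(@scalar_mx_block _ 1 1).
exact: (esym (@scalar_mx_block C 2 m 1)).
Qed.

Lemma emb_adj m a b c e : (emb m a b c e)^t* = emb m a^* c^* b^* e^*.
Proof.
have h2 : (mx2 a b c e)^t* = mx2 a^* c^* b^* e^*.
  by rewrite /mx2 (@tr_block_mx _ 1 1 1 1) (@map_block_mx _ _ _ 1 1 1 1) !tr_scalar_mx !map_scalar_mx.
rewrite /emb -h2; move: (mx2 a b c e) => A.
rewrite (@tr_block_mx _ 2 m 2 m) (@map_block_mx _ _ _ 2 m 2 m).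
by rewrite !trmx0 !map_mx0 trmx1 map_mx1.
Qed.

Lemma emb_unitary m a b c e : a * a^* + b * b^* = 1 -> c * c^* + e * e^* = 1 -> a * c^* + b * e^* = 0 ->
  emb m a b c e \is unitarymx.
Proof.
move=> h1 h2 h3; apply/unitarymxP; rewrite emb_adj embM h1 h2 h3.
suff -> : c * a^* + e * b^* = 0 by exact: emb1.
have /(congr1 Num.conj) := h3; rewrite rmorphD !rmorphM /= !conjCK rmorph0 => <-; ring.
Qed.

Lemma emb_su2 m x y : x * x^* + y * y^* = 1 -> emb m x (- y^*) y x^* \is unitarymx.
Proof.
move=> h; apply: emb_unitary; rewrite ?rmorphN /= ?conjCK; last by ring.
  by rewrite -h; ring.
by rewrite -h; ring.
Qed.

Lemma mul_conjCc (z : C) : z * z^* = (Re z ^+ 2 + Im z ^+ 2)%:C%C.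
Proof. by apply: complex_ext; rewrite ?cReM ?cImM cRe_conj cIm_conj /=; ring. Qed.

(** The vector (x, y) = (b^*, a - e) is an eigenvector for e: the upper row holds identically, the
    lower one by the trace and determinant conditions. Since b is nonzero it can be normalised, and
    the second column of the conjugator is the orthogonal vector, with eigenvalue e^*. *)
Lemma su2_diag m (a b e : C) : a * a^* + b * b^* = 1 -> b != 0 -> unitc e -> a + a^* = e + e^* ->
  exists2 V, V \is unitarymx & emb m a (- b^*) b a^* *m V = V *m emb m e 0 0 e^*.
Proof.
move=> hab b0 he htr; pose x := b^*; pose y := a - e.
pose N : R := Num.sqrt (Re x ^+ 2 + Im x ^+ 2 + (Re y ^+ 2 + Im y ^+ 2)).
have hN0 : 0 < Re x ^+ 2 + Im x ^+ 2 + (Re y ^+ 2 + Im y ^+ 2).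
  have : 0 < Re x ^+ 2 + Im x ^+ 2.
    rewrite lt_neqAle addr_ge0 ?sqr_ge0 // andbT eq_sym; apply: contra b0 => /eqP h.
    rewrite -(conjCK b) conjC_eq0 -/x; apply/eqP/complex_ext => /=; apply/eqP; rewrite -sqrf_eq0; apply/eqP; nra.
  by have := sqr_ge0 (Re y); have := sqr_ge0 (Im y); lra.
have hN : x * x^* + y * y^* = (N%:C%C) ^+ 2.
  by rewrite !mul_conjCc -rmorphXn /= sqr_sqrtr ?(ltW hN0) // -rmorphD.
have N0 : N%:C%C != 0 :> C by rewrite fmorph_eq0 gt_eqF // sqrtr_gt0.
have Nc : (N%:C%C)^* = N%:C%C :> C by rewrite cconjCE oppr0.
set k := N%:C%C in hN N0 Nc.
have kk : k^-1 ^+ 2 * (x * x^* + y * y^*) = 1 by rewrite hN -exprMn mulVf // expr1n.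
have kc : (k^-1)^* = k^-1 by rewrite fmorphV /= Nc.
exists (emb m (k^-1 * x) (- (k^-1 * y^*)) (k^-1 * y) (k^-1 * x^*)).
  have <- : (k^-1 * y)^* = k^-1 * y^* by rewrite rmorphM /= kc.
  have <- : (k^-1 * x)^* = k^-1 * x^* by rewrite rmorphM /= kc.
  apply: emb_su2; rewrite !rmorphM /= kc -kk.
  by move: (x^*) (y^*) => x' y'; ring.
have e1 : a * x - b^* * y = e * x by rewrite /x /y; ring.
have e2 : b * x + a^* * y = e * y.
  have h1 : b * x = 1 - a * a^* by rewrite -hab /x; ring.
  have h2 : e * a = e * (e + e^*) - e * a^* by rewrite -htr; ring.
  by rewrite h1 /y mulrBr [in RHS]mulrBr h2 [e * (e + _)]mulrDr he; ring.
have e3 : a * y^* + b^* * x^* = e^* * y^*.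
  by have /(congr1 Num.conj) := e2; rewrite rmorphD !rmorphM /= !conjCK => <-; rewrite /x; ring.
have e4 : a^* * x^* - b * y^* = e^* * x^*.
  by have /(congr1 Num.conj) := e1; rewrite rmorphB !rmorphM /= !conjCK => <-; ring.
rewrite !embM; apply: emb_eq.
- by transitivity (k^-1 * (a * x - b^* * y)); [ring|rewrite e1; ring].
- by transitivity (- k^-1 * (a * y^* + b^* * x^*)); [ring|rewrite e3; ring].
- by transitivity (k^-1 * (b * x + a^* * y)); [ring|rewrite e2; ring].
- by transitivity (k^-1 * (a^* * x^* - b * y^*)); [ring|rewrite e4; ring].
Qed.

End Torus.

(** * Smallness of the representation near the identity of a one-parameter torus *)

Section TorusRep.
Variables (R : realType).
Local Notation C := R[i].

Variables (m n : nat).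
Local Notation d := m.+2.
Variable phi : 'M[C]_d -> 'M[C]_n.
Hypothesis phiU : forall U, U \is unitarymx -> phi U \is unitarymx.
Hypothesis phiR : forall U, U \is unitarymx -> map_mx Num.conj (phi U) = phi U.
Hypothesis phiM : forall U V, U \is unitarymx -> V \is unitarymx -> phi (U *m V) = phi U *m phi V.
Hypothesis phiZ : forall z, unitc z -> phi z%:M = 1%:M.

Lemma unitarymx1 : (1%:M : 'M[C]_d) \is unitarymx.
Proof. by apply/unitarymxP; rewrite trmx1 map_mx1 mulmx1. Qed.

Lemma phi1 : phi 1%:M = 1%:M. Proof. exact/phiZ/unitc1. Qed.

Lemma phi_adj U : U \is unitarymx -> phi (U^t*) = (phi U)^t*.
Proof.
move=> hU; have hU' : U^t* \is unitarymx by rewrite trmxC_unitary.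
have h : phi U *m phi (U^t*) = 1%:M by rewrite -phiM // (unitarymxP hU) phi1.
rewrite -[LHS]mul1mx -(unitarymx_adjl (phiU hU)) -mulmxA h mulmx1.
by [].
Qed.

(** For unitary U this is half the squared Frobenius distance from [phi U] to the identity; written
    through the trace, it is visibly invariant under conjugation. *)
Definition tau U : R := n%:R - Re (\tr (phi U)).

Lemma tauE U : U \is unitarymx -> F2 (phi U - 1%:M) = 2 * tau U.
Proof.
move=> hU; rewrite F2_tr raddfB raddfB /= trmx1 map_mx1 mulmxBl !mulmxBr.
rewrite (unitarymxP (phiU hU)) !mulmx1 mul1mx !raddfB /= mxtrace1 /tau.
have -> : \tr ((phi U)^t*) = (\tr (phi U))^*.
  by rewrite raddf_sum; apply: eq_bigr => i _; rewrite !mxE.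
rewrite cRe_conj.
have -> : Re (n%:R : C) = n%:R by rewrite -(rmorph_nat (real_complex R)).
ring.
Qed.

Lemma tau_ge0 U : U \is unitarymx -> 0 <= tau U.
Proof. by move/tauE => h; have := F2_ge0 (phi U - 1%:M); rewrite h; lra. Qed.

(** Multiplying by the adjoint of [phi U] turns the distance from the product to 1 into the distance
    from [phi V] to that adjoint; the triangle inequality through 1, for squared norms, costs a
    factor 2. *)
Lemma tauM U V : U \is unitarymx -> V \is unitarymx -> tau (U *m V) <= 2 * tau U + 2 * tau V.
Proof.
move=> hU hV; have hUV := mul_unitarymx hU hV.
have := tauE hUV; rewrite phiM //.
have hU' : (phi U)^t* \is unitarymx by rewrite trmxC_unitary phiU.
rewrite -(F2_mul _ hU') mulmxBr mulmxA unitarymx_adjl ?phiU // mul1mx mulmx1.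
have -> : phi V - (phi U)^t* = (phi V - 1%:M) + (1%:M - (phi U)^t*) by rewrite addrA subrK.
have := F2D (phi V - 1%:M) (1%:M - (phi U)^t*).
have -> : F2 (1%:M - (phi U)^t*) = F2 (phi U - 1%:M).
  rewrite -[RHS]F2_adj raddfB raddfB /= trmx1 map_mx1.
  rewrite /F2; apply: eq_bigr => i _; apply: eq_bigr => j _.
  by rewrite !mxE !(cReD, cReN, cImD, cImN); ring.
by rewrite !tauE //; lra.
Qed.

Lemma tau_conj U V : U \is unitarymx -> V \is unitarymx -> tau (V *m U *m V^t*) = tau U.
Proof.
move=> hU hV; have hV' : V^t* \is unitarymx by rewrite trmxC_unitary.
rewrite /tau (phiM (mul_unitarymx hV hU) hV') (phiM hV hU) mxtrace_mulC mulmxA.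
by rewrite -(phiM hV' hV) (unitarymx_adjl hV) phi1 mul1mx.
Qed.

Lemma tau_adj U : U \is unitarymx -> tau (U^t*) = tau U.
Proof.
move=> hU; rewrite /tau phi_adj //.
have -> : \tr ((phi U)^t*) = (\tr (phi U))^*.
  by rewrite raddf_sum; apply: eq_bigr => i _; rewrite !mxE.
by rewrite cRe_conj.
Qed.

Definition gg (x : R) := emb m (expi x) 0 0 (expi (- x)).

Lemma gg_unitary x : gg x \is unitarymx.
Proof.
by apply: emb_unitary; rewrite ?mul0r ?mulr0 ?addr0 ?add0r ?rmorph0 ?mulr0 //; exact: unitc_expi.
Qed.

Lemma ggM x y : gg x *m gg y = gg (x + y).
Proof. by rewrite /gg embM !mul0r !mulr0 !addr0 !add0r opprD -!expiD. Qed.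

Lemma gg_adj x : (gg x)^t* = gg (- x).
Proof. by rewrite emb_adj rmorph0 -!expiN. Qed.

(** Two of the sample points [gg (k/N)] have close images by the pigeonhole; their quotient is the
    required [gg x], with x at most 1. *)
Lemma gg_small (e : R) : 0 < e -> exists2 x, 0 < x <= 1 & tau (gg x) <= e.
Proof.
move=> e0; have [N hN] := pigeonhole n (mulr_gt0 (ltr0Sn R 1) e0).
have [|k [l [kl lN hF]]] := hN (fun k => phi (gg (k%:R / N%:R))).
  by move=> k; split; [apply/phiU/gg_unitary|apply/phiR/gg_unitary].
have N0 : 0 < N%:R :> R by rewrite ltr0n; case: (N) lN kl => //; case: (l).
exists ((l%:R - k%:R) / N%:R).
  rewrite ler_pdivrMr // divr_gt0 // ?mul1r ?subr_gt0 ?ltr_nat //=.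
  by rewrite -[leRHS]subr0 lerB ?ler_nat // ler0n.
set x := (l%:R - k%:R) / N%:R.
have e1 : gg (l%:R / N%:R) = gg (k%:R / N%:R) *m gg x.
  by rewrite ggM; congr gg; rewrite /x; field; rewrite gt_eqF.
have : F2 (phi (gg (k%:R / N%:R)) - phi (gg (l%:R / N%:R))) = 2 * tau (gg x).
  rewrite -tauE ?gg_unitary // e1 phiM ?gg_unitary //.
  rewrite -{1}[phi (gg (k%:R / N%:R))]mulmx1 -mulmxBr F2_mul ?phiU ?gg_unitary //.
  rewrite /F2; apply: eq_bigr => i _; apply: eq_bigr => j _.
  by rewrite !mxE !(cReD, cReN, cImD, cImN); ring.
by move=> h; rewrite h in hF; lra.
Qed.

(* gg x times a conjugate of its inverse has eigenvalues expi (+-y) with y varying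
   continuously from 0 as the conjugating rotation does. *)
Lemma gg_le x y : 0 < x <= 1 -> `|y| <= x -> tau (gg y) <= 4 * tau (gg x).
Proof.
move=> /andP[x0 x1] yx; have t0 := tau_ge0 (gg_unitary x).
case: (eqVneq y 0) => [->|y0].
  have -> : tau (gg 0) = 0; last by lra.
  have -> : gg 0 = 1%:M by rewrite /gg oppr0 expi0 emb1.
  by rewrite /tau phi1 mxtrace1 -(rmorph_nat (real_complex R)) /= subrr.
have p2 := @pi_ge2 R.
have hc1 : cos y < 1.
  rewrite -cos_norm -[ltRHS]cos0 ltr_cos ?in_itv /= ?normr_ge0 ?normr_gt0 ?lexx //=; lra.
have hc2 : cos (x *+ 2) < cos y.
  rewrite -(cos_norm y) ltr_cos ?in_itv /= ?normr_ge0 ?mulr2n //=; lra.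
(* Squared sine of the rotation angle, solved from 1 - cos y = s2 (1 - cos 2x), so that the 2 by 2
   block of the product below has trace 2 cos y. It is less than 1 because |y| < 2x. *)
pose s2 := (1 - cos y) / (1 - cos (x *+ 2)).
have hs0 : 0 < s2 by rewrite divr_gt0 //; lra.
have hs1 : s2 < 1 by rewrite ltr_pdivrMr; lra.
pose sn := (Num.sqrt s2)%:C%C : C; pose cs := (Num.sqrt (1 - s2))%:C%C : C.
have hsn : sn ^+ 2 = (s2)%:C%C by rewrite -rmorphXn /= sqr_sqrtr ?ltW.
have hcs : cs ^+ 2 = 1 - (s2)%:C%C by rewrite -rmorphXn /= sqr_sqrtr ?rmorphB //; lra.
have snc : sn^* = sn by rewrite cconjCE oppr0.
have csc : cs^* = cs by rewrite cconjCE oppr0.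
have hsc : cs * cs + sn * sn = 1 by rewrite -!expr2 hsn hcs subrK.
pose K := emb m cs (- sn) sn cs.
have hK : K \is unitarymx.
  by apply: emb_unitary; rewrite ?rmorphN /= ?snc ?csc -?hsc; ring.
pose a : C := cs ^+ 2 + sn ^+ 2 * expi (x *+ 2).
pose b : C := cs * sn * (expi (- (x *+ 2)) - 1).
pose u := expi x; have hu : u * u^* = 1 by exact: unitc_expi.
have e2 : expi (x *+ 2) = u * u by rewrite mulr2n expiD.
have e2N : expi (- (x *+ 2)) = u^* * u^* by rewrite expiN e2 rmorphM.
have hS : gg x *m (K *m gg (- x) *m K^t*) = emb m a (- b^*) b a^*.
  rewrite /gg /K emb_adj !embM opprK expiN -/u rmorphN /= snc csc /a /b e2 e2N.
  rewrite ?(rmorphD, rmorphB, rmorphM, rmorphXn, rmorph1) /= !conjCK ?snc ?csc.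
  apply: emb_eq.
  - by transitivity (cs ^+ 2 * (u * u^*) + sn ^+ 2 * (u * u)); [ring|rewrite hu; ring].
  - by transitivity (- (cs * sn * (u * u - u * u^*))); [ring|rewrite hu; ring].
  - by transitivity (cs * sn * (u^* * u^* - u * u^*)); [ring|rewrite hu; ring].
  - by transitivity (cs ^+ 2 * (u * u^*) + sn ^+ 2 * (u^* * u^*)); [ring|rewrite hu; ring].
have hab : a * a^* + b * b^* = 1.
  rewrite /a /b e2 e2N ?(rmorphD, rmorphB, rmorphM, rmorphXn, rmorph1) /= !conjCK ?snc ?csc.
  have huu : u * u * (u^* * u^*) = 1 by rewrite mulrACA hu mulr1.
  transitivity ((cs * cs + sn * sn * (u * u * (u^* * u^*))) * (cs * cs + sn * sn) ); last by rewrite huu mulr1 hsc mulr1.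
  transitivity (cs ^+ 4 + sn ^+ 4 * (u * u * (u^* * u^*)) + cs ^+ 2 * sn ^+ 2 * (u * u * (u^* * u^*) + 1)); first by ring.
  by rewrite huu; ring.
have b0 : b != 0.
  have cs0 : cs != 0 by rewrite fmorph_eq0 gt_eqF // sqrtr_gt0 subr_gt0.
  have sn0 : sn != 0 by rewrite fmorph_eq0 gt_eqF // sqrtr_gt0.
  rewrite /b mulf_neq0 //; first exact: mulf_neq0.
  apply/eqP => /(congr1 (@complex.Re R)); rewrite cReD cReN /= cosN => h.
  by have := cos_le1 y; lra.
have htr : a + a^* = expi y + (expi y)^*.
  rewrite /a hsn hcs; apply: complex_ext;
    rewrite !(cReD, cImD, cRe_conj, cIm_conj, cReM, cImM, cReN, cImN) /=; last by ring.
  rewrite /s2; field; lra.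
have [V hV eV] := su2_diag m hab b0 (unitc_expi y) htr.
have eS : gg x *m (K *m gg (- x) *m K^t*) = V *m gg y *m V^t*.
  by rewrite hS -expiN in eV *; rewrite -eV -mulmxA (unitarymxP hV) mulmx1.
have hK' : K^t* \is unitarymx by rewrite trmxC_unitary; exact: hK.
have hT := mul_unitarymx (mul_unitarymx hK (gg_unitary (- x))) hK'.
(* Conjugation and inversion preserve [tau], so both factors count as [tau phi (gg x)], which gives
   the constant 2 + 2. *)
have h1 := tauM (gg_unitary x) hT.
rewrite eS (tau_conj (gg_unitary y) hV) (tau_conj (gg_unitary (- x)) hK) in h1.
by rewrite -gg_adj (tau_adj (gg_unitary x)) in h1; lra.
Qed.

End TorusRep.

(** * Integral weights of the diagonal torus *)

Section TorusWeights.
Variables (R : realType).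
Local Notation C := R[i].
Variables (m n : nat).
Local Notation d := m.+2.
Variable phi : 'M[C]_d -> 'M[C]_n.
Hypothesis phiU : forall U, U \is unitarymx -> phi U \is unitarymx.
Hypothesis phiR : forall U, U \is unitarymx -> map_mx Num.conj (phi U) = phi U.
Hypothesis phiM : forall U V, U \is unitarymx -> V \is unitarymx -> phi (U *m V) = phi U *m phi V.
Hypothesis phiZ : forall z, unitc z -> phi z%:M = 1%:M.

Lemma emb_dg (a e : C) : emb m a 0 0 e = dg (fun k : 'I_d => if k == 0 then a else if k == 1 then e else 1).
Proof.
have h2 : mx2 a 0 0 e = diag_mx (\row_(k < 2) if k == 0 then a else e).
  apply/matrixP => i j; rewrite /mx2 !mxE.
  case: (@splitP 1 1 i) => i' hi; rewrite ?mxE; case: (@splitP 1 1 j) => j' hj;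
    by rewrite ?mxE -?val_eqE /= ?hi ?hj ?ord1 /= ?eqxx ?mulr1n ?mulr0n.
rewrite /emb h2 /dg; apply/matrixP => i j; rewrite !mxE.
case: (@splitP 2 m i) => i' hi; rewrite !mxE; case: (@splitP 2 m j) => j' hj; rewrite !mxE -!val_eqE /= hi hj.
- by case: i' hi => [[|[|]]].
- have -> : (nat_of_ord i' == 2 + j')%N = false by have := ltn_ord i'; lia.
  by rewrite mulr0n.
- have -> : (2 + i' == nat_of_ord j')%N = false by have := ltn_ord j'; lia.
  by rewrite mulr0n.
- by rewrite eqn_add2l.
Qed.

Lemma perm_mx_unitary p (s : 'S_p) : (perm_mx s : 'M[C]_p) \is unitarymx.
Proof.
apply/unitarymxP; rewrite tr_perm_mx map_perm_mx -perm_mxM mulgV.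
exact: perm_mx1.
Qed.

Lemma perm_mx_adj p (s : 'S_p) : (perm_mx s : 'M[C]_p)^t* = perm_mx (s^-1)%g.
Proof. by rewrite tr_perm_mx map_perm_mx. Qed.

Lemma perm_mx_conj p (s : 'S_p) (A : 'M[C]_p) :
  perm_mx s *m A *m (perm_mx s)^t* = \matrix_(i, j) A (s i) (s j).
Proof.
rewrite perm_mx_adj -row_permE -[(s^-1)%g]invgK; rewrite -col_permE invgK.
by apply/matrixP => i j; rewrite !mxE.
Qed.

Lemma perm_mx_dg p (s : 'S_p) (f : 'I_p -> C) :
  perm_mx s *m dg f *m (perm_mx s)^t* = dg (fun i => f (s i)).
Proof. by rewrite perm_mx_conj; apply/matrixP => i j; rewrite !mxE (inj_eq perm_inj). Qed.

Definition gij (i j : 'I_d) (x : R) : 'I_d -> C :=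
  fun k => if k == i then expi x else if k == j then expi (- x) else 1.

Lemma gij_unit i j x k : unitc (gij i j x k).
Proof. by rewrite /gij; case: eqP => _; [|case: eqP => _]; (exact: unitc_expi || exact: unitc1). Qed.

Lemma tau_gij i j x : i != j -> tau phi (dg (gij i j x)) = tau phi (gg m x).
Proof.
move=> ij; have [s [si sj]] := perm2 ij (isT : (0 : 'I_d) != 1).
rewrite -(tau_conj phiM phiZ (gg_unitary m x) (perm_mx_unitary s)).
rewrite /gg emb_dg perm_mx_dg; congr (tau _ (dg _)); apply/funext => k.
by rewrite /gij -si -sj !(inj_eq perm_inj).
Qed.

Lemma gij_small (e : R) : 0 < e -> exists2 dl, 0 < dl & forall i j x, i != j -> `|x| <= dl ->
  tau phi (dg (gij i j x)) <= e.
Proof.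
move=> e0; have e4 : 0 < e / 4 by lra.
have [x hx ht] := gg_small phiU phiR phiM e4.
exists x; first by case/andP: hx.
move=> i j y ij hy; rewrite tau_gij //.
move: ht (gg_le phiU phiM phiZ hx hy).
by move: (tau phi (gg m x)) (tau phi (gg m y)) => a b h1 h2; lra.
Qed.

Definition hk (k : 'I_d) (x : R) : 'I_d -> C := fun l => if l == k then expi x else 1.

Lemma hk_unit k x l : unitc (hk k x l).
Proof. by rewrite /hk; case: eqP => _; (exact: unitc_expi || exact: unitc1). Qed.

(** Each joint eigenvalue is a character of the torus. On the elements [gij] it is close to 1 for
    small arguments, hence exponential; the remaining diagonal elements are obtained from these and
    the scalars, on which [phi] is trivial. *)
Lemma torus_weights : exists2 P : 'M[C]_n, P \in unitmx & exists wt : 'I_n -> 'I_d -> int,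
  forall k x, P *m phi (dg (hk k x)) = diag_mx (\row_a expi ((wt a k)%:~R * x)) *m P.
Proof.
pose T := {f : 'I_d -> C | forall i, unitc (f i)}.
have fU (t : T) : dg (sval t) \is unitarymx by apply: dg_unitary; case: t.
have dgC (f g : 'I_d -> C) : dg f *m dg g = dg g *m dg f.
  by rewrite !dgM; congr dg; apply/funext => i; rewrite mulrC.
have [P Pu hP] : exists2 P, P \in unitmx & forall t : T, is_diag_mx (P *m phi (dg (sval t)) *m invmx P).
  apply: codiag_family => [t|s t]; first exact/phiU/fU.
  by rewrite -(phiM (fU s) (fU t)) dgC (phiM (fU t) (fU s)).
exists P => //.
pose chi a f := (P *m phi (dg f) *m invmx P) a a.
have chiE f : (forall i, unitc (f i)) -> P *m phi (dg f) *m invmx P = diag_mx (\row_a chi a f).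
  move=> hf; have /is_diag_mxP h := hP (exist _ f hf : T).
  apply/matrixP => i j; rewrite [RHS]mxE; case: (eqVneq i j) => [<-|ij]; first by rewrite mulr1n [RHS]mxE.
  by rewrite mulr0n; exact: h.
have chiP f : (forall i, unitc (f i)) -> P *m phi (dg f) = diag_mx (\row_a chi a f) *m P.
  by move=> hf; rewrite -chiE // mulmxKV.
have chiM a f g : (forall i, unitc (f i)) -> (forall i, unitc (g i)) ->
    chi a (fun i => f i * g i) = chi a f * chi a g.
  move=> hf hg; rewrite {1}/chi -dgM (phiM (dg_unitary hf) (dg_unitary hg)).
  rewrite mulmxA (chiP _ hf) -!mulmxA [P *m _]mulmxA (chiE _ hg) mul_diag_mx !mxE.
  by rewrite eqxx mulr1n.
have chi1 a : chi a (fun=> 1) = 1.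
  rewrite /chi; have -> : dg (fun=> 1) = 1%:M :> 'M[C]_d.
    by apply/matrixP => i j; rewrite !mxE.
  by rewrite (phi1 phiZ) mulmx1 mulmxV // mxE eqxx.
have chiZ a z : unitc z -> chi a (fun=> z) = 1.
  move=> hz; rewrite /chi; have -> : dg (fun=> z) = z%:M :> 'M[C]_d.
    by apply/matrixP => i j; rewrite !mxE.
  by rewrite phiZ // mulmx1 mulmxV // mxE eqxx.
have chiU a f : (forall i, unitc (f i)) -> unitc (chi a f).
  move=> hf; pose p := row a P.
  have p0 : p != 0.
    apply/eqP => h; have : row a (P *m invmx P) = 0 by rewrite row_mul -/p h mul0mx.
    by rewrite mulmxV // => /matrixP/(_ 0 a); rewrite !mxE eqxx => /eqP; rewrite oner_eq0.
  have e1 : p *m phi (dg f) = chi a f *: p.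
    rewrite /p -row_mul chiP // row_mul row_diag_mx -scalemxAl -rowE mxE.
    by [].
  have hu := phiU (dg_unitary hf).
  have : (p *m phi (dg f)) *m (p *m phi (dg f))^t* = p *m p^t*.
    by rewrite trmx_mul map_mxM mulmxA -[p *m _ *m _]mulmxA (unitarymxP hu) mulmx1.
  rewrite e1 linearZ /= map_mxZ -scalemxAl -scalemxAr scalerA.
  have hpp : (p *m p^t*) 0 0 != 0.
    have := sqn_gt0 (x := p^t*); rewrite trmxCK => h; rewrite gt_eqF // h //.
    by apply: contra p0 => /eqP h0; rewrite -(trmxCK p) h0 trmx0 map_mx0.
  move/matrixP/(_ 0 0); rewrite mxE => /eqP; rewrite -subr_eq0 -{2}[(p *m p^t*) 0 0]mul1r -mulrBl mulf_eq0 (negPf hpp) orbF subr_eq0.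
  by move/eqP.
(* The eigenvalues lie on the unit circle, so [tau] is a sum of nonnegative terms 1 - Re and
   dominates each of them. *)
have chi_tau a f : (forall i, unitc (f i)) -> 1 - Re (chi a f) <= tau phi (dg f).
  move=> hf; rewrite /tau.
  have -> : \tr (phi (dg f)) = \sum_a chi a f.
    have -> : \tr (phi (dg f)) = \tr (P *m phi (dg f) *m invmx P).
      by rewrite mxtrace_mulC mulmxA mulVmx // mul1mx.
    by rewrite chiE // mxtrace_diag; apply: eq_bigr => b _; rewrite mxE.
  have -> : n%:R = \sum_(b < n) 1 :> R by rewrite sumr_const card_ord.
  rewrite cRe_sum -sumrB (bigD1 a) //= lerDl sumr_ge0 // => b _.
  have /unitcE := chiU b _ hf; move: (Re _) (Im _) => u v h; nra.
(* Complement of the threshold 9/10 required by [char_exp]. *)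
have e10 : 0 < 1 / 10 :> R by lra.
have [dl dl0 hdl] := gij_small e10.
have exq a i j : exists q, i != j -> forall x, chi a (gij i j x) = expi (q * x).
  case: (boolP (i != j)) => [ij|]; last by exists 0.
  have [|x|x hx|q hq] := @char_exp R (fun x => chi a (gij i j x)) dl _ _ dl0.
  - move=> x y; rewrite -chiM; try exact: gij_unit.
    congr chi; apply/funext => k; rewrite /gij opprD; case: eqP => _; first exact: expiD.
    by case: eqP => _; [exact: expiD | rewrite mulr1].
  - exact/chiU/gij_unit.
  - have := chi_tau a _ (gij_unit i j x); have := hdl _ _ _ ij hx; lra.
  by exists q.
(* [hk k x] is the scalar e^(ix/d) times the product over j different from k of [gij k j (x/d)]: at
   place k the exponents add up to x, at every other place they cancel. *)
have exQ a k : exists Q, forall x, chi a (hk k x) = expi (Q * x).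
  have /choice[q hq] := exq a k.
  exists (\sum_(j | k != j) q j / d%:R) => x.
  have hprod (r : seq 'I_d) : chi a (fun i => \prod_(j <- r | k != j) gij k j (x / d%:R) i)
      = \prod_(j <- r | k != j) expi (q j * (x / d%:R)) /\
      forall i, unitc (\prod_(j <- r | k != j) gij k j (x / d%:R) i).
    elim: r => [|j r [IH IHu]].
      split=> [|i]; last by rewrite big_nil; exact: unitc1.
      by rewrite big_nil -(chi1 a); congr chi; apply/funext => i; rewrite big_nil.
    case: (boolP (k != j)) => kj; last first.
      split=> [|i]; last by rewrite big_cons (negPf kj).
      by rewrite big_cons (negPf kj) -IH; congr chi; apply/funext => i; rewrite big_cons (negPf kj).
    split=> [|i]; last by rewrite big_cons kj; apply: unitcM => //; exact: gij_unit.
    rewrite big_cons kj -IH -(hq j kj) -(chiM a _ _ (gij_unit k j (x / d%:R)) IHu).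
    by congr chi; apply/funext => i; rewrite big_cons kj.
  have [h1 h2] := hprod (index_enum 'I_d).
  have d0 : d%:R != 0 :> R by rewrite pnatr_eq0.
  rewrite mulr_suml expi_sum.
  rewrite (eq_bigr (fun j => expi (q j * (x / d%:R)))); last by move=> j _; congr expi; ring.
  pose G i := \prod_(j | k != j) gij k j (x / d%:R) i.
  have e1 : chi a (fun i => expi (x / d%:R) * G i) = \prod_(j | k != j) expi (q j * (x / d%:R)).
    by rewrite (chiM a _ G (fun=> unitc_expi (x / d%:R)) h2) (chiZ a _ (unitc_expi (x / d%:R))) mul1r.
  rewrite -e1 /G {e1 h1 h2 G hprod}.
  congr chi; apply/funext => l; rewrite /hk; case: (eqVneq l k) => [->|lk].
    rewrite (eq_bigr (fun=> expi (x / d%:R))); last by move=> j _; rewrite /gij eqxx.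
    rewrite big_const -(big_const 1 *%R) -expi_sum -expiD; congr expi.
    rewrite sumr_const.
    have -> : #|[pred i | k != i]| = m.+1.
      rewrite (eq_card (B := predC1 k)) ?cardC1 ?card_ord // => i.
      by rewrite !inE eq_sym.
    by rewrite -mulrS -[RHS]mulr_natr divfK.
  rewrite (bigD1 l) 1?eq_sym //= big1 => [|j /andP[kj jl]]; last first.
    by rewrite /gij (negPf lk) [l == j]eq_sym (negPf jl).
  by rewrite /gij (negPf lk) eqxx mulr1 expiN; apply/esym/unitc_expi.
(* Integrality: at x = 2 pi the matrix [dg (hk k x)] is the identity. *)
have exw a k : exists w : int, forall x, chi a (hk k x) = expi (w%:~R * x).
  have [Q hQ] := exQ a k; have [|w hw] := @expi_eq1_int R Q; last by exists w; rewrite -hw.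
  rewrite -hQ -(chi1 a); congr chi; apply/funext => l; rewrite /hk expi_pi2.
  by case: eqP.
have /choice[wt hwt] : forall a, exists wt, forall k x, chi a (hk k x) = expi ((wt k)%:~R * x).
  by move=> a; have /choice[w hw] := exw a; exists w.
exists wt => k x; rewrite chiP; last exact: hk_unit.
by congr (diag_mx _ *m _); apply/matrixP => i j; rewrite !mxE.
Qed.

End TorusWeights.

(** * Norm estimates for complex matrices and exponentials *)

Section Norm.
Variables (R : realType).
Local Notation C := R[i].
Implicit Types (z w : C).

(** An l1 norm on the complex numbers. Unlike the modulus of [R[i]], which is again an element of
    [R[i]], it takes values in [R], and it is submultiplicative. *)
Definition nz z : R := `|Re z| + `|Im z|.

Lemma nz_ge0 z : 0 <= nz z. Proof. by rewrite addr_ge0. Qed.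
Lemma nz0 : nz 0 = 0. Proof. by rewrite /nz normr0 addr0. Qed.
Lemma nzN z : nz (- z) = nz z. Proof. by rewrite /nz cReN cImN !normrN. Qed.
Lemma nz_conj z : nz z^* = nz z. Proof. by rewrite /nz cRe_conj cIm_conj normrN. Qed.
Lemma nzD z w : nz (z + w) <= nz z + nz w.
Proof.
rewrite /nz cReD cImD; have := ler_normD (Re z) (Re w); have := ler_normD (Im z) (Im w); lra.
Qed.
Lemma nzM z w : nz (z * w) <= nz z * nz w.
Proof.
rewrite /nz cReM cImM.
have h1 := ler_normB (Re z * Re w) (Im z * Im w).
have h2 := ler_normD (Re z * Im w) (Im z * Re w).
rewrite !normrM in h1 h2; rewrite mulrDl !mulrDr; lra.
Qed.
Lemma nz_it t z : nz (Complex 0 t * z) = `|t| * nz z.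
Proof. by rewrite /nz cReM cImM /= !mul0r ?add0r ?sub0r ?addr0 normrN !normrM; ring. Qed.
Lemma nz_real x : nz (x%:C%C) = `|x|.
Proof. by rewrite /nz /= normr0 addr0. Qed.
Lemma nz_eq0 z : nz z = 0 -> z = 0.
Proof.
rewrite /nz => h; apply: complex_ext => /=; apply/eqP; rewrite -normr_eq0; apply/eqP;
have := normr_ge0 (Re z); have := normr_ge0 (Im z); lra.
Qed.
Lemma nz_unit z : unitc z -> nz z <= 2.
Proof.
move=> /unitcE h; rewrite /nz; suff : `|Re z| <= 1 /\ `|Im z| <= 1 by lra.
by split; rewrite ler_norml; apply/andP; split; nra.
Qed.

Definition nrm p q (A : 'M[C]_(p, q)) : R := \sum_i \sum_j nz (A i j).

Lemma nrm_ge0 p q (A : 'M[C]_(p, q)) : 0 <= nrm A.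
Proof. by apply: sumr_ge0 => i _; apply: sumr_ge0 => j _; exact: nz_ge0. Qed.
Lemma nrm0 p q : nrm (0 : 'M[C]_(p, q)) = 0.
Proof. by rewrite /nrm big1 // => i _; rewrite big1 // => j _; rewrite mxE nz0. Qed.
Lemma nrmD p q (A B : 'M[C]_(p, q)) : nrm (A + B) <= nrm A + nrm B.
Proof.
rewrite /nrm -big_split; apply: ler_sum => i _; rewrite -big_split; apply: ler_sum => j _.
by rewrite mxE nzD.
Qed.
Lemma nrmN p q (A : 'M[C]_(p, q)) : nrm (- A) = nrm A.
Proof. by apply: eq_bigr => i _; apply: eq_bigr => j _; rewrite mxE nzN. Qed.
Lemma nrmB p q (A B : 'M[C]_(p, q)) : nrm (A - B) <= nrm A + nrm B.
Proof. by rewrite -(nrmN B) nrmD. Qed.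
Lemma nrm_entry p q (A : 'M[C]_(p, q)) i j : nz (A i j) <= nrm A.
Proof.
rewrite /nrm (bigD1 i) //= (bigD1 j) //= -addrA lerDl addr_ge0 ?sumr_ge0 // => k _;
  by rewrite ?sumr_ge0 ?nz_ge0 // => l _; exact: nz_ge0.
Qed.
Lemma nrm_eq0 p q (A : 'M[C]_(p, q)) : nrm A = 0 -> A = 0.
Proof.
move=> h; apply/matrixP => i j; rewrite mxE; apply: nz_eq0.
by apply/eqP; rewrite eq_le nz_ge0 andbT -h nrm_entry.
Qed.
Lemma nrmZ p q c (A : 'M[C]_(p, q)) : nrm (c *: A) <= nz c * nrm A.
Proof.
rewrite /nrm mulr_sumr; apply: ler_sum => i _; rewrite mulr_sumr; apply: ler_sum => j _.
by rewrite mxE nzM.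
Qed.
Lemma nrm_it p q t (A : 'M[C]_(p, q)) : nrm (Complex 0 t *: A) = `|t| * nrm A.
Proof.
rewrite /nrm mulr_sumr; apply: eq_bigr => i _; rewrite mulr_sumr; apply: eq_bigr => j _.
by rewrite mxE nz_it.
Qed.
Lemma nz_sum (I : Type) (r : seq I) (P : pred I) (F : I -> C) :
  nz (\sum_(i <- r | P i) F i) <= \sum_(i <- r | P i) nz (F i).
Proof.
elim/big_ind2: _ => [|x1 x2 y1 y2 h1 h2|//]; first by rewrite nz0.
exact: le_trans (nzD _ _) (lerD h1 h2).
Qed.
Lemma nrm_sum p q (I : Type) (r : seq I) (P : pred I) (F : I -> 'M[C]_(p, q)) :
  nrm (\sum_(i <- r | P i) F i) <= \sum_(i <- r | P i) nrm (F i).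
Proof.
elim/big_ind2: _ => [|x1 x2 y1 y2 h1 h2|//]; first by rewrite nrm0.
exact: le_trans (nrmD _ _) (lerD h1 h2).
Qed.
Lemma nrmM p q r (A : 'M[C]_(p, q)) (B : 'M[C]_(q, r)) : nrm (A *m B) <= nrm A * nrm B.
Proof.
rewrite /nrm mulr_suml; apply: ler_sum => i _.
have h j : nz ((A *m B) i j) <= \sum_k nz (A i k) * nz (B k j).
  by rewrite mxE (le_trans (nz_sum _ _ _)) //; apply: ler_sum => k _; exact: nzM.
apply: (@le_trans _ _ (\sum_j \sum_k nz (A i k) * nz (B k j))); first exact: ler_sum.
rewrite exchange_big mulr_suml; apply: ler_sum => k _; rewrite -mulr_sumr ler_wpM2l ?nz_ge0 //.
by rewrite [leRHS](bigD1 k) //= lerDl sumr_ge0 // => l _; apply: sumr_ge0 => ? _; exact: nz_ge0.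
Qed.
Lemma nrm_adj p q (A : 'M[C]_(p, q)) : nrm (A^t*) = nrm A.
Proof.
rewrite /nrm exchange_big; apply: eq_bigr => i _; apply: eq_bigr => j _.
by rewrite !mxE nz_conj.
Qed.
Lemma nrm_conj p q (A : 'M[C]_(p, q)) : nrm (map_mx Num.conj A) = nrm A.
Proof. by apply: eq_bigr => i _; apply: eq_bigr => j _; rewrite mxE nz_conj. Qed.

Definition kap (p : nat) : R := \sum_(i < p) \sum_(j < p) 2.
Lemma kap_ge0 p : 0 <= kap p.
Proof. by apply: sumr_ge0 => i _; apply: sumr_ge0. Qed.
Lemma nrm_unitary p (U : 'M[C]_p) : U \is unitarymx -> nrm U <= kap p.
Proof.
move=> hU; apply: ler_sum => i _; apply: ler_sum => j _.
have := unitarymx_entry i j hU; rewrite /nz => h.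
suff : `|Re (U i j)| <= 1 /\ `|Im (U i j)| <= 1 by lra.
by move: (Re _) (Im _) h => a b h; split; rewrite ler_norml; apply/andP; split; nra.
Qed.

Lemma nrm_conjugate p (U A : 'M[C]_p) : U \is unitarymx -> nrm (U *m A *m U^t*) <= kap p * kap p * nrm A.
Proof.
move=> hU; have h1 := nrm_unitary hU.
have h2 : nrm (U^t*) <= kap p by rewrite nrm_adj.
apply: le_trans (nrmM _ _) _; rewrite mulrAC ler_pM ?nrm_ge0 //.
by apply: le_trans (nrmM _ _) _; rewrite ler_wpM2r ?nrm_ge0.
Qed.

Lemma nz_expi_nat (k : nat) x : nz (expi (k%:R * x) - 1) <= 2 * k%:R * nz (expi x - 1).
Proof.
elim: k => [|k IH]; first by rewrite mul0r expi0 subrr nz0 mulr0 mul0r.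
have -> : expi (k.+1%:R * x) - 1 = expi (k%:R * x) * (expi x - 1) + (expi (k%:R * x) - 1).
  by rewrite -natr1 mulrDl mul1r expiD; ring.
apply: le_trans (nzD _ _) _.
have key (a b c e f : R) : c <= 2 * f * a -> 0 <= a -> b <= 2 -> e <= b * a ->
    e + c <= 2 * (f + 1) * a.
  move=> h1 h2 h3 h4; have : b * a <= 2 * a by rewrite ler_wpM2r.
  by lra.
rewrite -[k.+1%:R]natr1; apply: key IH (nz_ge0 _) (nz_unit (unitc_expi (k%:R * x))) (nzM _ _).
Qed.

Lemma nz_expi_int (w : int) x : nz (expi (w%:~R * x) - 1) <= 2 * `|w|%:~R * nz (expi x - 1).
Proof.
case: w => k; first exact: nz_expi_nat.
have -> : expi ((Negz k)%:~R * x) - 1 = (expi (k.+1%:R * x) - 1)^*.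
  by rewrite NegzE rmorphN mulNr expiN rmorphB rmorph1.
by rewrite nz_conj; exact: nz_expi_nat.
Qed.

Lemma nz_expi_nat2 (k : nat) x : nz (expi (k%:R * x) - 1 - k%:R * (expi x - 1)) <=
  2 * k%:R * k%:R * nz (expi x - 1) ^+ 2.
Proof.
elim: k => [|k IH]; first by rewrite !mul0r expi0 subrr subrr nz0 !mulr0 mul0r.
have -> : expi (k.+1%:R * x) - 1 - k.+1%:R * (expi x - 1) =
  (expi (k%:R * x) - 1) * (expi x - 1) + (expi (k%:R * x) - 1 - k%:R * (expi x - 1)).
  by rewrite -natr1 mulrDl mul1r expiD -[k.+1%:R]natr1; ring.
apply: le_trans (nzD _ _) _.
have key (a b c e f : R) : c <= 2 * f * f * a ^+ 2 -> 0 <= f -> b <= 2 * f * a -> 0 <= a -> e <= b * a ->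
    e + c <= 2 * (f + 1) * (f + 1) * a ^+ 2.
  move=> h1 h2 h3 h4 h5; have : b * a <= 2 * f * a ^+ 2 by rewrite expr2 mulrA ler_wpM2r.
  by have := sqr_ge0 a; nra.
rewrite -[k.+1%:R]natr1; exact: key IH (ler0n _ _) (nz_expi_nat k x) (nz_ge0 _) (nzM _ _).
Qed.

(** Expansion in u = e^(ix) - 1 rather than in x, so no derivative of the exponential enters. For
    negative w the conjugate of the positive case is corrected by the identity u + u^* = - u u^* on
    the unit circle. *)
Lemma nz_expi_int2 (w : int) x : nz (expi (w%:~R * x) - 1 - w%:~R * (expi x - 1)) <=
  (2 * `|w|%:~R * `|w|%:~R + 2 * `|w|%:~R) * nz (expi x - 1) ^+ 2.
Proof.
have a0 := sqr_ge0 (nz (expi x - 1)).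
case: w => k.
  apply: le_trans (nz_expi_nat2 k x) _; rewrite /= -[k%:~R]/(k%:R).
  have := ler0n R k; move: (_ ^+ 2) a0 k%:R => a ha f hf; nra.
set u := expi x - 1.
have e1 : expi ((Negz k)%:~R * x) - 1 - (Negz k)%:~R * u =
    (expi (k.+1%:R * x) - 1 - k.+1%:R * u)^* + k.+1%:R * (u * (- u^*)).
  have hx : expi x * (expi x)^* = 1 := unitc_expi x.
  rewrite NegzE rmorphN mulNr expiN mulrNz /u !rmorphB !rmorphM !rmorphB !rmorph1 /= conjC_nat.
  rewrite -[k.+1%:~R]/(k.+1%:R).
  transitivity ((expi (k.+1%:R * x))^* - 1 + k.+1%:R * (expi x - 1) + k.+1%:R * (1 - expi x * (expi x)^*)).
    by rewrite hx; ring.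
  by ring.
rewrite e1; apply: le_trans (nzD _ _) _; rewrite nz_conj.
have h1 := nz_expi_nat2 k.+1 x; rewrite -/u in h1.
have h2 : nz (k.+1%:R * (u * - u^*)) <= k.+1%:R * (nz u * nz u).
  apply: le_trans (nzM _ _) _.
  have -> : nz (k.+1%:R : C) = k.+1%:R.
    by rewrite -(rmorph_nat (real_complex R)) nz_real ger0_norm.
  rewrite ler_wpM2l //; apply: le_trans (nzM _ _) _; by rewrite nzN nz_conj.
rewrite -expr2 in h2; rewrite /= -[(k.+1)%:~R]/(k.+1%:R).
have := ler0n R k.+1; rewrite -/u in a0; move: (nz u ^+ 2) a0 (k.+1%:R) h1 h2 => a ha f h1 h2 hf.
by set b := nz _ in h1 *; set c := nz _ in h2 *; move: b c h1 h2 => b c h1 h2; nra.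
Qed.

Lemma unitc_expiP z : unitc z -> exists x, z = expi x.
Proof.
move=> /unitcE h.
have h1 : -1 <= Re z <= 1 by move: (Re z) (Im z) h => a b h; apply/andP; split; nra.
have hs := sin_acos h1; have hc : cos (acos (Re z)) = Re z by apply: acosK; rewrite in_itv.
have e : 1 - Re z ^+ 2 = Im z ^+ 2 by rewrite -h; ring.
rewrite e sqrtr_sqr in hs.
case: (lerP 0 (Im z)) => hI.
  by exists (acos (Re z)); apply: complex_ext; rewrite /= ?hc // hs ger0_norm.
exists (- acos (Re z)); apply: complex_ext; rewrite /= ?cosN ?sinN ?hc //.
by rewrite hs ltr0_norm // opprK.
Qed.

(** The point is the Cayley transform (1 + it/2) / (1 - it/2), which lies on the unit circle and
    agrees with 1 + it up to order t^2. *)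
Lemma cayley (t : R) : exists x, nz (expi x - 1 - Complex 0 t) <= t ^+ 2 /\ nz (expi x - 1) <= 2 * `|t|.
Proof.
pose D := 1 + t ^+ 2 / 4.
have D0 : 1 <= D by rewrite /D; have := sqr_ge0 t; lra.
have D0' : D != 0 by rewrite gt_eqF //; lra.
pose z : C := Complex ((1 - t ^+ 2 / 4) / D) (t / D).
have hz : unitc z.
  by apply/unitcE; rewrite /= !expr_div_n -mulrDl -[RHS](@mulfV _ (D ^+ 2)) ?expf_neq0 //; congr (_ / _); rewrite /D; field.
have hD : t ^+ 2 = 4 * (D - 1) by rewrite /D; field.
have [x hx] := unitc_expiP hz; exists x; rewrite -hx.
have e1 : z - 1 - Complex 0 t = Complex (- (t ^+ 2 / 2) / D) (- (t * (t ^+ 2 / 4)) / D).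
  apply: complex_ext; rewrite !(cReD, cReN, cImD, cImN) /= ?hD; clear -D0'; clearbody D; field; exact: D0'.
have e2 : z - 1 = Complex (- (t ^+ 2 / 2) / D) (t / D).
  apply: complex_ext; rewrite !(cReD, cReN, cImD, cImN) /= ?hD; clear -D0'; clearbody D; field; exact: D0'.
have Dt : `|t| <= D.
  rewrite /D -real_normK ?num_real //; have := sqr_ge0 (`|t| / 2 - 1); nra.
have Di : `|D^-1| = D^-1 by rewrite ger0_norm // invr_ge0; lra.
have h1 : `|t| * D^-1 <= 1 by rewrite ler_pdivrMr ?mul1r //; lra.
have h2 : D^-1 <= 1 by rewrite invf_le1 //; lra.
have h3 : 0 <= D^-1 by rewrite invr_ge0; lra.
have tt : t ^+ 2 = `|t| ^+ 2 by rewrite real_normK ?num_real.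
have n4 : `|t ^+ 2 / 4| = t ^+ 2 / 4 by rewrite ger0_norm //; have := sqr_ge0 t; lra.
have n2 : `|t ^+ 2 / 2| = t ^+ 2 / 2 by rewrite ger0_norm //; have := sqr_ge0 t; lra.
rewrite e1 e2 /nz /= !mulNr !normrN ![`|_ * D^-1|]normrM Di [`|t * (_ / 4)|]normrM n4 n2 tt.
have := normr_ge0 t; move: (`|t|) (D^-1) h1 h2 h3 => a b h1 h2 h3 h4; split; last by nra.
have : a * (a ^+ 2 / 4) * b <= a ^+ 2 / 4.
  have -> : a * (a ^+ 2 / 4) * b = (a ^+ 2 / 4) * (a * b) by ring.
  by rewrite ler_piMr //; nra.
have : a ^+ 2 / 2 * b <= a ^+ 2 / 2 by rewrite ler_piMr //; nra.
by have := sqr_ge0 a; lra.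
Qed.
End Norm.

(** * The derivative of the representation at the identity *)

Section Derivative.
Variables (R : realType).
Local Notation C := R[i].
Variables (m n : nat).
Local Notation d := m.+2.
Variable phi : 'M[C]_d -> 'M[C]_n.
Hypothesis phiU : forall U, U \is unitarymx -> phi U \is unitarymx.
Hypothesis phiR : forall U, U \is unitarymx -> map_mx Num.conj (phi U) = phi U.
Hypothesis phiM : forall U V, U \is unitarymx -> V \is unitarymx -> phi (U *m V) = phi U *m phi V.
Hypothesis phiZ : forall z, unitc z -> phi z%:M = 1%:M.
Variables (P : 'M[C]_n) (wt : 'I_n -> 'I_d -> int).
Hypothesis Pu : P \in unitmx.
Hypothesis hwt : forall k x, P *m phi (dg (hk k x)) = diag_mx (\row_a expi ((wt a k)%:~R * x)) *m P.

Lemma phi_dg (th : 'I_d -> R) : P *m phi (dg (fun k => expi (th k))) =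
  diag_mx (\row_a expi (\sum_k (wt a k)%:~R * th k)) *m P.
Proof.
have h (r : seq 'I_d) : (forall l, unitc (\prod_(k <- r) hk k (th k) l)) /\
    P *m phi (dg (fun l => \prod_(k <- r) hk k (th k) l)) =
    diag_mx (\row_a expi (\sum_(k <- r) (wt a k)%:~R * th k)) *m P.
  elim: r => [|k r [IHu IH]].
    split=> [l|]; first by rewrite big_nil; exact: unitc1.
    have -> : dg (fun l => \prod_(k <- [::]) hk k (th k) l) = 1%:M :> 'M[C]_d.
      by apply/matrixP => i j; rewrite !mxE big_nil.
    rewrite (phi1 phiZ) mulmx1; apply/matrixP => i j; rewrite mul_diag_mx !mxE big_nil expi0.
    by rewrite mul1r.
  split=> [l|]; first by rewrite big_cons; apply: unitcM => //; exact: hk_unit.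
  have -> : dg (fun l => \prod_(j <- k :: r) hk j (th j) l) =
      dg (hk k (th k)) *m dg (fun l => \prod_(j <- r) hk j (th j) l).
    by rewrite dgM; congr dg; apply/funext => l; rewrite big_cons.
  rewrite (phiM (dg_unitary (hk_unit k (th k))) (dg_unitary IHu)) mulmxA hwt -mulmxA IH mulmxA.
  congr (_ *m _); apply/matrixP => i j; rewrite mul_diag_mx !mxE big_cons expiD.
  by case: eqP => _; rewrite ?mulr0n ?mulr0.
have [_ <-] := h (index_enum 'I_d).
congr (_ *m phi (dg _)); apply/funext => l; rewrite (bigD1 l) //= big1 => [|k kl].
  by rewrite mulr1 /hk eqxx.
by rewrite /hk eq_sym (negPf kl).
Qed.

Lemma unitary_spectral p (U : 'M[C]_p) : U \is unitarymx -> exists2 V, V \is unitarymx &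
  exists th : 'I_p -> R, U = V *m dg (fun k => expi (th k)) *m V^t*.
Proof.
move=> hU; have : U \is normalmx.
  by apply/normalmxP; rewrite (unitarymxP hU) unitarymx_adjl.
move/orthomx_spectralP; set V := spectralmx U; set f := spectral_diag U => e.
have hV : V \is unitarymx := spectral_unitarymx U.
have hV' : V^t* \is unitarymx by rewrite trmxC_unitary.
rewrite (invmx_unitary hV) in e.
have e2 : diag_mx f = V *m U *m V^t*.
  by rewrite e !mulmxA (unitarymxP hV) mul1mx -mulmxA (unitarymxP hV) mulmx1.
have hd : diag_mx f \is unitarymx by rewrite e2; exact: mul_unitarymx (mul_unitarymx hV hU) hV'.
have hf k : exists x, f 0 k = expi x.
  apply: unitc_expiP; rewrite /unitc.
  have := unitarymxP hd => /matrixP/(_ k k).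
  rewrite tr_diag_mx map_diag_mx mul_diag_mx !mxE eqxx !mulr1n => <-.
  by [].
have /choice[th hth] := hf.
exists (V^t*); first exact: hV'.
exists th; rewrite trmxCK {1}e; congr (_ *m _ *m _).
by rewrite /dg; congr diag_mx; apply/matrixP => i j; rewrite ord1 mxE hth.
Qed.

Lemma phi_conj V U : V \is unitarymx -> U \is unitarymx ->
  phi (V *m U *m V^t*) = phi V *m phi U *m (phi V)^t*.
Proof.
move=> hV hU; have hV' : V^t* \is unitarymx by rewrite trmxC_unitary.
by rewrite (phiM (mul_unitarymx hV hU) hV') (phiM hV hU) (phi_adj phiU phiM phiZ hV).
Qed.

(** Every unitary is conjugate to a diagonal one, and conjugation by unitaries distorts [nrm] by a
    bounded factor only. The estimate is thus needed on the torus alone, where the integral weights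
    give it explicitly. *)
Lemma phi_lipschitz : exists2 L : R, 0 <= L & forall U, U \is unitarymx ->
  nrm (phi U - 1%:M) <= L * nrm (U - 1%:M).
Proof.
pose S : R := \sum_a \sum_k 4 * `|wt a k|%:~R.
have S0 : 0 <= S.
  by apply: sumr_ge0 => a _; apply: sumr_ge0 => k _; rewrite mulr_ge0 // ler0z.
pose L0 := kap R n * kap R n * (nrm (invmx P) * S * nrm P).
have L00 : 0 <= L0 by rewrite !mulr_ge0 ?kap_ge0 ?nrm_ge0.
exists (L0 * (kap R d * kap R d)); first by apply: mulr_ge0 => //; rewrite mulr_ge0 ?kap_ge0.
move=> U hU; have [V hV [th eU]] := unitary_spectral hU.
set D := dg (fun k => expi (th k)) in eU.
have hD : D \is unitarymx by apply: dg_unitary => k; exact: unitc_expi.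
have hV' : V^t* \is unitarymx by rewrite trmxC_unitary.
have eD : D - 1%:M = V^t* *m (U - 1%:M) *m (V^t*)^t*.
  rewrite trmxCK eU mulmxBr mulmxBl mulmx1 (unitarymx_adjl hV) !mulmxA (unitarymx_adjl hV) mul1mx.
  by rewrite -mulmxA (unitarymx_adjl hV) mulmx1.
have hD1 : nrm (D - 1%:M) <= kap R d * kap R d * nrm (U - 1%:M) by rewrite eD; exact: nrm_conjugate.
have eP : phi U - 1%:M = phi V *m (phi D - 1%:M) *m (phi V)^t*.
  by rewrite {1}eU (phi_conj hV hD) mulmxBr mulmxBl mulmx1 (unitarymxP (phiU hV)).
have hP1 : nrm (phi U - 1%:M) <= kap R n * kap R n * nrm (phi D - 1%:M).
  by rewrite eP; exact: nrm_conjugate (phiU hV).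
apply: (le_trans hP1).
suff h : nrm (phi D - 1%:M) <= nrm (invmx P) * S * nrm P * nrm (D - 1%:M).
  have h5 : kap R n * kap R n * nrm (phi D - 1%:M) <= L0 * nrm (D - 1%:M).
    rewrite /L0 -[leRHS]mulrA; apply: ler_wpM2l; last exact: h.
    by rewrite mulr_ge0 ?kap_ge0.
  apply: (le_trans h5); rewrite -[leRHS]mulrA; apply: ler_wpM2l; [exact: L00 | exact: hD1].
have -> : phi D - 1%:M = invmx P *m (diag_mx (\row_a (expi (\sum_k (wt a k)%:~R * th k) - 1))) *m P.
  have -> : diag_mx (\row_a (expi (\sum_k (wt a k)%:~R * th k) - 1)) =
      diag_mx (\row_a expi (\sum_k (wt a k)%:~R * th k)) - 1%:M :> 'M[C]_n.
    by apply/matrixP => i j; rewrite !mxE; case: eqP => _; rewrite ?mulr1n ?mulr0n ?subrr.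
  rewrite mulmxBr mulmxBl mulmx1 mulVmx //; congr (_ - _).
  by rewrite -mulmxA -phi_dg mulKmx.
apply: le_trans (nrmM _ _) _; rewrite mulrAC ler_wpM2r ?nrm_ge0 //.
apply: le_trans (nrmM _ _) _; rewrite -mulrA ler_wpM2l ?nrm_ge0 //.
move: (nrm (D - 1%:M)) (@nrm_entry R d d (D - 1%:M)) => ND hND.
rewrite /nrm /S mulr_suml; apply: ler_sum => a _.
rewrite (bigD1 a) //= big1 ?addr0 => [|j ja]; last by rewrite !mxE eq_sym (negPf ja) mulr0n nz0.
rewrite !mxE eqxx mulr1n mulr_suml.
have hk0 k : nz (expi ((wt a k)%:~R * th k) - 1) <= 2 * `|wt a k|%:~R * ND.
  apply: le_trans (nz_expi_int _ _) _; rewrite ler_wpM2l ?mulr_ge0 ?ler0z //.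
  by have := hND k k; rewrite !mxE eqxx mulr1n.
elim: (index_enum _) => [|k r IH]; first by rewrite !big_nil expi0 subrr nz0.
rewrite !big_cons expiD; set u := expi (_ * _); set v := expi _.
have -> : u * v - 1 = v * (u - 1) + (v - 1) by ring.
apply: le_trans (nzD _ _) _; apply: lerD IH.
apply: le_trans (nzM _ _) _.
have h1 := hk0 k; rewrite -/u in h1; have h2 : nz v <= 2 := nz_unit (unitc_expi _).
have h3 := nz_ge0 (u - 1); have h4 : nz v * nz (u - 1) <= 2 * nz (u - 1) by rewrite ler_wpM2r.
move: (nz (u - 1)) (nz v * _) (`|wt a k|%:~R) h1 h3 h4 => e2 e3 e4; nra.
Qed.

(** The graph of the differential, without limits: unitaries close to 1 + itX whose images are close
    to 1 + itA, with quadratic error. A separate U is allowed for each t, so no one-parameter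
    subgroup has to be exhibited; the factor i makes the tangent directions Hermitian. *)
Definition Gen (X : 'M[C]_d) (A : 'M[C]_n) := exists2 K : R, 0 <= K & forall t, `|t| <= 1 ->
  exists U, [/\ U \is unitarymx, nrm (U - 1%:M - Complex 0 t *: X) <= K * t ^+ 2 &
    nrm (phi U - 1%:M - Complex 0 t *: A) <= K * t ^+ 2].

Definition Hk k : 'M[C]_n := invmx P *m diag_mx (\row_a (wt a k)%:~R) *m P.

(** The unitaries are [dg (hk k x)] with e^(ix) the Cayley transform for t; on the image side the
    second-order estimate for integral powers applies to each weight. *)
Lemma Gen_delta k : Gen (delta_mx k k) (Hk k).
Proof.
pose S : R := \sum_a ((2 * `|wt a k|%:~R * `|wt a k|%:~R + 2 * `|wt a k|%:~R) * 4 + `|wt a k|%:~R).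
have w0 a : 0 <= `|wt a k|%:~R :> R by rewrite ler0z.
have S0 : 0 <= S.
  by apply: sumr_ge0 => a _; rewrite addr_ge0 // mulr_ge0 // addr_ge0 // !mulr_ge0.
have Z0 : 0 <= nrm (invmx P) * S * nrm P by rewrite !mulr_ge0 ?nrm_ge0.
exists (1 + nrm (invmx P) * S * nrm P); first by lra.
move=> t _; have [x [h1 h2]] := cayley t; exists (dg (hk k x)).
have t0 := sqr_ge0 t.
split; first exact: dg_unitary (hk_unit k x).
  have -> : dg (hk k x) - 1%:M - Complex 0 t *: delta_mx k k =
      (expi x - 1 - Complex 0 t) *: delta_mx k k :> 'M[C]_d.
    apply/matrixP => i j; rewrite !mxE /hk; case: (eqVneq i j) => [<-|ij] /=.
      by case: eqP => _ /=; rewrite ?mulr1n; ring.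
    have -> : (i == k) && (j == k) = false.
      by apply/negP => /andP[/eqP e1 /eqP e2]; rewrite e1 e2 eqxx in ij.
    by rewrite !mulr0n !mulr0 !subr0.
  apply: le_trans (nrmZ _ _) _.
  have -> : nrm (delta_mx k k : 'M[C]_d) = 1.
    rewrite /nrm (bigD1 k) //= (bigD1 k) //= !big1; first by rewrite !addr0 mxE !eqxx (nz_real 1) normr1.
      by move=> i ik; rewrite big1 // => j _; rewrite mxE (negPf ik) nz0.
    by move=> j jk; rewrite mxE (negPf jk) andbF nz0.
  rewrite mulr1 (le_trans h1) //; nra.
have -> : phi (dg (hk k x)) - 1%:M - Complex 0 t *: Hk k = invmx P *m
    diag_mx (\row_a (expi ((wt a k)%:~R * x) - 1 - Complex 0 t * (wt a k)%:~R)) *m P.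
  have -> : diag_mx (\row_a (expi ((wt a k)%:~R * x) - 1 - Complex 0 t * (wt a k)%:~R)) =
      diag_mx (\row_a expi ((wt a k)%:~R * x)) - 1%:M - Complex 0 t *: diag_mx (\row_a (wt a k)%:~R) :> 'M[C]_n.
    apply/matrixP => i j; rewrite !mxE; case: eqP => _; rewrite ?mulr1n ?mulr0n //.
    by rewrite mulr0 !subr0.
  rewrite !mulmxBr !mulmxBl mulmx1 mulVmx //; congr (_ - _ - _).
    by rewrite -mulmxA -hwt mulKmx.
  by rewrite -scalemxAr -scalemxAl.
have : nrm (diag_mx (\row_a (expi ((wt a k)%:~R * x) - 1 - Complex 0 t * (wt a k)%:~R))) <= S * t ^+ 2.
  rewrite /nrm /S mulr_suml; apply: ler_sum => a _.
  rewrite (bigD1 a) //= big1 ?addr0 => [|j ja]; last by rewrite !mxE eq_sym (negPf ja) mulr0n nz0.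
  rewrite !mxE eqxx mulr1n.
  set w := wt a k; set y := expi (_ * x).
  have -> : y - 1 - Complex 0 t * w%:~R = (y - 1 - w%:~R * (expi x - 1)) +
      w%:~R * (expi x - 1 - Complex 0 t) by ring.
  apply: le_trans (nzD _ _) _; rewrite mulrDl; apply: lerD.
    apply: le_trans (nz_expi_int2 _ _) _; rewrite -[leRHS]mulrA ler_wpM2l //.
      by rewrite addr_ge0 // !mulr_ge0.
    have h3 := nz_ge0 (expi x - 1); rewrite -[t ^+ 2]real_normK ?num_real //.
    by move: (nz _) `|t| h2 h3 => a1 a2; nra.
  apply: le_trans (nzM _ _) _.
  have -> : nz (w%:~R : C) = `|w|%:~R.
    by rewrite -(rmorph_int (real_complex R)) nz_real intr_norm.
  by rewrite ler_wpM2l.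
move: (diag_mx _) => DD hDD.
apply: (@le_trans _ _ (nrm (invmx P) * (S * t ^+ 2) * nrm P)); last by nra.
apply: le_trans (nrmM _ _) _; rewrite ler_wpM2r ?nrm_ge0 //.
by apply: le_trans (nrmM _ _) _; rewrite ler_wpM2l ?nrm_ge0.
Qed.

Lemma Gen_conj V X A : V \is unitarymx -> Gen X A ->
  Gen (V *m X *m V^t*) (phi V *m A *m (phi V)^t*).
Proof.
move=> hV [K K0 hK]; have k1 := kap_ge0 R d; have k2 := kap_ge0 R n.
have k3 : 0 <= kap R d * kap R d by rewrite mulr_ge0.
have k4 : 0 <= kap R n * kap R n by rewrite mulr_ge0.
exists ((kap R d * kap R d + kap R n * kap R n) * K); first by rewrite mulr_ge0 ?addr_ge0.
move=> t /hK[U [hU h1 h2]]; have t0 := sqr_ge0 t.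
have hV' : V^t* \is unitarymx by rewrite trmxC_unitary.
have Kt : 0 <= K * t ^+ 2 by rewrite mulr_ge0.
have key (x y a b : R) : 0 <= x -> 0 <= y -> a <= b -> 0 <= b -> x * a <= (x + y) * b.
  move=> x0 y0 ab b0; rewrite mulrDl -[leLHS]addr0; apply: lerD; last exact: mulr_ge0.
  exact: ler_wpM2l.
exists (V *m U *m V^t*); split; first exact: mul_unitarymx (mul_unitarymx hV hU) hV'.
  have -> : V *m U *m V^t* - 1%:M - Complex 0 t *: (V *m X *m V^t*) =
      V *m (U - 1%:M - Complex 0 t *: X) *m V^t*.
    by rewrite !mulmxBr !mulmxBl mulmx1 (unitarymxP hV) -scalemxAr -scalemxAl.
  apply: le_trans (nrm_conjugate _ hV) _.
  rewrite -[leRHS]mulrA; exact: (key _ _ _ _ k3 k4 h1 Kt).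
rewrite (phi_conj hV hU).
have -> : phi V *m phi U *m (phi V)^t* - 1%:M - Complex 0 t *: (phi V *m A *m (phi V)^t*) =
    phi V *m (phi U - 1%:M - Complex 0 t *: A) *m (phi V)^t*.
  by rewrite !mulmxBr !mulmxBl mulmx1 (unitarymxP (phiU hV)) -scalemxAr -scalemxAl.
apply: le_trans (nrm_conjugate _ (phiU hV)) _.
rewrite -[leRHS]mulrA [_ + kap R n * _]addrC; exact: (key _ _ _ _ k4 k3 h2 Kt).
Qed.

Lemma near1 p (U X : 'M[C]_p) K t : `|t| <= 1 -> 0 <= K -> nrm (U - 1%:M - Complex 0 t *: X) <= K * t ^+ 2 ->
  nrm (U - 1%:M) <= (K + nrm X) * `|t|.
Proof.
move=> t1 K0 h; rewrite -[U - 1%:M](subrK (Complex 0 t *: X)).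
apply: le_trans (nrmD _ _) _; rewrite nrm_it mulrDl [nrm X * _]mulrC lerD2r.
apply: (le_trans h); rewrite -[t ^+ 2]real_normK ?num_real //.
have := normr_ge0 t; move: `|t| t1 => a t1 a0; rewrite ler_wpM2l //; nra.
Qed.

Lemma mul_expand p (U V X Y : 'M[C]_p) K K' t : `|t| <= 1 -> 0 <= K -> 0 <= K' -> U \is unitarymx ->
  nrm (U - 1%:M - Complex 0 t *: X) <= K * t ^+ 2 -> nrm (V - 1%:M - Complex 0 t *: Y) <= K' * t ^+ 2 ->
  nrm (U *m V - 1%:M - Complex 0 t *: (X + Y)) <= (kap R p * K' + K + (K + nrm X) * nrm Y) * t ^+ 2.
Proof.
move=> t1 K0 K0' hU h1 h2.
have -> : U *m V - 1%:M - Complex 0 t *: (X + Y) = U *m (V - 1%:M - Complex 0 t *: Y) +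
   (U - 1%:M - Complex 0 t *: X) + Complex 0 t *: ((U - 1%:M) *m Y).
  rewrite !mulmxBr mulmx1 mulmxBl mul1mx -scalemxAr scalerBr scalerDr.
  move: (U *m V) (U *m Y) => UV UY; apply/matrixP => i j; rewrite !mxE; ring.
apply: le_trans (nrmD _ _) _; rewrite [leRHS]mulrDl; apply: lerD.
  apply: le_trans (nrmD _ _) _; rewrite [leRHS]mulrDl; apply: lerD => //.
  apply: le_trans (nrmM _ _) _; rewrite -mulrA.
  by apply: ler_pM; rewrite ?nrm_ge0 // nrm_unitary.
rewrite nrm_it; have h := near1 t1 K0 h1; have h3 := nrmM (U - 1%:M) Y.
have := nrm_ge0 Y; have := normr_ge0 t; rewrite -[t ^+ 2]real_normK ?num_real //.
have h4 : nrm (U - 1%:M) * nrm Y <= (K + nrm X) * `|t| * nrm Y by rewrite ler_wpM2r ?nrm_ge0.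
have h5 := le_trans h3 h4 => a0 b0.
apply: (@le_trans _ _ (`|t| * ((K + nrm X) * `|t| * nrm Y))); first by rewrite ler_wpM2l.
by rewrite le_eqVlt; apply/orP; left; apply/eqP; ring.
Qed.

(** To first order, the product of the two chosen unitaries realises the sum of the directions, on
    both sides. *)
Lemma Gen_add X A Y B : Gen X A -> Gen Y B -> Gen (X + Y) (A + B).
Proof.
move=> [K K0 hK] [K' K0' hK'].
pose Z1 := kap R d * K' + K + (K + nrm X) * nrm Y.
pose Z2 := kap R n * K' + K + (K + nrm A) * nrm B.
have z1 : 0 <= Z1 by rewrite !addr_ge0 ?mulr_ge0 ?addr_ge0 ?kap_ge0 ?nrm_ge0.
have z2 : 0 <= Z2 by rewrite !addr_ge0 ?mulr_ge0 ?addr_ge0 ?kap_ge0 ?nrm_ge0.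
exists (Z1 + Z2); first by rewrite addr_ge0.
move=> t t1; have [U [hU h1 h2]] := hK t t1; have [V [hV h3 h4]] := hK' t t1.
have t0 := sqr_ge0 t.
exists (U *m V); split; first exact: mul_unitarymx hU hV.
  apply: le_trans (mul_expand t1 K0 K0' hU h1 h3) _; rewrite -/Z1 ler_wpM2r //; lra.
rewrite (phiM hU hV); apply: le_trans (mul_expand t1 K0 K0' (phiU hU) h2 h4) _.
by rewrite -/Z2 ler_wpM2r //; lra.
Qed.

Lemma Gen_scale (c : R) X A : Gen X A -> Gen (c%:C%C *: X) (c%:C%C *: A).
Proof.
move=> [K K0 hK]; pose Z := c ^+ 2 * K + c ^+ 2 * (nrm X + nrm A).
have Z0 : 0 <= Z by rewrite addr_ge0 // mulr_ge0 ?sqr_ge0 ?addr_ge0 ?nrm_ge0.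
exists Z => // t t1; have t0 := sqr_ge0 t; have c0 := sqr_ge0 c.
have e p q (M : 'M[C]_(p, q)) : Complex 0 t *: (c%:C%C *: M) = Complex 0 (t * c) *: M.
  rewrite scalerA; congr (_ *: _); apply: complex_ext; rewrite ?cReM ?cImM /=; ring.
have nX := nrm_ge0 X; have nA := nrm_ge0 A.
case: (lerP `|t * c| 1) => tc.
  have [U [hU h1 h2]] := hK (t * c) tc; exists U; split=> //; rewrite e.
    apply: (le_trans h1); rewrite exprMn /Z mulrA [K * _]mulrC -mulrA; move: (t ^+ 2) (c ^+ 2) t0 c0 => a b a0 b0.
    have : 0 <= b * (nrm X + nrm A) * a by rewrite !mulr_ge0 ?addr_ge0.
    by move: (nrm X) (nrm A) => x y; lra.
  apply: (le_trans h2); rewrite exprMn /Z mulrA [K * _]mulrC -mulrA; move: (t ^+ 2) (c ^+ 2) t0 c0 => a b a0 b0.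
  have : 0 <= b * (nrm X + nrm A) * a by rewrite !mulr_ge0 ?addr_ge0.
  by move: (nrm X) (nrm A) => x y; lra.
(* For |tc| > 1 the hypothesis gives no unitary, but the linear terms are then bounded by quadratic
   ones, so the identity matrix serves as the witness. *)
have htc : `|t * c| <= c ^+ 2 * t ^+ 2.
  have -> : c ^+ 2 * t ^+ 2 = `|t * c| ^+ 2 by rewrite real_normK ?num_real // exprMn mulrC.
  by rewrite expr2 ler_peMl // ltW.
have KK : 0 <= c ^+ 2 * t ^+ 2 * K by do 2 apply: mulr_ge0 => //.
exists 1%:M; rewrite (phi1 phiZ) !subrr !sub0r !nrmN !e !nrm_it; split; first exact: unitarymx1.
  apply: (@le_trans _ _ (c ^+ 2 * t ^+ 2 * (nrm X + nrm A))); last by rewrite /Z; lra.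
  by apply: ler_pM; rewrite ?normr_ge0 //; lra.
apply: (@le_trans _ _ (c ^+ 2 * t ^+ 2 * (nrm X + nrm A))); last by rewrite /Z; lra.
by apply: ler_pM; rewrite ?normr_ge0 //; lra.
Qed.

Lemma small_eq0 p q (A : 'M[C]_(p, q)) K : 0 <= K ->
  (forall t, `|t| <= 1 -> `|t| * nrm A <= K * t ^+ 2) -> A = 0.
Proof.
move=> K0 h; apply: nrm_eq0; apply/eqP; rewrite eq_le nrm_ge0 andbT leNgt; apply/negP => hA.
pose t := Num.min 1 (nrm A / (2 * (K + 1))).
have K1 : 0 < 2 * (K + 1) by lra.
have t0 : 0 < t by rewrite lt_min ltr01 divr_gt0.
have t1 : t <= 1 by rewrite ge_min lexx.
have t2 : t * (2 * (K + 1)) <= nrm A by rewrite -ler_pdivlMr // ge_min lexx orbT.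
have := h t; rewrite (ger0_norm (ltW t0)) => /(_ t1); rewrite expr2 mulrCA ler_pM2l //.
by move: (nrm A) hA t2 => a *; nra.
Qed.

(** By linearity the direction may be taken to be 0. The unitary is then within O(t^2) of 1, so is
    its image by the Lipschitz bound, and a linear term of quadratic size must vanish. *)
Lemma Gen_uniq X A B : Gen X A -> Gen X B -> A = B.
Proof.
move=> hA hB.
have h0 : Gen 0 (A - B).
  have := Gen_add hA (Gen_scale (-1) hB).
  by rewrite rmorphN rmorph1 !scaleN1r subrr.
have [K K0 hK] := h0; have [L L0 hL] := phi_lipschitz.
apply/eqP; rewrite -subr_eq0; apply/eqP; apply: (@small_eq0 _ _ _ (L * K + K)); first by rewrite addr_ge0 ?mulr_ge0.
move=> t t1; have [U [hU]] := hK t t1; rewrite scaler0 subr0 => h1 h2.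
have h3 := hL U hU.
rewrite -nrm_it -[Complex 0 t *: (A - B)](subKr (phi U - 1%:M)).
apply: le_trans (nrmB _ _) _; rewrite mulrDl lerD //.
by apply: (le_trans h3); rewrite -mulrA ler_wpM2l.
Qed.

Lemma Gen0 : Gen 0 0.
Proof. by have := Gen_scale 0 (Gen_delta 0); rewrite rmorph0 !scale0r. Qed.

(** By the spectral theorem X is a real combination of unitary conjugates of diagonal matrix units,
    for which derivatives are available. *)
Lemma Gen_total X : X^t* = X -> exists A, Gen X A.
Proof.
move=> hX; have hh : X \is hermsymmx by apply/is_hermitianmxP; rewrite expr0 scale1r hX.
have /orthomx_spectralP := hermitian_normalmx hh.
set V := spectralmx X; set f := spectral_diag X => e.
have hV : V \is unitarymx := spectral_unitarymx X.
have hV' : V^t* \is unitarymx by rewrite trmxC_unitary.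
rewrite (invmx_unitary hV) in e.
have hf k : exists c : R, f 0 k = c%:C%C.
  by apply/complex_realP; have /mxOverP := hermitian_spectral_diag_real hh; exact.
have /choice[c hc] := hf.
have -> : X = \sum_k (c k)%:C%C *: (V^t* *m delta_mx k k *m (V^t*)^t*).
  rewrite {1}e trmxCK; have -> : diag_mx f = \sum_k (c k)%:C%C *: delta_mx k k.
    apply/matrixP => i j; rewrite mxE summxE (bigD1 i) //= big1 => [|k ki].
      by rewrite !mxE eqxx /= hc [j == i]eq_sym; case: eqP => _; rewrite /= ?mulr1n ?mulr1 ?mulr0n ?mulr0 addr0.
    by rewrite !mxE eq_sym (negPf ki) mulr0.
  rewrite mulmx_sumr mulmx_suml; apply: eq_bigr => k _.
  by rewrite -scalemxAr -scalemxAl.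
elim: (index_enum _) => [|k r [A hA]]; first by exists 0; rewrite big_nil; exact: Gen0.
rewrite big_cons; eexists; apply: Gen_add hA; apply: Gen_scale.
exact: Gen_conj hV' (Gen_delta k).
Qed.

End Derivative.

(** * The complexified derived representation and its bracket *)

Section DerivedRep.
Variables (R : realType).
Local Notation C := R[i].
Variables (m n : nat).
Local Notation d := m.+2.
Variable phi : 'M[C]_d -> 'M[C]_n.
Hypothesis phiU : forall U, U \is unitarymx -> phi U \is unitarymx.
Hypothesis phiR : forall U, U \is unitarymx -> map_mx Num.conj (phi U) = phi U.
Hypothesis phiM : forall U V, U \is unitarymx -> V \is unitarymx -> phi (U *m V) = phi U *m phi V.
Hypothesis phiZ : forall z, unitc z -> phi z%:M = 1%:M.
Variables (P : 'M[C]_n) (wt : 'I_n -> 'I_d -> int).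
Hypothesis Pu : P \in unitmx.
Hypothesis hwt : forall k x, P *m phi (dg (hk k x)) = diag_mx (\row_a expi ((wt a k)%:~R * x)) *m P.

Local Notation Gen := (Gen phi).
Local Notation gadd := (Gen_add phiU phiM).
Local Notation gscale := (Gen_scale phiZ).
Local Notation guniq := (Gen_uniq phiU phiM phiZ Pu hwt).
Local Notation gtotal := (Gen_total phiU phiM phiZ Pu hwt).

Lemma Gen_adj X A : Gen X A -> Gen (X^t*) (A^t*).
Proof.
move=> [K K0 hK]; exists K => // t t1.
have [|U [hU h1 h2]] := hK (- t); first by rewrite normrN.
rewrite sqrrN in h1 h2; exists (U^t*); rewrite (phi_adj phiU phiM phiZ hU).
have e p (M Y : 'M[C]_p) : M^t* - 1%:M - Complex 0 t *: Y^t* = (M - 1%:M - Complex 0 (- t) *: Y)^t*.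
  apply/matrixP => i j; rewrite !mxE !rmorphB rmorphM /= conjC_nat [i == j]eq_sym; congr (_ - _ * _).
  by rewrite cconjCE opprK.
by split; [rewrite trmxC_unitary; exact: hU | rewrite e nrm_adj | rewrite e nrm_adj].
Qed.

(** Conjugation fixes the real matrix [phi U] and reverses the factor i. By uniqueness the
    derivative is purely imaginary, and being Hermitian it is antisymmetric. *)
Lemma Gen_bar X A : Gen X A -> Gen X (- map_mx Num.conj A).
Proof.
move=> [K K0 hK]; exists K => // t t1; have [U [hU h1 h2]] := hK t t1.
exists U; split=> //; rewrite -(phiR hU).
have -> : map_mx Num.conj (phi U) - 1%:M - Complex 0 t *: - map_mx Num.conj A =
    map_mx Num.conj (phi U - 1%:M - Complex 0 t *: A).
  apply/matrixP => i j; rewrite !mxE !rmorphB rmorphM /= conjC_nat mulrN -mulNr; congr (_ - _ * _).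
  by apply: complex_ext; rewrite ?cReN ?cImN ?cRe_conj ?cIm_conj /= ?oppr0.
by rewrite nrm_conj.
Qed.

Lemma Gen_one : Gen 1%:M 0.
Proof.
pose K := nrm (1%:M : 'M[C]_d); have K0 : 0 <= K by exact: nrm_ge0.
exists K => // t t1; have [x [h1 h2]] := cayley t; exists ((expi x)%:M).
have t0 := sqr_ge0 t.
have hx := unitc_expi x; rewrite (phiZ hx) scaler0 subr0 subrr nrm0; split; last by rewrite mulr_ge0.
  apply/unitarymxP; rewrite tr_scalar_mx map_scalar_mx -scalar_mxM.
  by congr (_%:M); exact: hx.
have -> : (expi x)%:M - 1%:M - Complex 0 t *: 1%:M = (expi x - 1 - Complex 0 t) *: 1%:M :> 'M[C]_d.
  by rewrite -[(expi x)%:M]scalemx1 !scalerBl scale1r.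
by apply: le_trans (nrmZ _ _) _; rewrite -/K mulrC ler_wpM2l.
Qed.

Definition herm1 (Z : 'M[C]_d) : 'M[C]_d := (2^-1)%:C%C *: (Z + Z^t*).
Definition herm2 (Z : 'M[C]_d) : 'M[C]_d := Complex 0 (- 2^-1) *: (Z - Z^t*).

Lemma herm1P Z : (herm1 Z)^t* = herm1 Z.
Proof.
apply/matrixP => i j; rewrite !mxE rmorphM rmorphD /= conjCK addrC; congr (_ * _).
by rewrite cconjCE oppr0.
Qed.
Lemma herm2P Z : (herm2 Z)^t* = herm2 Z.
Proof.
apply/matrixP => i j; rewrite !mxE rmorphM rmorphB /= conjCK -[RHS]mulrNN opprB; congr (_ * _).
by apply: complex_ext; rewrite ?cReN ?cImN ?cRe_conj ?cIm_conj /= ?oppr0.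
Qed.
Lemma half_ii : Complex 0 1 * Complex 0 (- 2^-1) = (2^-1)%:C%C :> C.
Proof. by apply: complex_ext; rewrite ?cReM ?cImM /=; ring. Qed.
Lemma half2 : (2^-1)%:C%C + (2^-1)%:C%C = 1 :> C.
Proof. by apply: complex_ext; rewrite ?cReD ?cImD /=; field. Qed.
Lemma hermE Z : Z = herm1 Z + Complex 0 1 *: herm2 Z.
Proof.
rewrite /herm1 /herm2 scalerA half_ii -scalerDr addrACA subrr addr0.
by rewrite scalerDr -scalerDl half2 scale1r.
Qed.

(** [rho] extends the derivative complex-linearly from Hermitian matrices. The bracket relation
    comes from differentiating the compatibility of [rho] with conjugation by unitaries. *)
Lemma derived_rep : exists rho : 'M[C]_d -> 'M[C]_n,
  [/\ forall A B, rho (A + B) = rho A + rho B,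
      forall c A, rho (c *: A) = c *: rho A,
      forall A, (rho A)^T = - rho A,
      forall A, rho (A^t*) = (rho A)^t* &
      rho 1%:M = 0] /\
  [/\ forall k, rho (delta_mx k k) = Hk P wt k,
      forall X, X^t* = X -> Gen X (rho X),
      forall U A, U \is unitarymx -> rho (U *m A *m U^t*) = phi U *m rho A *m (phi U)^t* &
      forall A B, rho (A *m B - B *m A) = rho A *m rho B - rho B *m rho A].
Proof.
have /choice[rh hrh] : forall X : 'M[C]_d, exists A, X^t* = X -> Gen X A.
  move=> X; case: (pselect (X^t* = X)) => hX; last by exists 0.
  by have [A hA] := gtotal hX; exists A.
have adjD p (X Y : 'M[C]_p) : (X + Y)^t* = X^t* + Y^t* by rewrite linearD /= map_mxD.
have adjZ p c (X : 'M[C]_p) : (c *: X)^t* = c^* *: X^t* by rewrite linearZ /= map_mxZ.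
have rhD X Y : X^t* = X -> Y^t* = Y -> rh (X + Y) = rh X + rh Y.
  by move=> hX hY; apply: guniq (gadd (hrh _ hX) (hrh _ hY)); apply: hrh; rewrite adjD hX hY.
have rhZ (c : R) X : X^t* = X -> rh (c%:C%C *: X) = c%:C%C *: rh X.
  move=> hX; apply: guniq (gscale _ (hrh _ hX)); apply: hrh; rewrite adjZ hX.
  by rewrite cconjCE oppr0.
have rh_adj X : X^t* = X -> (rh X)^t* = rh X.
  by move=> hX; have h := Gen_adj (hrh _ hX); rewrite hX in h; exact: guniq h (hrh _ hX).
have rh_bar X : X^t* = X -> map_mx Num.conj (rh X) = - rh X.
  by move=> hX; have e := guniq (hrh _ hX) (Gen_bar (hrh _ hX)); rewrite [in RHS]e opprK.
have rh_tr X : X^t* = X -> (rh X)^T = - rh X.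
  move=> hX; rewrite -rh_bar // -{1}(rh_adj _ hX).
  by apply/matrixP => i j; rewrite !mxE.
pose ii : C := Complex 0 1.
pose rho Z := rh (herm1 Z) + ii *: rh (herm2 Z).
have rhoE X Y : X^t* = X -> Y^t* = Y -> rho (X + ii *: Y) = rh X + ii *: rh Y.
  move=> hX hY; have iic : ii^* = - ii.
    by apply: complex_ext; rewrite ?cReN ?cImN ?cRe_conj ?cIm_conj /= ?oppr0.
  rewrite /rho; congr (rh _ + _ *: rh _).
    rewrite /herm1 adjD adjZ hX hY iic scaleNr addrACA subrr addr0.
    by rewrite scalerDr -scalerDl half2 scale1r.
  have e : X + ii *: Y - (X - ii *: Y) = (ii + ii) *: Y.
    by apply/matrixP => i j; rewrite !mxE; ring.
  rewrite /herm2 adjD adjZ hX hY iic scaleNr e scalerA.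
  have -> : Complex 0 (- 2^-1) * (ii + ii) = 1 :> C.
    by apply: complex_ext; rewrite ?cReM ?cImM ?cReD ?cImD /=; field.
  by rewrite scale1r.
have rhoH X : X^t* = X -> rho X = rh X.
  move=> hX; have h0 : (0 : 'M[C]_d)^t* = 0 by rewrite trmx0 map_mx0.
  have := rhoE X 0 hX h0; rewrite scaler0 addr0 => ->.
  by have := rhZ 0 0 h0; rewrite rmorph0 !scale0r => ->; rewrite scaler0 addr0.
have ind (Q : 'M[C]_d -> Prop) : (forall X Y, X^t* = X -> Y^t* = Y -> Q (X + ii *: Y)) -> forall Z, Q Z.
  by move=> h Z; rewrite (hermE Z); apply: h; [exact: herm1P|exact: herm2P].
have rhoD A B : rho (A + B) = rho A + rho B.
  elim/ind: A => X Y hX hY; elim/ind: B => X' Y' hX' hY'.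
  have -> : X + ii *: Y + (X' + ii *: Y') = (X + X') + ii *: (Y + Y') by rewrite scalerDr addrACA.
  rewrite !rhoE ?adjD ?hX ?hY ?hX' ?hY' // !rhD // scalerDr addrACA //.
have rhoZ c A : rho (c *: A) = c *: rho A.
  elim/ind: A => X Y hX hY; case: c => a b.
  have hc (M N : 'M[C]_d) : Complex a b *: (M + ii *: N) = (a%:C%C *: M + (- b)%:C%C *: N) + ii *: (b%:C%C *: M + a%:C%C *: N).
    apply/matrixP => i j; rewrite !mxE; apply: complex_ext; rewrite !(cReM, cImM, cReD, cImD) /=; ring.
  have hc' (M N : 'M[C]_n) : Complex a b *: (M + ii *: N) = (a%:C%C *: M + (- b)%:C%C *: N) + ii *: (b%:C%C *: M + a%:C%C *: N).
    apply/matrixP => i j; rewrite !mxE; apply: complex_ext; rewrite !(cReM, cImM, cReD, cImD) /=; ring.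
  have hz (x : R) (M : 'M[C]_d) : M^t* = M -> (x%:C%C *: M)^t* = x%:C%C *: M.
    by move=> hM; rewrite adjZ hM cconjCE oppr0.
  rewrite hc !rhoE ?adjD ?hz // !rhD ?hz // !rhZ // hc' //.
exists rho.
have rho_conj U A : U \is unitarymx -> rho (U *m A *m U^t*) = phi U *m rho A *m (phi U)^t*.
  move=> hU; elim/ind: A => X Y hX hY.
  have hUX M : M^t* = M -> (U *m M *m U^t*)^t* = U *m M *m U^t*.
    by move=> hM; rewrite !trmx_mul !map_mxM trmxCK hM mulmxA.
  have hr M : M^t* = M -> rh (U *m M *m U^t*) = phi U *m rh M *m (phi U)^t*.
    by move=> hM; apply: guniq (hrh _ (hUX _ hM)) (Gen_conj phiU phiM phiZ hU (hrh _ hM)).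
  rewrite mulmxDr mulmxDl -scalemxAr -scalemxAl !rhoE ?hUX // !hr //.
  by rewrite mulmxDr mulmxDl -scalemxAr -scalemxAl.
split; split=> //.
- elim/ind=> X Y hX hY; rewrite rhoE // linearD linearZ /= !rh_tr //.
  by rewrite scalerN opprD.
- elim/ind=> X Y hX hY; rewrite rhoE //.
  have -> : (X + ii *: Y)^t* = X + ii *: ((-1)%:C%C *: Y).
    rewrite adjD adjZ hX hY scalerA; congr (_ + _ *: _).
    by apply: complex_ext; rewrite ?cReM ?cImM ?cRe_conj ?cIm_conj /=; ring.
  have h1 : ((-1)%:C%C *: Y)^t* = (-1)%:C%C *: Y by rewrite adjZ hY cconjCE oppr0.
  rewrite rhoE // rhZ // adjD adjZ !rh_adj // scalerA; congr (_ + _ *: _).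
  by apply: complex_ext; rewrite ?cReM ?cImM ?cRe_conj ?cIm_conj /=; ring.
- have h1 : (1%:M : 'M[C]_d)^t* = 1%:M by rewrite trmx1 map_mx1.
  by rewrite rhoH //; apply: guniq (hrh _ h1) Gen_one.
- move=> k; have h1 : (delta_mx k k : 'M[C]_d)^t* = delta_mx k k by rewrite trmx_delta map_delta_mx.
  by rewrite (rhoH _ h1); have h2 := Gen_delta Pu hwt k; exact: guniq (hrh _ h1) h2.
- by move=> X hX; rewrite rhoH //; exact: hrh.
have rhoN A : rho (- A) = - rho A by rewrite -scaleN1r rhoZ scaleN1r.
have rhoB A B : rho (A - B) = rho A - rho B by rewrite rhoD rhoN.
pose M0 : R := \sum_i \sum_j nrm (rho (delta_mx i j)).
have bound Z : nrm (rho Z) <= nrm Z * M0.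
  have rho0 : rho 0 = 0 by rewrite -(scale0r (0 : 'M[C]_d)) rhoZ scale0r.
  rewrite [in rho Z](matrix_sum_delta Z) !(big_morph rho rhoD rho0).
  apply: le_trans (nrm_sum _ _ _) _; rewrite mulr_sumr; apply: ler_sum => i _.
  rewrite (big_morph rho rhoD rho0).
  apply: le_trans (nrm_sum _ _ _) _; rewrite mulr_sumr; apply: ler_sum => j _.
  rewrite rhoZ; apply: le_trans (nrmZ _ _) _; rewrite ler_wpM2r ?nrm_ge0 //.
  exact: nrm_entry.
have M00 : 0 <= M0 by apply: sumr_ge0 => i _; apply: sumr_ge0 => j _; exact: nrm_ge0.
(* U Z U^* = Z + it [Y, Z] + O(t^2). Writing the difference as (UZ - ZU) U^* means that only U has
   to be expanded. *)
have expand p (U Y Z : 'M[C]_p) K t : `|t| <= 1 -> 0 <= K -> U \is unitarymx ->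
    nrm (U - 1%:M - Complex 0 t *: Y) <= K * t ^+ 2 ->
    nrm (U *m Z *m U^t* - Z - Complex 0 t *: (Y *m Z - Z *m Y)) <=
    (nrm (Y *m Z - Z *m Y) * (K + nrm Y) + (K * nrm Z + nrm Z * K) * kap R p) * t ^+ 2.
  move=> t1 K0 hU h; set E := U - 1%:M - Complex 0 t *: Y in h.
  have eU : U = 1%:M + Complex 0 t *: Y + E by apply/matrixP => a b; rewrite /E !mxE; ring.
  have -> : U *m Z *m U^t* - Z - Complex 0 t *: (Y *m Z - Z *m Y) =
      Complex 0 t *: ((Y *m Z - Z *m Y) *m (U^t* - 1%:M)) + (E *m Z - Z *m E) *m U^t*.
    have e1 : U *m Z *m U^t* - Z = (U *m Z - Z *m U) *m U^t*.
      by rewrite mulmxBl -[Z *m U *m _]mulmxA (unitarymxP hU) mulmx1.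
    have e2 : U *m Z - Z *m U = Complex 0 t *: (Y *m Z - Z *m Y) + (E *m Z - Z *m E).
      rewrite {1 2}eU !mulmxDl !mulmxDr mul1mx mulmx1 -!scalemxAl -!scalemxAr.
      move: (Y *m Z) (Z *m Y) (E *m Z) (Z *m E) => a1 a2 a3 a4.
      by apply/matrixP => i j; rewrite !mxE; ring.
    move: e2; move: (Y *m Z - Z *m Y) => N e2.
    have e3 : N *m (U^t* - 1%:M) = N *m U^t* - N by rewrite mulmxBr mulmx1.
    have e4 (M : 'M[C]_p) : (Complex 0 t *: N + M) *m U^t* = Complex 0 t *: (N *m U^t*) + M *m U^t*.
      by rewrite mulmxDl scalemxAl.
    by rewrite e1 e2 e4 e3 scalerBr addrAC.
  rewrite [leRHS]mulrDl; apply: le_trans (nrmD _ _) _; apply: lerD.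
    rewrite nrm_it; apply: (@le_trans _ _ (`|t| * (nrm (Y *m Z - Z *m Y) * ((K + nrm Y) * `|t|)))).
      rewrite ler_wpM2l //; apply: le_trans (nrmM _ _) _; rewrite ler_wpM2l ?nrm_ge0 //.
      have -> : U^t* - 1%:M = (U - 1%:M)^t* by rewrite raddfB raddfB /= trmx1 map_mx1.
      by rewrite nrm_adj; exact: near1 t1 K0 h.
    by rewrite -[t ^+ 2]real_normK ?num_real // le_eqVlt; apply/orP; left; apply/eqP; ring.
  apply: (@le_trans _ _ ((K * t ^+ 2 * nrm Z + nrm Z * (K * t ^+ 2)) * kap R p)).
    apply: le_trans (nrmM _ _) _; apply: ler_pM; rewrite ?nrm_ge0 //; last by rewrite nrm_adj nrm_unitary.
    apply: le_trans (nrmB _ _) _; apply: lerD; apply: le_trans (nrmM _ _) _.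
      by rewrite ler_wpM2r ?nrm_ge0.
    by rewrite ler_wpM2l ?nrm_ge0.
  by rewrite le_eqVlt; apply/orP; left; apply/eqP; ring.
(* Comparing the expansion on the image side with [rho] of the expansion on the source side leaves t
   times the defect of the bracket relation, bounded by a multiple of t^2. *)
have brH Y Z : Y^t* = Y -> rho (Y *m Z - Z *m Y) = rho Y *m rho Z - rho Z *m rho Y.
  move=> hY; rewrite (rhoH Y hY); have [K K0 hK] := hrh _ hY.
  apply/eqP; rewrite -subr_eq0; apply/eqP.
  set B := rh Y in hK *; set W := Y *m Z - Z *m Y; set W' := B *m rho Z - rho Z *m B.
  pose K1 := nrm W * (K + nrm Y) + (K * nrm Z + nrm Z * K) * kap R d.
  pose K2 := nrm W' * (K + nrm B) + (K * nrm (rho Z) + nrm (rho Z) * K) * kap R n.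
  have K10 : 0 <= K1 by rewrite addr_ge0 // mulr_ge0 ?addr_ge0 ?mulr_ge0 ?nrm_ge0 ?kap_ge0.
  have K20 : 0 <= K2 by rewrite addr_ge0 // mulr_ge0 ?addr_ge0 ?mulr_ge0 ?nrm_ge0 ?kap_ge0.
  apply: (@small_eq0 R n n _ (K1 * M0 + K2)); first by rewrite addr_ge0 // mulr_ge0.
  move=> t t1; have [U [hU h1 h2]] := hK t t1.
  have g1 := expand d U Y Z K t t1 K0 hU h1; have g2 := expand n (phi U) B (rho Z) K t t1 K0 (phiU hU) h2.
  rewrite -/W -/K1 in g1; rewrite -/W' -/K2 -(rho_conj U Z hU) in g2.
  set D1 := U *m Z *m U^t* - Z - _ in g1.
  have e1 : rho D1 = rho (U *m Z *m U^t*) - rho Z - Complex 0 t *: rho W by rewrite /D1 rhoB rhoB rhoZ.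
  have g3 := bound D1.
  have -> : `|t| * nrm (rho W - W') = nrm (Complex 0 t *: (rho W - W')) by rewrite nrm_it.
  have -> : Complex 0 t *: (rho W - W') = (rho (U *m Z *m U^t*) - rho Z - Complex 0 t *: W') - rho D1.
    rewrite e1 scalerBr; move: (rho (U *m Z *m U^t*)) (rho Z) (rho W) => a1 a2 a3.
    by apply/matrixP => i j; rewrite !mxE; ring.
  apply: le_trans (nrmB _ _) _; rewrite mulrDl addrC; apply: lerD => //.
  by apply: (le_trans g3); rewrite mulrAC ler_wpM2r.
clearbody rho; move=> A B; elim/ind: A => X Y hX hY.
rewrite !mulmxDl !mulmxDr -!scalemxAl -!scalemxAr.
have -> : X *m B + ii *: (Y *m B) - (B *m X + ii *: (B *m Y)) = (X *m B - B *m X) + ii *: (Y *m B - B *m Y).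
  by rewrite scalerBr opprD addrACA.
have e0 (M N : 'M[C]_d) : rho (M + ii *: N) = rho M + ii *: rho N by rewrite rhoD rhoZ.
rewrite !e0 (brH X B hX) (brH Y B hY); move: (rho X) (rho Y) (rho B) => X' Y' B'.
rewrite mulmxDl mulmxDr -scalemxAl -scalemxAr.
by rewrite scalerBr opprD addrACA.
Qed.

End DerivedRep.

(** * The equivariant map from matrices and its invariant forms *)

Section Adjoint.
Variables (R : realType).
Local Notation C := R[i].
Variables (m n : nat).
Local Notation d := m.+2.
Variable phi : 'M[C]_d -> 'M[C]_n.
Hypothesis phiU : forall U, U \is unitarymx -> phi U \is unitarymx.
Hypothesis phiR : forall U, U \is unitarymx -> map_mx Num.conj (phi U) = phi U.
Hypothesis phiM : forall U V, U \is unitarymx -> V \is unitarymx -> phi (U *m V) = phi U *m phi V.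
Hypothesis phiK : forall U, U \is unitarymx -> (phi U = 1%:M <-> exists2 z, unitc z & U = z%:M).
Variable c0 : 'cV[C]_n.
Hypothesis c00 : c0 != 0.
Hypothesis phic : forall U, U \is unitarymx -> phi U *m c0 = c0.
Hypothesis dimn : (n <= d * d)%N.

(** Apart from the construction of [g], everything follows from invariance: an invariant functional
    is a multiple of the trace, and an invariant symmetric bilinear form is a combination of tr(AB)
    and tr A tr B. *)
Lemma intertwiner_exists : exists g : 'M[C]_d -> 'cV[C]_n,
  [/\ forall A B, g (A + B) = g A + g B,
      forall c A, g (c *: A) = c *: g A,
      forall A, map_mx Num.conj (g A) = g (A^t*) &
      forall U A, U \is unitarymx -> phi U *m g A = g (U *m A *m U^t*)] /\
  (exists kp : C, forall A, (c0^T *m g A) 0 0 = kp * \tr A) /\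
  exists a b : C, 0 < a /\ forall A B, ((g A)^T *m g B) 0 0 = a * \tr (A *m B) + b * (\tr A * \tr B).
Proof.
have phiZ z : unitc z -> phi z%:M = 1%:M.
  move=> hz; apply/(phiK _).2; last by exists z.
  apply/unitarymxP; rewrite tr_scalar_mx map_scalar_mx -scalar_mxM.
  by congr (_%:M); exact: hz.
have [P Pu [wt hwt]] := torus_weights phiU phiR phiM phiZ.
have [rho [[rhoD rhoZ rhoT rhoA rho1] [rhok rhoG rhoc rhoB]]] := derived_rep phiU phiR phiM phiZ Pu hwt.
pose E i j := rho (delta_mx i j).
have rho0 : rho 0 = 0 by rewrite -(scale0r (0 : 'M[C]_d)) rhoZ scale0r.
have rhoN A : rho (- A) = - rho A by rewrite -scaleN1r rhoZ scaleN1r.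
have dcomm i j k l : delta_mx i j *m delta_mx k l - delta_mx k l *m delta_mx i j =
    (j == k)%:R *: delta_mx i l - (l == i)%:R *: delta_mx k j :> 'M[C]_d.
  rewrite !mul_delta_mx_cond; congr (_ - _).
    by case: eqP => _; rewrite ?mulr1n ?mulr0n ?scale1r ?scale0r.
  by case: eqP => _; rewrite ?mulr1n ?mulr0n ?scale1r ?scale0r.
have bracket i j k l : E i j *m E k l - E k l *m E i j = (j == k)%:R *: E i l - (l == i)%:R *: E k j.
  by rewrite /E -rhoB dcomm rhoD rhoN !rhoZ.
have adj i j : (E i j)^t* = E j i by rewrite /E -rhoA trmx_delta map_delta_mx.
have trE : \sum_k E k k = 0.
  rewrite -(big_morph rho rhoD rho0) -[RHS]rho1; congr rho.
  apply/matrixP => i j; rewrite summxE mxE (bigD1 i) //= big1 => [|k ki]; last first.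
    by rewrite mxE eq_sym (negPf ki).
  by rewrite mxE eqxx addr0 [j == i]eq_sym.
have diagE k : P *m E k k = diag_mx (\row_a (wt a k)%:~R) *m P.
  by rewrite /E rhok /Hk mulmxA mulmxA mulmxV // mul1mx.
have weyl (s : 'S_d) : exists2 S : 'M[C]_n, S \in unitmx & forall i j, S *m E i j = E (s i) (s j) *m S.
  have hu := perm_mx_unitary R (s^-1)%g; have hu' := phiU hu.
  exists (phi (perm_mx (s^-1)%g)); first exact: unitarymx_unit hu'.
  move=> i j; have := rhoc _ (delta_mx i j) hu; rewrite perm_mx_conj.
  have -> : \matrix_(a, b) (delta_mx i j : 'M[C]_d) ((s^-1)%g a) ((s^-1)%g b) = delta_mx (s i) (s j).
    by apply/matrixP => a b; rewrite !mxE !(canF_eq (permKV s)).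
  by rewrite /E => ->; rewrite -mulmxA (unitarymx_adjl hu') mulmx1.
have rhoc0 X : X^t* = X -> rho X *m c0 = 0.
  move=> hX; have [K K0 hK] := rhoG X hX.
  apply: (@small_eq0 R n 1 _ (K * nrm c0)); first by rewrite mulr_ge0 ?nrm_ge0.
  move=> t t1; have [U [hU _ h2]] := hK t t1.
  have e : (phi U - 1%:M - Complex 0 t *: rho X) *m c0 = - (Complex 0 t *: (rho X *m c0)).
    by rewrite !mulmxBl mul1mx (phic hU) subrr sub0r -scalemxAl.
  rewrite -nrm_it -nrmN -e mulrAC; apply: le_trans (nrmM _ _) _.
  by rewrite ler_wpM2r ?nrm_ge0.
have fix1 : exists2 c : 'cV[C]_n, c != 0 & forall i j, E i j *m c = 0.
  exists c0 => // i j; rewrite /E (hermE (delta_mx i j)) rhoD rhoZ mulmxDl -scalemxAl.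
  by rewrite !rhoc0 ?herm1P ?herm2P // scaler0 addr0.
(* Otherwise diag(-1, 1, ..., 1) would act as the identity, although it is not scalar. *)
have nontriv : exists k, E k k != 0.
  exists 0; apply/eqP => h.
  have hwt0 a : wt a 0 = 0.
    have := diagE 0; rewrite h mulmx0 => /(congr1 (fun M => M *m invmx P)).
    rewrite mul0mx mulmxK // => /matrixP/(_ a a); rewrite !mxE eqxx mulr1n => /esym/eqP.
    by rewrite intr_eq0 => /eqP.
  have hu := dg_unitary (@hk_unit R m 0 pi).
  have : phi (dg (hk 0 pi)) = 1%:M.
    apply: (can_inj (mulKmx Pu)); rewrite hwt mulmx1 -[RHS]mul1mx; congr (_ *m _).
    by apply/matrixP => i j; rewrite !mxE hwt0 mul0r expi0.
  move/(phiK hu).1 => [z _ /matrixP e].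
  have := e 0 0; have := e 1 1; rewrite !mxE /hk /= !mulr1n => <- /(congr1 (@complex.Re R)) /=.
  by rewrite cospi; lra.
have small1 := wt_small1 bracket adj trE Pu diagE weyl fix1 nontriv dimn.
have small2 := wt_small2 bracket adj trE Pu diagE weyl fix1 nontriv dimn.
have st : (0 : 'I_d) != 1 by [].
have [v v0 hv] := isW_root bracket adj trE Pu diagE weyl nontriv dimn st.
pose f (A : 'M[C]_d) : 'cV[C]_n := \sum_a \sum_b A a b *: fvec E 0 1 v a b.
have fD A B : f (A + B) = f A + f B.
  rewrite /f -big_split; apply: eq_bigr => a _; rewrite -big_split; apply: eq_bigr => b _.
  by rewrite mxE scalerDl.
have fZ c A : f (c *: A) = c *: f A.
  rewrite /f scaler_sumr; apply: eq_bigr => a _; rewrite scaler_sumr; apply: eq_bigr => b _.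
  by rewrite mxE scalerA.
have fdelta a b : f (delta_mx a b) = fvec E 0 1 v a b.
  rewrite /f; move: (fvec E 0 1 v) => F; rewrite (bigD1 a) //= (bigD1 b) //= mxE !eqxx scale1r !big1 ?addr0 // => [i ia|j jb].
    by rewrite big1 // => j _; rewrite mxE (negPf ia) scale0r.
  by rewrite mxE (negPf jb) andbF scale0r.
have lin_ext (V : lmodType C) (F G : 'M[C]_d -> V) :
    (forall A B, F (A + B) = F A + F B) -> (forall c A, F (c *: A) = c *: F A) ->
    (forall A B, G (A + B) = G A + G B) -> (forall c A, G (c *: A) = c *: G A) ->
    (forall i j, F (delta_mx i j) = G (delta_mx i j)) -> F =1 G.
  move=> FD FZ GD GZ h A; rewrite [A]matrix_sum_delta.
  have F0 : F 0 = 0 by rewrite -(scale0r (0 : 'M[C]_d)) FZ scale0r.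
  have G0 : G 0 = 0 by rewrite -(scale0r (0 : 'M[C]_d)) GZ scale0r.
  rewrite (big_morph F FD F0) (big_morph G GD G0); apply: eq_bigr => i _.
  rewrite (big_morph F FD F0) (big_morph G GD G0); apply: eq_bigr => j _.
  by rewrite FZ GZ h.
have fE X A : rho X *m f A = f (X *m A - A *m X).
  have fN B : f (- B) = - f B by rewrite -scaleN1r fZ scaleN1r.
  move: X; apply: (lin_ext _ _ _) => [X Y|c X|X Y|c X|p q].
  - by rewrite rhoD mulmxDl.
  - by rewrite rhoZ scalemxAl.
  - by rewrite mulmxDl mulmxDr opprD addrACA fD.
  - by rewrite -scalemxAl -scalemxAr -scalerBr fZ.
  move: A; apply: (lin_ext _ _ _) => [A B|c A|A B|c A|a b].
  - by rewrite fD mulmxDr.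
  - by rewrite fZ scalemxAr.
  - by rewrite mulmxDl mulmxDr opprD addrACA fD.
  - by rewrite -scalemxAl -scalemxAr -scalerBr fZ.
  rewrite dcomm fD fN !fZ !fdelta; exact: (fvecE bracket small1 small2 st hv).
have f01 : f (delta_mx 0 1) != 0.
  rewrite fdelta (fvec_st bracket small1 st hv) scaler_eq0 (negPf v0) orbF pnatr_eq0.
  by [].
clearbody f.
(* A second intertwiner, because conjugating [rho X] gives minus [rho] of the adjoint of X. Of f +
   fc and i (f - fc), both compatible with conjugation, at least one is nonzero on E_01. *)
pose fc A := map_mx Num.conj (f (A^t*)).
have adjD (X Y : 'M[C]_d) : (X + Y)^t* = X^t* + Y^t* by rewrite linearD /= map_mxD.
have adjZ c (X : 'M[C]_d) : (c *: X)^t* = c^* *: X^t* by rewrite linearZ /= map_mxZ.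
have adjM (X Y : 'M[C]_d) : (X *m Y)^t* = Y^t* *m X^t* by rewrite trmx_mul map_mxM.
have fcD A B : fc (A + B) = fc A + fc B by rewrite /fc adjD fD map_mxD.
have fcZ c A : fc (c *: A) = c *: fc A.
  by rewrite /fc adjZ fZ map_mxZ /= conjCK.
have rho_bar X : map_mx Num.conj (rho X) = - rho (X^t*).
  by rewrite rhoA rhoT map_mxN opprK.
have fcE X A : rho X *m fc A = fc (X *m A - A *m X).
  have e : rho X = - map_mx Num.conj (rho (X^t*)) by rewrite rho_bar opprK trmxCK.
  have e2 : (X *m A - A *m X)^t* = - (X^t* *m A^t* - A^t* *m X^t*).
    by rewrite -[- (A *m X)]scaleN1r adjD adjZ !adjM rmorphN1 scaleN1r opprB.
  by rewrite /fc e mulNmx -map_mxM fE e2 -[- (_ - _)]scaleN1r fZ scaleN1r map_mxN.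
have [g [gD gZ gC gE g01]] : exists g : 'M[C]_d -> 'cV[C]_n,
    [/\ forall A B, g (A + B) = g A + g B, forall c A, g (c *: A) = c *: g A,
      forall A, map_mx Num.conj (g A) = g (A^t*),
      forall X A, rho X *m g A = g (X *m A - A *m X) & g (delta_mx 0 1) != 0].
  have fcc A : map_mx Num.conj (f A) = fc (A^t*) by rewrite /fc trmxCK.
  have fcc' A : map_mx Num.conj (fc A) = f (A^t*).
    by rewrite /fc; apply/matrixP => i j; rewrite !mxE conjCK.
  case: (eqVneq (f (delta_mx 0 1) + fc (delta_mx 0 1)) 0) => h; last first.
    exists (fun A => f A + fc A); split=> //.
    - by move=> A B; rewrite fD fcD addrACA.
    - by move=> c A; rewrite fZ fcZ scalerDr.
    - by move=> A; rewrite map_mxD fcc fcc' addrC.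
    - by move=> X A; rewrite mulmxDr fE fcE.
  exists (fun A => Complex 0 1 *: (f A - fc A)); split=> //.
  - by move=> A B; rewrite fD fcD -scalerDr opprD addrACA.
  - by move=> c A; rewrite fZ fcZ -scalerBr !scalerA mulrC.
  - move=> A; rewrite map_mxZ map_mxB fcc fcc' -opprB scalerN -scaleNr; congr (_ *: _).
    by apply: complex_ext; rewrite ?cReN ?cImN ?cRe_conj ?cIm_conj /= ?oppr0 ?opprK.
  - by move=> X A; rewrite -scalemxAr mulmxBr fE fcE.
  have -> : fc (delta_mx 0 1) = - f (delta_mx 0 1) by apply/eqP; rewrite -addr_eq0 addrC h.
  rewrite opprK -mulr2n -scaler_nat scalerA scaler_eq0 (negPf f01) orbF mulf_neq0 ?pnatr_eq0 //.
  by apply/eqP => /(congr1 (@complex.Im R)) /= /eqP; rewrite oner_eq0.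
(* Equivariance under the group is recovered without exponentiating: after diagonalising U, a vector
   of weight e_a - e_b is multiplied by e^(i(th_a - th_b)), exactly as E_ab is under conjugation. *)
exists g; split; first (split; [exact: gD | exact: gZ | exact: gC | move=> U A hU]).
  have [V hV [th eU]] := unitary_spectral hU.
  set Dm := dg (fun k => expi (th k)) in eU.
  have hD : Dm \is unitarymx by apply: dg_unitary => k; exact: unitc_expi.
  have hV' : V^t* \is unitarymx by rewrite trmxC_unitary.
  pose Z B := V *m B *m V^t*.
  have ZD B B' : Z (B + B') = Z B + Z B' by rewrite /Z mulmxDr mulmxDl.
  have ZZ c B : Z (c *: B) = c *: Z B by rewrite /Z -scalemxAr -scalemxAl.
  have ZM B B' : Z (B *m B') = Z B *m Z B'.
    by rewrite /Z !mulmxA -[_ *m V^t* *m V]mulmxA (unitarymx_adjl hV) mulmx1.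
  have -> : A = Z (V^t* *m A *m V).
    by rewrite /Z !mulmxA (unitarymxP hV) mul1mx -mulmxA (unitarymxP hV) mulmx1.
  move: (V^t* *m A *m V) => {}A.
  have eUU B : U *m B *m U^t* = Z (Dm *m (V^t* *m B *m V) *m Dm^t*).
    by rewrite eU /Z !trmx_mul !map_mxM trmxCK !mulmxA.
  have VZV B : V^t* *m Z B *m V = B.
    by rewrite /Z !mulmxA (unitarymx_adjl hV) mul1mx -mulmxA (unitarymx_adjl hV) mulmx1.
  move: A; apply: (lin_ext _ _ _) => [B B'|c B|B B'|c B|a b].
  - by rewrite ZD gD mulmxDr.
  - by rewrite ZZ gZ scalemxAr.
  - by rewrite ZD mulmxDr mulmxDl gD.
  - by rewrite ZZ -scalemxAr -scalemxAl gZ.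
  rewrite eUU VZV.
  have -> : Dm *m delta_mx a b *m Dm^t* = expi (th a - th b) *: delta_mx a b.
    rewrite /Dm /dg tr_diag_mx map_diag_mx mul_diag_mx mul_mx_diag.
    apply/matrixP => i j; rewrite !mxE expiD expiN.
    case: (eqVneq i a) => [->|]; last by rewrite !mulr0 mul0r.
    by case: (eqVneq j b) => [->|]; rewrite /= ?mulr1 ?mulr0 ?mul0r // mulr1.
  rewrite ZZ gZ.
  pose y := (phi V)^t* *m g (Z (delta_mx a b)).
  have hy k : E k k *m y = (root a b k)%:~R *: y.
    have h1 : (phi V)^t* *m rho (Z (delta_mx k k)) = E k k *m (phi V)^t*.
      by rewrite /Z (rhoc _ _ hV) !mulmxA (unitarymx_adjl (phiU hV)) mul1mx.
    rewrite /y mulmxA -h1 -mulmxA gE -!ZM -scaleN1r -ZZ -ZD scaleN1r dcomm.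
    rewrite scalemxAr -gZ -ZZ; congr (_ *m g (Z _)).
    rewrite /root intrB scalerBl; congr (_ - _).
      by case: (eqVneq k a) => [->|_]; rewrite ?scale0r.
    by rewrite [b == k]eq_sym; case: (eqVneq k b) => [->|_]; rewrite ?scale0r.
  have hDy : phi Dm *m y = expi (th a - th b) *: y.
    apply: (can_inj (mulKmx Pu)); rewrite mulmxA (phi_dg phiM phiZ hwt) -mulmxA -scalemxAr.
    apply/matrixP => i j; rewrite mul_diag_mx [LHS]mxE [RHS]mxE ord1 [X in X * _]mxE.
    case: (eqVneq ((P *m y) i 0) 0) => [->|h0]; first by rewrite !mulr0.
    congr (expi _ * _).
    have hwi k : wt i k = root a b k.
      have /(congr1 (fun M : 'cV_n => (P *m M) i 0)) := hy k; rewrite mulmxA diagE -mulmxA mul_diag_mx.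
      rewrite -scalemxAr [LHS]mxE [X in X * _]mxE [RHS]mxE => /eqP.
      by rewrite -subr_eq0 -mulrBl mulf_eq0 (negPf h0) orbF subr_eq0 eqr_int => /eqP.
    rewrite (eq_bigr (fun k => (k == a)%:R * th k - (k == b)%:R * th k)); last first.
      by move=> k _; rewrite hwi /root intrB -mulrBl; do 2 case: eqP => _.
    rewrite sumrB (bigD1 a) //= (bigD1 b (P := predT)) //= !eqxx !mul1r !big1 ?addr0 //.
      by move=> k /negPf->; rewrite mul0r.
    by move=> k /negPf->; rewrite mul0r.
  rewrite eU (phi_conj phiU phiM phiZ hV hD) -mulmxA -/y -mulmxA hDy -scalemxAr.
  by rewrite /y mulmxA (unitarymxP (phiU hV)) mul1mx.
split.
  have rhoca X : rho X *m c0 = 0.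
    rewrite (hermE X) rhoD rhoZ mulmxDl -scalemxAl.
    by rewrite !rhoc0 ?herm1P ?herm2P // scaler0 addr0.
  (* [c0] is annihilated by [rho], so the functional vanishes on commutators, and modulo commutators
     every matrix is a multiple of E_00. *)
  have kz X A : c0^T *m g (X *m A - A *m X) = 0.
    by rewrite -gE mulmxA -[rho X]trmxK -trmx_mul rhoT mulNmx rhoca oppr0 trmx0 mul0mx.
  exists ((c0^T *m g (delta_mx 0 0)) 0 0) => A.
  suff -> : c0^T *m g A = \tr A *: (c0^T *m g (delta_mx 0 0)) by rewrite [LHS]mxE mulrC.
  move: A; apply: (lin_ext _ _ _) => [A B|c A|A B|c A|i j].
  - by rewrite gD mulmxDr.
  - by rewrite gZ scalemxAr.
  - by rewrite mxtraceD scalerDl.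
  - by rewrite mxtraceZ scalerA.
  case: (eqVneq i j) => [<-|ij].
    have -> : \tr (delta_mx i i : 'M[C]_d) = 1.
      by rewrite /mxtrace (bigD1 i) //= mxE !eqxx big1 ?addr0 // => k ki; rewrite mxE (negPf ki).
    rewrite scale1r; case: (eqVneq i 0) => [->//|i0].
    have := kz (delta_mx i 0) (delta_mx 0 i); rewrite dcomm !eqxx !scale1r -[- delta_mx 0 0]scaleN1r.
    by rewrite gD gZ scaleN1r mulmxDr mulmxN => /eqP; rewrite subr_eq0 => /eqP.
  have -> : \tr (delta_mx i j : 'M[C]_d) = 0.
    rewrite /mxtrace big1 // => k _; rewrite mxE; case: (eqVneq k i) => [->|//].
    by rewrite (negPf ij).
  have := kz (delta_mx i i) (delta_mx i j); rewrite dcomm eqxx [j == i]eq_sym (negPf ij) scale0r subr0 scale1r => ->.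
  by rewrite scale0r.
(* The transpose without conjugation keeps [b] bilinear and symmetric; antisymmetry of [rho] makes
   it invariant. *)
pose b A B := ((g A)^T *m g B) 0 0.
have bDl A A' B : b (A + A') B = b A B + b A' B by rewrite /b gD linearD /= mulmxDl mxE.
have bZl c A B : b (c *: A) B = c * b A B by rewrite /b gZ linearZ /= -scalemxAl mxE.
have bS A B : b A B = b B A.
  by rewrite /b -{1}[g B]trmxK -trmx_mul mxE.
have bDr A B B' : b A (B + B') = b A B + b A B' by rewrite bS bDl !(bS A).
have bZr c A B : b A (c *: B) = c * b A B by rewrite bS bZl (bS A).
have binv X A B : b (X *m A - A *m X) B = - b A (X *m B - B *m X).
  rewrite /b -!gE trmx_mul rhoT mulmxN mulNmx mulmxA.
  by rewrite [LHS]mxE.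
have bNl A B : b (- A) B = - b A B by rewrite -scaleN1r bZl mulN1r.
have bNr A B : b A (- B) = - b A B by rewrite bS bNl bS.
pose dl i j : 'M[C]_d := delta_mx i j.
have binvd p q i j k l : (q == i)%:R * b (dl p j) (dl k l) - (j == p)%:R * b (dl i q) (dl k l) =
    - ((q == k)%:R * b (dl i j) (dl p l) - (l == p)%:R * b (dl i j) (dl k q)).
  have := binv (dl p q) (dl i j) (dl k l); rewrite /dl !dcomm bDl bDr bNl bNr !bZl !bZr.
  by [].
have dbl0 (x : C) : x = - x -> x = 0.
  by move=> h; apply/eqP; rewrite -[_ == _](mulrn_eq0 x 2) mulr2n {1}h addNr.
(* Invariance under diagonal matrix units: two vectors pair to zero unless their weights are
   opposite. *)
have b0 i j k l : i != j -> ~~ ((k == j) && (l == i)) -> b (dl i j) (dl k l) = 0.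
  move=> ij; rewrite negb_and => /orP[kj|li].
    have := binvd j j i j k l; rewrite eqxx [j == i]eq_sym (negPf ij) [j == k]eq_sym (negPf kj) !mul0r !mul1r !sub0r.
    case: (eqVneq l j) => [->|_]; rewrite ?mul0r ?oppr0 ?mul1r ?opprK => h.
      exact: dbl0 (esym h).
    by apply/eqP; rewrite -oppr_eq0 h.
  have := binvd i i i j k l; rewrite eqxx [j == i]eq_sym (negPf ij) (negPf li) !mul0r !mul1r !subr0.
  case: (eqVneq i k) => [<-|_]; rewrite ?mul0r ?oppr0 ?mul1r // => h.
  exact: dbl0.
(* E_10 is the adjoint of E_01, so the reality of [g] turns this value into a Hermitian square
   norm. *)
have aP : 0 < b (dl 0 1) (dl 1 0).
  have -> : dl 1 0 = (dl 0 1)^t* by rewrite /dl trmx_delta map_delta_mx.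
  rewrite /b -gC; set w := g (dl 0 1) in g01 *.
  have hw : map_mx Num.conj w != 0.
    apply: contra g01 => /eqP h; apply/eqP/matrixP => i j; have /matrixP/(_ i j) := h.
    by rewrite !mxE => /eqP; rewrite conjC_eq0 => /eqP.
  have := sqn_gt0 hw; congr (0 < (_ *m _) 0 0).
  by apply/matrixP => i j; rewrite !mxE conjCK.
pose al := b (dl 0 1) (dl 1 0).
have move1 i j k : i != j -> k != j -> b (dl k j) (dl j k) = b (dl i j) (dl j i).
  move=> ij kj; case: (eqVneq k i) => [->//|ki].
  have := binvd k i i j j k; rewrite !eqxx [j == k]eq_sym (negPf kj) (negPf ij) !mul0r !mul1r subr0 sub0r opprK.
  by [].
have aE i j : i != j -> b (dl i j) (dl j i) = al.
  have two i' j' : i' != j' -> b (dl i' j') (dl j' i') = b (dl j' i') (dl i' j') by move=> _; exact: bS.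
  move=> ij; case: (eqVneq j 1) => [j1|j1].
    by rewrite /al j1; apply: move1 => //; rewrite -j1.
  have e1 : b (dl i j) (dl j i) = b (dl 1 j) (dl j 1).
    by rewrite (move1 i j 1 ij) // eq_sym.
  rewrite e1 bS; case: (eqVneq j 0) => [->//|j0].
  by rewrite (move1 0 1 j).
pose be := b (dl 0 0) (dl 1 1).
(* Since E_ii - E_jj = [E_ij, E_ji], invariance expresses differences of diagonal values through
   [al]; a single constant [be] stays free. *)
have dd i j k : b (dl i i) (dl k k) - b (dl j j) (dl k k) = ((i == k)%:R - (j == k)%:R) * al.
  case: (eqVneq i j) => [->|ij]; first by rewrite !subrr mul0r.
  have ji : j != i by rewrite eq_sym.
  have := binvd i j j i k k; rewrite !eqxx !mul1r => ->.
  rewrite [k == i]eq_sym; case: (eqVneq j k) => [<-|jk].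
    by rewrite (negPf ij) (aE _ _ ji) /=; ring.
  case: (eqVneq i k) => [<-|ik]; last by rewrite !mul0r; ring.
  by rewrite (aE _ _ ji) /=; ring.
have bdiag i k : b (dl i i) (dl k k) = (i == k)%:R * al + be.
  have h1 := dd i 0 k; have h2 := dd k 1 0.
  have e10 : ((1 : 'I_d) == 0)%:R = 0 :> C by [].
  have e0 : b (dl 0 0) (dl k k) = (k == 0)%:R * al + be.
    rewrite bS -[LHS](subrK (b (dl 1 1) (dl 0 0))) h2 (bS (dl 1 1)) -/be e10.
    by rewrite subr0.
  rewrite -[LHS](subrK (b (dl 0 0) (dl k k))) h1 e0 [0 == k]eq_sym.
  by rewrite mulrBl addrA subrK.
exists al, be; split; first exact: aP.
move=> A B; rewrite -/(b A B).
have bdelta i j k l : b (dl i j) (dl k l) = al * ((k == j) && (l == i))%:R + be * ((i == j) && (k == l))%:R.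
  case: (eqVneq i j) => [<-|ij]; last first.
    rewrite /= mulr0 addr0; case: (boolP ((k == j) && (l == i))) => [/andP[/eqP -> /eqP ->]|h].
      by rewrite aE // mulr1.
    by rewrite b0 // mulr0.
  case: (eqVneq k l) => [<-|kl].
    by rewrite bdiag andbb /= [i == k]eq_sym; ring.
  rewrite bS b0 //; last by rewrite andbC; apply: contra kl => /andP[/eqP <- /eqP <-].
  have -> : (k == i) && (l == i) = false by apply: contraNF kl => /andP[/eqP -> /eqP ->].
  by rewrite !mulr0 addr0.
have b0l B' : b 0 B' = 0 by rewrite -(scale0r (0 : 'M[C]_d)) bZl mul0r.
have b0r B' : b B' 0 = 0 by rewrite bS b0l.
have bsum : b A B = \sum_i \sum_j \sum_k \sum_l A i j * (B k l * b (dl i j) (dl k l)).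
  rewrite {1}[A]matrix_sum_delta (big_morph (fun X => b X B) (fun X Y => bDl X Y B) (b0l B)).
  apply: eq_bigr => i _; rewrite (big_morph (fun X => b X B) (fun X Y => bDl X Y B) (b0l B)).
  apply: eq_bigr => j _; rewrite bZl {1}[B]matrix_sum_delta.
  rewrite (big_morph (b (dl i j)) (bDr (dl i j)) (b0r _)) mulr_sumr; apply: eq_bigr => k _.
  rewrite (big_morph (b (dl i j)) (bDr (dl i j)) (b0r _)) mulr_sumr; apply: eq_bigr => l _.
  by rewrite bZr.
have -> : al * \tr (A *m B) = \sum_i \sum_j A i j * (B j i * al).
  rewrite /mxtrace mulr_sumr; apply: eq_bigr => i _; rewrite mxE mulr_sumr; apply: eq_bigr => j _.
  by ring.
have -> : be * (\tr A * \tr B) = \sum_i \sum_k A i i * (B k k * be).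
  rewrite /mxtrace mulr_suml mulr_sumr; apply: eq_bigr => i _; rewrite !mulr_sumr; apply: eq_bigr => k _.
  by ring.
rewrite bsum -big_split; apply: eq_bigr => i _ /=.
have e1 : \sum_j \sum_k \sum_l A i j * (B k l * b (dl i j) (dl k l)) =
   \sum_j (A i j * (B j i * al) + (i == j)%:R * \sum_k A i i * (B k k * be)).
  apply: eq_bigr => j _.
  transitivity (\sum_k \sum_l (((k == j) && (l == i))%:R * (A i j * (B k l * al)) + (k == l)%:R * ((i == j)%:R * (A i j * (B k l * be))))).
    apply: eq_bigr => k _; apply: eq_bigr => l _; rewrite bdelta -!mulnb !natrM; ring.
  under eq_bigr => k _ do rewrite big_split /=.
  rewrite big_split /=; congr (_ + _).
    rewrite (bigD1 j) //= (bigD1 i) //= !eqxx mul1r !big1 ?addr0 // => [k kj|l li].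
      by rewrite big1 // => l _; rewrite (negPf kj) mul0r.
    by rewrite (negPf li) andbF mul0r.
  rewrite mulr_sumr; apply: eq_bigr => k _; rewrite (bigD1 k) //= eqxx mul1r big1 ?addr0.
    by case: (eqVneq i j) => [->|_]; rewrite ?mul0r.
  by move=> l; rewrite eq_sym => /negPf->; rewrite mul0r.
rewrite e1 big_split /=; congr (_ + _).
move: (\sum_k A i i * (B k k * be)) => S.
rewrite (bigD1 i) //= eqxx mul1r big1 ?addr0 // => j; rewrite eq_sym => /negPf->.
by rewrite mul0r.
Qed.

End Adjoint.

(** * Unitarily invariant self-dual sets of trace-one Hermitian matrices *)

Section SelfDual.
Variable R : realType.

Lemma perm_extend (d : nat) (x0 : 'I_d) (t : seq 'I_d) : uniq t ->
  exists p : 'S_d, forall k : 'I_d, (k < size t)%N -> p k = nth x0 t k.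
Proof.
move=> ut; pose u := t ++ [seq x <- enum 'I_d | x \notin t].
have uu : uniq u.
  rewrite cat_uniq ut filter_uniq ?enum_uniq // andbT /=; apply/hasPn => x.
  by rewrite mem_filter => /andP[].
have su : size u = d.
  rewrite -[RHS](size_enum_ord d); apply/perm_size/uniq_perm; rewrite ?enum_uniq // => x.
  by rewrite mem_cat mem_filter mem_enum andbT; case: (x \in t).
have inj : injective (fun k : 'I_d => nth x0 u k).
  by move=> i j /eqP; rewrite nth_uniq ?su // => /eqP/val_inj.
by exists (perm inj) => k hk; rewrite permE nth_cat hk.
Qed.

(** The overlaps of l with its cyclic shifts add up to (sum l)^2 = 1. The trivial shift alone gives
    sum l^2 = 1, so the others, being nonnegative, vanish. Composing the unit shift with a
    transposition then yields a sign condition on differences, valid after any relabelling. *)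
Lemma spectrum_shape m (l : 'I_m.+2 -> R) :
  \sum_i l i = 1 -> \sum_i l i ^+ 2 = 1 -> (forall s : 'S_m.+2, 0 <= \sum_i l i * l (s i)) ->
  exists o b, forall k, k != o -> l k = b.
Proof.
move=> h1 h2 h3.
have shift (l' : 'I_m.+2 -> R) : \sum_i l' i = 1 -> \sum_i l' i ^+ 2 = 1 ->
    (forall s : 'S_m.+2, 0 <= \sum_i l' i * l' (s i)) ->
    forall i j, i != j -> (l' i - l' j) * (l' (i + 1) - l' (j + 1)) <= 0.
  move=> g1 g2 g3 i j ij.
  pose sh (k x : 'I_m.+2) : 'I_m.+2 := x + k.
  have inj k : injective (sh k) by exact: addIr.
  have ge0 k : 0 <= \sum_x l' x * l' (x + k).
    by have := g3 (perm (inj k)); under eq_bigr => x _ do rewrite permE /sh.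
  have tot : \sum_k \sum_x l' x * l' (x + k) = 1.
    rewrite exchange_big /=.
    transitivity (\sum_x l' x * 1); last by rewrite -mulr_suml g1 mulr1.
    apply: eq_bigr => x _; rewrite -mulr_sumr; congr (_ * _); rewrite -g1.
    by rewrite [RHS](reindex_inj (addrI x)).
  have z1 : \sum_x l' x * l' (x + 1) = 0.
    have : \sum_(k | k != 0) \sum_x l' x * l' (x + k) = 0.
      move: tot; rewrite (bigD1 0) //=.
      have -> : \sum_x l' x * l' (x + 0) = 1 by rewrite -[RHS]g2; apply: eq_bigr => x _; rewrite addr0 expr2.
      by move=> h; apply: (addrI 1); rewrite h addr0.
    by move/psumr_eq0P => h; apply: h.
  have inj2 : injective (fun x => sh 1 (tperm i j x)) by move=> x y /inj /perm_inj.
  have := g3 (perm inj2).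
  have -> : \sum_x l' x * l' (perm inj2 x) =
      \sum_x (l' x * l' (tperm i j x + 1) - l' x * l' (x + 1)).
    by rewrite sumrB z1 subr0; apply: eq_bigr => x _; rewrite permE.
  rewrite (bigD1 i) //= (bigD1 j) 1?eq_sym //= big1 => [|x /andP[xi xj]]; last first.
    by rewrite tpermD 1?eq_sym // subrr.
  by rewrite tpermL tpermR; move: (l' i) (l' j) (l' (i + 1)) (l' (j + 1)) => a b c e; nra.
have shiftp (p : 'S_m.+2) i j : i != j -> (l (p i) - l (p j)) * (l (p (i + 1)) - l (p (j + 1))) <= 0.
  apply: (shift (fun x => l (p x))) => //.
  - by rewrite -h1 [RHS](reindex_inj (@perm_inj _ p)).
  - by rewrite -h2 [RHS](reindex_inj (@perm_inj _ p)).
  move=> s; have := h3 (p^-1 * s * p)%g; rewrite (reindex_inj (@perm_inj _ p)) /=.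
  by under eq_bigr => x _ do rewrite !permM permK.
(* x, y, z are relabelled to consecutive places. Used for the three cyclic orders, this excludes
   three distinct values: two of the three successive differences would share a sign. *)
have tri x y z : uniq [:: x; y; z] -> (l x - l y) * (l y - l z) <= 0.
  move=> u; have [p hp] := perm_extend 0 u.
  have m1 : (2 < m.+2)%N.
    by have := uniq_leq_size u (s2 := enum 'I_m.+2); rewrite size_enum_ord; apply=> w _; rewrite mem_enum.
  have := shiftp p 0 1 isT.
  have -> : p 0 = x by rewrite hp.
  have -> : p (0 + 1) = y by rewrite add0r hp.
  have -> : p 1 = y by rewrite hp.
  have e2 : nat_of_ord ((1 + 1)%R : 'I_m.+2) = 2%N by rewrite /= modn_small // modn_small.
  by have -> : p (1 + 1) = z by rewrite hp e2.
(* Used with l z = l x and l w = l y, this excludes two values that both occur at least twice. *)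
have quad x y z w : uniq [:: x; z; y; w] -> (l x - l y) * (l z - l w) <= 0.
  move=> u; have [p hp] := perm_extend 0 u.
  have m1 : (3 < m.+2)%N.
    by have := uniq_leq_size u (s2 := enum 'I_m.+2); rewrite size_enum_ord; apply=> ? _; rewrite mem_enum.
  have e2 : nat_of_ord ((1 + 1)%R : 'I_m.+2) = 2%N by rewrite /= modn_small // modn_small // ltnW.
  have e3 : nat_of_ord ((1 + 1 + 1)%R : 'I_m.+2) = 3%N by rewrite /= !modn_small // ?modn_small // ltnW.
  have n02 : (0 : 'I_m.+2) != 1 + 1 by apply/eqP => /(congr1 (@nat_of_ord _)); rewrite e2.
  have := shiftp p 0 (1 + 1) n02.
  have -> : p 0 = x by rewrite hp.
  have -> : p (0 + 1) = z by rewrite add0r hp.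
  have -> : p (1 + 1) = y by rewrite hp e2.
  by have -> : p (1 + 1 + 1) = w by rewrite hp e3.
case: (pselect (exists x y, l x != l y)) => [[x [y xy]]|h]; last first.
  exists 0, (l 0) => k _; apply/eqP/negPn/negP => hk; apply: h; by exists k, 0.
have nxy : x != y by apply: contra xy => /eqP ->.
have two z : z != x -> z != y -> l z = l x \/ l z = l y.
  move=> zx zy.
  have nyz : y != z by rewrite eq_sym.
  have nxz : x != z by rewrite eq_sym.
  have nyx : y != x by rewrite eq_sym.
  have u1 : uniq [:: x; y; z] by rewrite /= !inE negb_or nxy nxz nyz.
  have u2 : uniq [:: y; z; x] by rewrite /= !inE negb_or nyz nyx zx.
  have u3 : uniq [:: z; x; y] by rewrite /= !inE negb_or zx zy nxy.
  have := tri _ _ _ u1; have := tri _ _ _ u2; have := tri _ _ _ u3.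
  case: (eqVneq (l z) (l x)) => [->|hzx]; first by left.
  case: (eqVneq (l z) (l y)) => [->|hzy]; first by right.
  move: (l x) (l y) (l z) xy hzx hzy => a b c; rewrite !neq_lt.
  by move=> /orP[] ? /orP[] ? /orP[] ? ? ? ?; exfalso; nra.
case: (pselect (forall z, z != x -> l z = l y)) => [h|/existsNP[z /not_implyP[zx hz]]].
  by exists x, (l y).
case: (pselect (forall w, w != y -> l w = l x)) => [h|/existsNP[w /not_implyP[wy hw]]].
  by exists y, (l x).
have zy : z != y by apply/eqP => e; apply: hz; rewrite e.
have wx : w != x by apply/eqP => e; apply: hw; rewrite e.
have lz : l z = l x by case: (two _ zx zy).
have lw : l w = l y by case: (two _ wx wy).
have zw : z != w by apply: contra xy => /eqP e; rewrite -lz -lw e.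
have u : uniq [:: x; z; y; w].
  by rewrite /= !inE !negb_or eq_sym zx nxy [x == w]eq_sym wx zy zw [y == w]eq_sym wy.
have := quad _ _ _ _ u; rewrite lz lw -expr2 => h.
have : (l x - l y) ^+ 2 == 0 by rewrite eq_le h sqr_ge0.
by rewrite sqrf_eq0 subr_eq0 (negPf xy).
Qed.

Variable m : nat.
Local Notation d := m.+2.
Local Notation C := R[i].

Definition dens (A : 'M[C]_d) := [/\ A^t* = A, \tr A = 1 & forall v : 'cV[C]_d, 0 <= (v^t* *m A *m v) 0 0].

Lemma herm_spectral (A : 'M[C]_d) : A^t* = A -> exists2 V, V \is unitarymx &
  exists l : 'I_d -> R, A = V^t* *m dg (fun k => (l k)%:C%C) *m V.
Proof.
move=> hX; have hh : A \is hermsymmx by apply/is_hermitianmxP; rewrite expr0 scale1r hX.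
have /orthomx_spectralP := hermitian_normalmx hh.
set V := spectralmx A; set f := spectral_diag A => e.
have hV : V \is unitarymx := spectral_unitarymx A.
rewrite (invmx_unitary hV) in e.
have hf k : exists c : R, f 0 k = c%:C%C.
  by apply/complex_realP; have /mxOverP := hermitian_spectral_diag_real hh; exact.
have /choice[c hc] := hf; exists V; first exact: hV.
exists c; rewrite {1}e; congr (_ *m _ *m _); rewrite /dg; congr diag_mx.
by apply/matrixP => i j; rewrite ord1 mxE hc.
Qed.

Lemma tr_dg_mul (f : 'I_d -> C) (B : 'M[C]_d) : \tr (dg f *m B) = \sum_k f k * B k k.
Proof. by rewrite /mxtrace; apply: eq_bigr => k _; rewrite mul_diag_mx !mxE. Qed.

(** The order on [R[i]] makes 0 <= z include that z is real. For trace-one matrices the polar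
    threshold turns into the threshold zero for the trace form. *)
Definition selfdual (T : 'M[C]_d -> Prop) :=
  [/\ forall A, T A -> A^t* = A /\ \tr A = 1,
      forall A, A^t* = A -> \tr A = 1 -> (T A <-> forall B, T B -> 0 <= \tr (A *m B)) &
      forall U A, U \is unitarymx -> T A -> T (U *m A *m U^t*)].

(** By invariance every E_kk lies in T, so all diagonal entries of members and of their conjugates
    are nonnegative. Diagonalising a member makes it positive; diagonalising a density matrix shows
    that it pairs nonnegatively with T. *)
Lemma selfdual_delta T o : selfdual T -> T (delta_mx o o) -> forall A, T A <-> dens A.
Proof.
move=> [T1 T2 T3] Td.
have Tk k : T (delta_mx k k).
  have := T3 _ _ (perm_mx_unitary R (tperm k o)) Td; rewrite perm_mx_conj; congr T.
  have e x : (tperm k o x == o) = (x == k) by rewrite -[X in _ == X](tpermL k o) (inj_eq perm_inj).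
  by apply/matrixP => i j; rewrite !mxE !e.
have pos A B : T A -> T B -> 0 <= \tr (A *m B).
  by move=> hA hB; have [h1 h2] := T1 A hA; exact: (T2 A h1 h2).1.
have trd k B : \tr (delta_mx k k *m B) = B k k.
  rewrite /mxtrace (bigD1 k) //= big1 => [|i ik].
    by rewrite addr0 mxE (bigD1 k) //= big1 => [|j jk]; rewrite !mxE ?eqxx ?mul1r ?addr0 // (negPf jk) andbF mul0r.
  by rewrite mxE big1 // => j _; rewrite mxE (negPf ik) mul0r.
have entry A k : T A -> 0 <= A k k by move=> hA; rewrite -trd; exact: pos.
move=> A; split=> [hA|[hA trA psd]].
  have [h1 h2] := T1 A hA; split=> // v.
  have [V hV [l e]] := herm_spectral h1.
  have eD : dg (fun k => (l k)%:C%C) = V *m A *m V^t*.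
    by rewrite e !mulmxA (unitarymxP hV) mul1mx -mulmxA (unitarymxP hV) mulmx1.
  have l0 k : 0 <= (l k)%:C%C :> C.
    by have := entry _ k (T3 _ _ hV hA); rewrite -eD !mxE eqxx mulr1n.
  have -> : v^t* *m A *m v = (V *m v)^t* *m dg (fun k => (l k)%:C%C) *m (V *m v).
    by rewrite trmx_mul map_mxM e !mulmxA.
  move: (V *m v) => w; rewrite mul_mx_diag mxE; apply: sumr_ge0 => k _; rewrite !mxE.
  by rewrite mulrAC mulr_ge0 // mulrC -normCK exprn_ge0.
apply/(T2 A hA trA) => B hB; have [V hV [l e]] := herm_spectral hA.
have eD : dg (fun k => (l k)%:C%C) = V *m A *m V^t*.
  by rewrite e !mulmxA (unitarymxP hV) mul1mx -mulmxA (unitarymxP hV) mulmx1.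
have l0 k : 0 <= (l k)%:C%C :> C.
  have := psd (V^t* *m delta_mx k 0); rewrite trmx_mul map_mxM trmxCK trmx_delta map_delta_mx.
  rewrite -!mulmxA [V *m (A *m _)]mulmxA [V *m A *m _]mulmxA -eD mul_diag_mx.
  rewrite mxE (bigD1 k) //= big1 => [|i ik]; last by rewrite !mxE (negPf ik) ?andbF ?mul0r.
  by rewrite !mxE !eqxx mul1r mulr1 addr0.
have -> : \tr (A *m B) = \tr (dg (fun k => (l k)%:C%C) *m (V *m B *m V^t*)).
  by rewrite {1}e -!mulmxA mxtrace_mulC -!mulmxA.
rewrite tr_dg_mul; apply: sumr_ge0 => k _; apply: mulr_ge0 => //.
exact/entry/T3.
Qed.

(** On trace-one matrices this is the point reflection in I/d; the factor [\tr A] makes it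
    linear. *)
Definition refl (A : 'M[C]_d) : 'M[C]_d := (2 / d%:R * \tr A)%:M - A.

Lemma tr_refl A : \tr (refl A) = \tr A.
Proof.
rewrite /refl raddfB /= mxtrace_scalar -[_ *+ d]mulr_natr.
have d0 : (d%:R : C) != 0 by rewrite pnatr_eq0.
by move: (d%:R : C) d0 => x x0; field.
Qed.

Lemma refl_adj A : (refl A)^t* = refl (A^t*).
Proof.
have e : (2 / d%:R * \tr A)^* = 2 / d%:R * \tr (A^t*).
  rewrite rmorphM rmorphM fmorphV /= !conjC_nat; congr (_ * _).
  by rewrite /mxtrace rmorph_sum; apply: eq_bigr => i _; rewrite !mxE.
by rewrite /refl raddfB raddfB /= tr_scalar_mx map_scalar_mx /= e.
Qed.

Lemma reflK A : refl (refl A) = A.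
Proof. by rewrite {1}/refl tr_refl /refl opprB addrC subrK. Qed.

Lemma tr_refl_mul A B : \tr (refl A *m refl B) = \tr (A *m B).
Proof.
rewrite /refl mulmxBl !mulmxBr -scalar_mxM mul_scalar_mx mul_mx_scalar !raddfB /= mxtrace_scalar !mxtraceZ -[_ *+ d]mulr_natr.
have d0 : (d%:R : C) != 0 by rewrite pnatr_eq0.
by move: (d%:R : C) d0 => x x0; field.
Qed.

Lemma selfdual_refl T : selfdual T -> selfdual (fun A => T (refl A)).
Proof.
move=> [T1 T2 T3]; split.
- by move=> A /T1[h1 h2]; rewrite -(tr_refl A); split=> //; rewrite -[A]reflK refl_adj h1.
- move=> A hA trA; rewrite T2 ?refl_adj ?hA ?tr_refl //; split=> h B hB.
    by rewrite -tr_refl_mul; exact: h.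
  by rewrite -tr_refl_mul reflK; apply: h; rewrite reflK.
move=> U A hU /(T3 _ _ hU); congr T.
rewrite /refl mulmxBr mulmxBl mul_mx_scalar -scalemxAl (unitarymxP hU) scalemx1; congr ((_ * _)%:M - _).
by rewrite mxtrace_mulC mulmxA (unitarymx_adjl hU) mul1mx.
Qed.

Lemma selfdual_dens T : selfdual T -> (exists2 A, T A & \tr (A *m A) = 1) ->
  (forall A, T A <-> dens A) \/ (forall A, T (refl A) <-> dens A).
Proof.
move=> sd [A0 TA trA2]; have [T1 T2 T3] := sd; have [hA trA] := T1 _ TA.
have [V hV [l e]] := herm_spectral hA.
pose Dl (s : 'S_d) := dg (fun k => (l (s k))%:C%C).
have eD : dg (fun k => (l k)%:C%C) = V *m A0 *m V^t*.
  by rewrite e !mulmxA (unitarymxP hV) mul1mx -mulmxA (unitarymxP hV) mulmx1.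
have T0 : T (dg (fun k => (l k)%:C%C)) by rewrite eD; exact: T3.
have Ts s : T (Dl s) by have := T3 _ _ (perm_mx_unitary R s) T0; rewrite perm_mx_dg.
have s1 : \sum_i l i = 1.
  have [_ h] := T1 _ T0; move/(congr1 (@complex.Re R)): h; rewrite /mxtrace cRe_sum /= => <-.
  by apply: eq_bigr => i _; rewrite !mxE eqxx mulr1n.
have s2 : \sum_i l i ^+ 2 = 1.
  have : \tr (dg (fun k => (l k)%:C%C) *m dg (fun k => (l k)%:C%C)) = 1 :> C.
    rewrite eD !mulmxA -[_ *m V^t* *m V]mulmxA (unitarymx_adjl hV) mulmx1 mxtrace_mulC !mulmxA.
    by rewrite (unitarymx_adjl hV) mul1mx.
  rewrite tr_dg_mul => /(congr1 (@complex.Re R)); rewrite cRe_sum /= => <-.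
  by apply: eq_bigr => i _; rewrite !mxE eqxx mulr1n -rmorphM /= expr2.
have s3 (s : 'S_d) : 0 <= \sum_i l i * l (s i).
  have [h1 h2] := T1 _ T0; have := (T2 _ h1 h2).1 T0 _ (Ts s); rewrite tr_dg_mul.
  rewrite lecE => /andP[_]; rewrite cRe_sum /=; congr (0 <= _).
  by apply: eq_bigr => i _; rewrite !mxE eqxx mulr1n -rmorphM.
have [o [b hb]] := spectrum_shape s1 s2 s3.
have d0 : (d%:R : R) != 0 by rewrite pnatr_eq0.
have cd : #|[pred i : 'I_d | i != o]| = m.+1 by rewrite cardC1 card_ord.
have q1 : l o + m.+1%:R * b = 1.
  rewrite -[RHS]s1 (bigD1 o) //= (eq_bigr (fun=> b)) // sumr_const cd.
  by rewrite -[b *+ _]mulr_natl.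
have q2 : l o ^+ 2 + m.+1%:R * b ^+ 2 = 1.
  rewrite -[RHS]s2 (bigD1 o) //= (eq_bigr (fun=> b ^+ 2)); last by move=> i /hb ->.
  by rewrite sumr_const cd -[b ^+ 2 *+ _]mulr_natl.
(* Eliminating the exceptional eigenvalue from the two power sums leaves b = 0, the spectrum of a
   rank-one projection, or b = 2/d, that of its reflection. *)
have q3 : b * (d%:R * b - 2) = 0.
  have M0 : m.+1%:R != 0 :> R by rewrite pnatr_eq0.
  have e1 : l o = 1 - m.+1%:R * b by apply: (addIr (m.+1%:R * b)); rewrite q1 subrK.
  apply: (mulfI M0); rewrite mulr0 -[d%:R]natr1; rewrite e1 in q2.
  move: (m.+1%:R : R) q2 => M q2.
  have e3 : M * (b * ((M + 1) * b - 2)) = (1 - M * b) ^+ 2 + M * b ^+ 2 - 1 by ring.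
  by rewrite e3 q2 subrr.
move/eqP: q3; rewrite mulf_eq0 => /orP[/eqP b0|/eqP b2].
  left; apply: (selfdual_delta (o := o)) => //.
  have lo : l o = 1 by rewrite -q1 b0 mulr0 addr0.
  have -> : delta_mx o o = dg (fun k => (l k)%:C%C) :> 'M[C]_d; last exact: T0.
  apply/matrixP => i j; rewrite !mxE; case: (eqVneq i o) => [->|io] /=.
    by rewrite lo eq_sym.
  by rewrite (hb _ io) b0 mul0rn.
right; apply: (selfdual_delta (T := fun A => T (refl A)) (o := o)); first exact: selfdual_refl.
have -> : refl (delta_mx o o) = dg (fun k => (l k)%:C%C) :> 'M[C]_d; last exact: T0.
have bE : b = 2 / d%:R by apply: (mulIf d0); rewrite divfK // mulrC; apply/eqP; rewrite -subr_eq0 b2.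
have lo : l o = b - 1.
  have -> : l o = 1 - m.+1%:R * b by apply: (addIr (m.+1%:R * b)); rewrite q1 subrK.
  have -> : m.+1%:R = d%:R - 1 :> R by rewrite -[d%:R]natr1 addrK.
  by rewrite bE; move: (d%:R : R) d0 => x x0; field.
rewrite /refl; have -> : \tr (delta_mx o o : 'M[C]_d) = 1.
  by rewrite /mxtrace (bigD1 o) //= mxE !eqxx big1 ?addr0 // => k ko; rewrite mxE (negPf ko).
have bC : 2 / d%:R * 1 = b%:C%C :> C by rewrite bE mulr1 rmorphM fmorphV !rmorph_nat.
rewrite bC; apply/matrixP => i j; rewrite !mxE; case: (eqVneq i o) => [->|io] /=.
  rewrite lo [j == o]eq_sym; case: (eqVneq o j) => _ /=; last by rewrite !mulr0n subr0.
  by rewrite !mulr1n rmorphB rmorph1.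
by rewrite (hb _ io) subr0.
Qed.

End SelfDual.

(** * Normalisation of the intertwiner *)

Section Normalized.
Variables (R : realType).
Local Notation C := R[i].
Variables (m n : nat).
Local Notation d := m.+2.
Variable phi : 'M[C]_d -> 'M[C]_n.
Hypothesis phiU : forall U, U \is unitarymx -> phi U \is unitarymx.
Hypothesis phiR : forall U, U \is unitarymx -> map_mx Num.conj (phi U) = phi U.
Hypothesis phiM : forall U V, U \is unitarymx -> V \is unitarymx -> phi (U *m V) = phi U *m phi V.
Hypothesis phiK : forall U, U \is unitarymx -> (phi U = 1%:M <-> exists2 z, unitc z & U = z%:M).
Variable c0 : 'cV[C]_n.
Hypothesis c00 : c0 != 0.
Hypothesis phic : forall U, U \is unitarymx -> phi U *m c0 = c0.
Hypothesis dimn : (n <= d * d)%N.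

Hypothesis c0R : map_mx Num.conj c0 = c0.

(** The trace part is sent along [c0] and the traceless part through [g]. The images are orthogonal,
    so the second can be rescaled independently: the factor sqrt(sg / a) turns the form a tr(AB) on
    traceless matrices into sg tr(AB). *)
Lemma normalized_exists (sg : R) : 0 < sg -> exists h : 'M[C]_d -> 'cV[C]_n,
  [/\ forall A B, h (A + B) = h A + h B,
      forall c A, h (c *: A) = c *: h A,
      forall A, map_mx Num.conj (h A) = h (A^t*) &
      forall U A, U \is unitarymx -> phi U *m h A = h (U *m A *m U^t*)] /\
  (forall A, (c0^T *m h A) 0 0 = \tr A * (c0^T *m c0) 0 0) /\
  forall A B, ((h A)^T *m h B) 0 0 = \tr A * \tr B * (c0^T *m c0) 0 0 +
    sg%:C%C * (\tr (A *m B) - \tr A * \tr B / d%:R).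
Proof.
move=> sg0.
have [g [[gD gZ gC gE] [[kp hkp] [a [b [a0 hab]]]]]] := intertwiner_exists phiU phiR phiM phiK c00 phic dimn.
have aR : a = (Re a)%:C%C by apply/esym/RRe_real/ger0_real/ltW.
have ra0 : 0 < Re a by move: a0; rewrite {1}aR ltcR.
pose s : R := Num.sqrt (sg / Re a).
have s2 : s%:C%C * s%:C%C * a = sg%:C%C.
  rewrite aR -!rmorphM -expr2 sqr_sqrtr ?divfK ?gt_eqF //.
  by rewrite divr_ge0 // ltW.
have d0 : (d%:R : C) != 0 by rewrite pnatr_eq0.
pose X (A : 'M[C]_d) : 'M[C]_d := A - (\tr A / d%:R)%:M.
have XD A B : X (A + B) = X A + X B.
  by rewrite /X mxtraceD mulrDl raddfD opprD addrACA.
have XZ c A : X (c *: A) = c *: X A.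
  by rewrite /X mxtraceZ -mulrA scalerBr scale_scalar_mx.
have trX A : \tr (X A) = 0.
  by rewrite /X raddfB /= mxtrace_scalar -[_ *+ d]mulr_natr divfK // subrr.
have trC (A : 'M[C]_d) : (\tr A)^* = \tr (A^t*).
  by rewrite /mxtrace rmorph_sum; apply: eq_bigr => i _; rewrite !mxE.
have XC A : (X A)^t* = X (A^t*).
  rewrite /X raddfB raddfB /= tr_scalar_mx map_scalar_mx /= -trC; congr (_ - _%:M).
  by rewrite rmorphM fmorphV /= conjC_nat.
have trM A B : \tr (X A *m X B) = \tr (A *m B) - \tr A * \tr B / d%:R.
  rewrite /X mulmxBl !mulmxBr -scalar_mxM mul_scalar_mx mul_mx_scalar !raddfB /= mxtrace_scalar !mxtraceZ -[(_ * _) *+ d]mulr_natr.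
  by move: (d%:R : C) d0 (\tr A) (\tr B) (\tr (A *m B)) => x x0 u v w; field.
have trU (U A : 'M[C]_d) : U \is unitarymx -> \tr (U *m A *m U^t*) = \tr A.
  by move=> hU; rewrite mxtrace_mulC mulmxA (unitarymx_adjl hU) mul1mx.
have XU U A : U \is unitarymx -> U *m X A *m U^t* = X (U *m A *m U^t*).
  move=> hU; rewrite /X (trU U A hU) mulmxBr mulmxBl mul_mx_scalar -scalemxAl (unitarymxP hU).
  by rewrite scalemx1.
exists (fun A => \tr A *: c0 + s%:C%C *: g (X A)).
have cg A : c0^T *m g (X A) = 0.
  by apply/matrixP => i j; rewrite !ord1 hkp trX mulr0 mxE.
have gc A : (g (X A))^T *m c0 = 0.
  by rewrite -[c0]trmxK -trmx_mul cg trmx0.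
split; last split.
- split.
  + by move=> A B; rewrite mxtraceD XD gD scalerDl scalerDr addrACA.
  + by move=> c A; rewrite mxtraceZ XZ gZ scalerDr !scalerA [s%:C%C * c]mulrC.
  + move=> A; rewrite map_mxD !map_mxZ /= c0R gC XC trC; congr (_ + _ *: _).
    by rewrite cconjCE oppr0.
  + move=> U A hU; rewrite mulmxDr -!scalemxAr (phic hU) (gE _ _ hU) (XU _ _ hU) (trU _ _ hU).
    by [].
- by move=> A; rewrite mulmxDr -!scalemxAr cg scaler0 addr0 mxE.
have tE A : (\tr A *: c0 + s%:C%C *: g (X A))^T = \tr A *: c0^T + s%:C%C *: (g (X A))^T.
  by apply/matrixP => i j; rewrite !mxE.
move=> A B; rewrite tE mulmxDl !mulmxDr -!scalemxAl -!scalemxAr cg gc !scaler0 addr0 add0r.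
have -> (P Q : 'M[C]_1) (x y z t : C) : (x *: (y *: P) + z *: (t *: Q)) 0 0 = x * y * P 0 0 + z * t * Q 0 0.
  by rewrite !mxE !mulrA.
rewrite hab !trX mul0r mulr0 addr0 trM -s2.
by rewrite -!mulrA.
Qed.

End Normalized.

(** * Qplexes and preservation groups in matrix language *)

Section Bridge.
Local Notation R := Rdefinitions.R.
Local Notation K := R[i].

Lemma rsumE n (F : 'I_n -> R) : rsum F = \sum_i F i.
Proof. by []. Qed.

Lemma dotE n (u v : vec n) : dot u v = \sum_i u i * v i.
Proof. by []. Qed.

Lemma dRE d : dR d = d%:R. Proof. exact: INRE. Qed.

Lemma Rdiv1E (x : R) : Rdiv 1 x = x^-1.
Proof. by rewrite RdivE; exact: mul1r. Qed.

Lemma polarE d (A : vec (D d) -> Prop) u : polar A u <->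
  \sum_i u i = 1 /\ forall v, A v -> (d%:R * (d%:R + 1))^-1 <= \sum_i u i * v i.
Proof.
rewrite /polar /hyp rsumE Rdiv1E dRE.
by split=> -[h1 h2]; split=> // v /h2 h; [apply/RleP/Rge_le | apply/Rle_ge/RleP].
Qed.

Lemma simplexE d (p : vec (D d)) : simplex p <-> (forall i, 0 <= p i) /\ \sum_i p i = 1.
Proof.
by rewrite /simplex rsumE; split=> -[h1 h2]; split=> // i; apply/RleP; exact: h1.
Qed.

(** On the hyperplane the squared distance to the centre is |u|^2 - 1/d^2, and the squared
    out-radius plus 1/d^2 equals 2 / (d (d + 1)). *)
Lemma out_ballE d (u : vec (D d)) : (0 < d)%N -> out_ball u ->
  \sum_i u i * u i <= 2 / (d%:R * (d%:R + 1)).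
Proof.
move=> d0 [hu]; rewrite /vnorm /r_out !RsqrtE => /RleP.
have dp : 0 < d%:R :> R by rewrite ltr0n.
pose x : R := \sum_i u i * u i - (d%:R * d%:R)^-1.
pose y : R := (d%:R - 1) / (d%:R * d%:R * (d%:R + 1)).
have -> : dot (fun i => Rminus (u i) (@centre d i)) (fun i => Rminus (u i) (@centre d i)) = x.
  rewrite dotE /centre Rdiv1E dRE RmultE /x.
  have aux (z : R) : z != 0 -> (z * z)^-1 * (z * z)^-1 * (z * z) = (z * z)^-1 by move=> z0; field.
  have := aux _ (lt0r_neq0 dp); move: (d%:R * d%:R)^-1 => c cc.
  transitivity (\sum_i (u i * u i - (2 * c) * u i + c * c)).
    by apply: eq_bigr => i _; rewrite RminusE; ring.
  rewrite big_split sumrB -mulr_sumr /= sumr_const card_ord.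
  have -> : \sum_i u i = 1 by exact: hu.
  have -> : c * c *+ D d = c by rewrite -[_ *+ _]mulr_natr /D natrM cc.
  by rewrite mulr1 mulr2n mulrDl mul1r opprD addrA subrK.
have -> : Rdiv (Rminus (dR d) (IZR 1)) (Rmult (Rmult (dR d) (dR d)) (Rplus (dR d) (IZR 1))) = y.
  by rewrite dRE RdivE.
have b0 : 0 <= y.
  by apply: divr_ge0; [rewrite subr_ge0 ler1n | rewrite !mulr_ge0 ?addr_ge0 ?ler0n].
move=> h; have {}h : x <= y.
  case: (lerP x 0) => hx; first exact: le_trans hx b0.
  by move: h; rewrite ler_sqrt.
have -> : 2 / (d%:R * (d%:R + 1)) = y + (d%:R * d%:R)^-1 :> R.
  rewrite /y; have d1 : d%:R + 1 != 0 :> R by rewrite lt0r_neq0 // addr_gt0.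
  by move: (d%:R : R) dp d1 => z /lt0r_neq0 z0 z1; field; rewrite z0 z1.
by rewrite -lerBlDr.
Qed.

(** The basis distributions. The polar inequality against the k-th one says precisely that the k-th
    coordinate is nonnegative, which puts them in every qplex; they lie on the boundary sphere of
    the out-ball. *)
Definition ebas d (k i : 'I_(D d)) : R := ((i == k)%:R + d%:R^-1) / (d%:R + 1).

Lemma dot_ebas d k (v : vec (D d)) : \sum_i v i = 1 -> \sum_i ebas k i * v i = (v k + d%:R^-1) / (d%:R + 1).
Proof.
move=> hv; transitivity (\sum_i ((i == k)%:R * v i + d%:R^-1 * v i) / (d%:R + 1)).
  by apply: eq_bigr => i _; rewrite /ebas; ring.
rewrite -mulr_suml big_split -mulr_sumr hv mulr1 /= (bigD1 k) //= eqxx mul1r big1 ?addr0 //.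
by move=> i /negPf->; rewrite mul0r.
Qed.

Lemma sum_ebas d (k : 'I_(D d)) : (0 < d)%N -> \sum_i ebas k i = 1.
Proof.
move=> d0; have dp : 0 < d%:R :> R by rewrite ltr0n.
rewrite /ebas -mulr_suml big_split /= sumr_const card_ord (bigD1 k) //= eqxx big1 ?addr0; last first.
  by move=> i /negPf->.
rewrite -[_^-1 *+ _]mulr_natr /D natrM (_ : true%:R = 1 :> R) //.
have d1 : d%:R + 1 != 0 :> R by rewrite lt0r_neq0 // addr_gt0.
by move: (d%:R : R) dp d1 => z /lt0r_neq0 z0 z1; field; rewrite z0 z1.
Qed.

Section QplexFacts.
Variables (d : nat) (Q : vec (D d) -> Prop).
Hypothesis d0 : (0 < d)%N.
Hypothesis hQ : qplex Q.

Lemma Q_sum q : Q q -> \sum_i q i = 1.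
Proof. by move/(hQ.1 q) => [/simplexE[]]. Qed.

Lemma Q_ge0 q i : Q q -> 0 <= q i.
Proof. by move/(hQ.1 q) => [/simplexE[]]. Qed.

Lemma Q_norm q : Q q -> \sum_i q i * q i <= 2 / (d%:R * (d%:R + 1)).
Proof. by move/(hQ.1 q) => [_]; exact: out_ballE. Qed.

Lemma Q_polar q : Q q <-> \sum_i q i = 1 /\ forall v, Q v -> (d%:R * (d%:R + 1))^-1 <= \sum_i q i * v i.
Proof. by rewrite -polarE; split=> /(hQ.2 q). Qed.

Lemma Q_ebas k : Q (ebas k).
Proof.
apply/Q_polar; split; first exact: sum_ebas.
move=> v hv; rewrite dot_ebas ?Q_sum // invfM ler_wpM2r ?lerDr ?Q_ge0 //.
by rewrite invr_ge0 addr_ge0 ?ler0n.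
Qed.

(** The coordinates of q sum to one, so the constant shift by 1/d can be absorbed into the matrix.
    The affine action of a measurement thereby becomes linear. *)
Lemma stretched_mul (r : rmat (D d)) q i : \sum_j q j = 1 ->
  q_r r q i = \sum_j stretched r i j * q j.
Proof.
move=> hq; rewrite /q_r /stretched !rsumE Rdiv1E dRE.
rewrite !(RmultE, RplusE, RminusE).
transitivity ((d%:R + 1) * (\sum_j r i j * q j) - d%:R^-1 * \sum_j r i j).
  rewrite !mulr_sumr -sumrB; apply: eq_bigr => j _.
  by rewrite !(RmultE, RplusE, RminusE) R1E; ring.
transitivity ((d%:R + 1) * (\sum_j r i j * q j) - d%:R^-1 * (\sum_j r i j) * \sum_j q j).
  by rewrite hq mulr1.
rewrite !mulr_sumr -sumrB; apply: eq_bigr => j _.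
by rewrite !(RmultE, RplusE, RminusE) R1E; ring.
Qed.

Definition rm (M : rmat (D d)) : 'M[R]_(D d) := \matrix_(i, j) M i j.
Definition rv (q : vec (D d)) : 'cV[R]_(D d) := \col_i q i.

Lemma rm_mul A B : rm (rmatmul A B) = rm A *m rm B.
Proof. by apply/matrixP => i j; rewrite !mxE /rmatmul rsumE; apply: eq_bigr => k _; rewrite !mxE. Qed.

Lemma rm_id : rm (@rid (D d)) = 1%:M.
Proof. by apply/matrixP => i j; rewrite !mxE /rid -val_eqE; case: eqP. Qed.

Lemma rm_inj : injective rm.
Proof.
by move=> A B /matrixP h; apply/funext => i; apply/funext => j; have := h i j; rewrite !mxE.
Qed.

Lemma G_act M q : preservation_group Q M -> Q q -> Q (fun i => (rm M *m rv q) i 0).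
Proof.
move=> [r [_ [[h _] ->]]] hq; have := h q hq; congr Q; apply/funext => i.
by rewrite (stretched_mul r i (Q_sum hq)) mxE; apply: eq_bigr => j _; rewrite !mxE.
Qed.

Lemma G_colsum M j : preservation_group Q M -> \sum_i M i j = 1.
Proof.
move=> [r [[_ h] [_ ->]]]; have {}h j' : \sum_i r i j' = 1 by exact: h.
transitivity (\sum_i ((d%:R + 1) * r i j - d%:R^-1 * \sum_k r i k)).
  by apply: eq_bigr => i _; rewrite /stretched Rdiv1E dRE rsumE !(RmultE, RplusE, RminusE) R1E.
rewrite sumrB -!mulr_sumr h mulr1 exchange_big /= (eq_bigr (fun=> 1)); last by move=> k _; exact: h.
rewrite sumr_const card_ord /D natrM.
have : (d%:R : R) != 0 by rewrite pnatr_eq0 -lt0n.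
by move: (d%:R : R) => z z0; rewrite mulKf // addrAC subrr add0r.
Qed.

(** The images of the d^2 basis distributions stay in the out-ball. Summing their squared norms
    bounds the Frobenius norm plus a multiple of the squared row sums; the row sums average to one,
    so their squares sum to at least d^2. *)
Lemma G_frob M : preservation_group Q M -> \sum_i \sum_j M i j ^+ 2 <= (D d)%:R.
Proof.
move=> hM; have dp : 0 < d%:R :> R by rewrite ltr0n.
pose mm i := \sum_j M i j.
have hm : \sum_i mm i = (D d)%:R.
  rewrite /mm exchange_big /= (eq_bigr (fun=> 1)); last by move=> j _; exact: G_colsum.
  by rewrite sumr_const card_ord.
have hm2 : (D d)%:R <= \sum_i mm i ^+ 2.
  have : 0 <= \sum_i (mm i - 1) ^+ 2 by apply: sumr_ge0 => i _; exact: sqr_ge0.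
  have -> : \sum_i (mm i - 1) ^+ 2 = \sum_i mm i ^+ 2 - 2 * (D d)%:R + (D d)%:R.
    transitivity (\sum_i (mm i ^+ 2 - 2 * mm i + 1)); first by apply: eq_bigr => i _; ring.
    by rewrite big_split sumrB -mulr_sumr hm /= sumr_const card_ord.
  by lra.
have col k : \sum_i (M i k + d%:R^-1 * mm i) ^+ 2 <= 2 * (d%:R + 1) / d%:R.
  have := Q_norm (G_act hM (Q_ebas k)).
  have -> : \sum_i (rm M *m rv (ebas k)) i 0 * (rm M *m rv (ebas k)) i 0 =
      \sum_i (M i k + d%:R^-1 * mm i) ^+ 2 / (d%:R + 1) ^+ 2.
    apply: eq_bigr => i _.
    have -> : (rm M *m rv (ebas k)) i 0 = (M i k + d%:R^-1 * mm i) / (d%:R + 1).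
      rewrite mxE; transitivity (\sum_j ((j == k)%:R * M i j + d%:R^-1 * M i j) / (d%:R + 1)).
        by apply: eq_bigr => j _; rewrite !mxE /ebas; ring.
      rewrite -mulr_suml big_split -mulr_sumr /= (bigD1 k) //= eqxx mul1r big1 ?addr0 //.
      by move=> j /negPf->; rewrite mul0r.
    by rewrite -expr2 expr_div_n.
  have d1 : 0 < d%:R + 1 :> R by rewrite addr_gt0.
  rewrite -mulr_suml ler_pdivrMr ?exprn_gt0 // => /le_trans; apply.
  rewrite le_eqVlt; apply/orP; left; apply/eqP.
  by move: (d%:R : R) dp d1 => z /lt0r_neq0 z0 /lt0r_neq0 z1; field; rewrite z0 z1.
have tot : \sum_k \sum_i (M i k + d%:R^-1 * mm i) ^+ 2 <= \sum_(k < D d) 2 * (d%:R + 1) / d%:R.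
  by apply: ler_sum => k _; exact: col.
rewrite sumr_const card_ord in tot.
have e : \sum_k \sum_i (M i k + d%:R^-1 * mm i) ^+ 2 =
    \sum_i \sum_j M i j ^+ 2 + (2 / d%:R + 1) * \sum_i mm i ^+ 2.
  rewrite exchange_big mulr_sumr -big_split /=; apply: eq_bigr => i _.
  transitivity (\sum_j (M i j ^+ 2 + (2 / d%:R * mm i) * M i j + (d%:R^-1 * mm i) ^+ 2)).
    by apply: eq_bigr => j _; ring.
  rewrite !big_split /= -mulr_sumr -/(mm i) sumr_const card_ord -[(_ ^+ 2) *+ _]mulr_natr /D natrM.
  by move: (d%:R : R) dp => z /lt0r_neq0 z0; field.
rewrite e -[_ *+ D d]mulr_natr in tot.
have e2 : 2 * (d%:R + 1) / d%:R * (D d)%:R = (D d)%:R + (2 / d%:R + 1) * (D d)%:R :> R.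
  by rewrite /D natrM; move: (d%:R : R) dp => z /lt0r_neq0 z0; field.
have : (2 / d%:R + 1) * (D d)%:R <= (2 / d%:R + 1) * \sum_i mm i ^+ 2.
  by rewrite ler_wpM2l // addr_ge0 // divr_ge0 // ltW.
rewrite e2 in tot; lra.
Qed.

(* Both a group element and its inverse have Frobenius norm at most that of the
   identity, which forces the inverse to be the transpose. *)
Lemma G_orth A B : preservation_group Q A -> preservation_group Q B -> rm A *m rm B = 1%:M ->
  rm B = (rm A)^T.
Proof.
move=> hA hB hAB; have fA := G_frob hA; have fB := G_frob hB.
have tr : \sum_i \sum_j A i j * B j i = (D d)%:R.
  have := congr1 (@mxtrace _ _) hAB; rewrite mxtrace1 => <-.
  by apply: eq_bigr => i _; rewrite mxE; apply: eq_bigr => j _; rewrite !mxE.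
have h0 : \sum_i \sum_j (A i j - B j i) ^+ 2 <= 0.
  have -> : \sum_i \sum_j (A i j - B j i) ^+ 2 =
      \sum_i \sum_j A i j ^+ 2 - 2 * (\sum_i \sum_j A i j * B j i) + \sum_i \sum_j B i j ^+ 2.
    rewrite [X in _ + X]exchange_big /= mulr_sumr -sumrB -big_split /=; apply: eq_bigr => i _.
    by rewrite mulr_sumr -sumrB -big_split /=; apply: eq_bigr => j _; ring.
  by rewrite tr; lra.
have g0 i j : 0 <= (A i j - B j i) ^+ 2 by exact: sqr_ge0.
have g1 i : 0 <= \sum_j (A i j - B j i) ^+ 2 by apply: sumr_ge0.
have e0 : \sum_i \sum_j (A i j - B j i) ^+ 2 = 0.
  by apply/eqP; rewrite eq_le h0 sumr_ge0.
apply/matrixP => j i; rewrite !mxE.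
have h1 := psumr_eq0P (fun i _ => g1 i) e0; have {}h1 := h1 i isT.
have h2 := psumr_eq0P (fun j _ => g0 i j) h1; move/eqP: (h2 j isT).
by rewrite sqrf_eq0 subr_eq0 => /eqP.
Qed.

(** The columns of the inverse sum to one and the inverse is the transpose, so the rows of M sum to
    one too. *)
Lemma G_fix M B : preservation_group Q M -> preservation_group Q B -> rm M *m rm B = 1%:M ->
  rm M *m const_mx 1 = const_mx 1 :> 'cV[R]_(D d).
Proof.
move=> hM hB h; have e := G_orth hM hB h.
have hBt : (rm B)^T = rm M by rewrite e trmxK.
apply/matrixP => i j; rewrite -hBt !mxE -[RHS](G_colsum i hB); apply: eq_bigr => k _.
by rewrite !mxE mulr1.
Qed.

End QplexFacts.
End Bridge.

(** * Complex matrices: the concrete encoding against library matrices *)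

Section CBridge.
Local Notation R := Rdefinitions.R.
Local Notation K := R[i].

Definition toC (z : Defs.C) : K := Complex (Defs.Re z) (Defs.Im z).
Definition ofC (z : K) : Defs.C := mkC (complex.Re z) (complex.Im z).
Lemma toCK : cancel toC ofC. Proof. by case. Qed.
Lemma ofCK : cancel ofC toC. Proof. by case. Qed.
Lemma toCD x y : toC (Cadd x y) = toC x + toC y. Proof. by case: x y => [? ?] [? ?]. Qed.
Lemma toCM x y : toC (Cmul x y) = toC x * toC y. Proof. by case: x y => [? ?] [? ?]. Qed.
Lemma toCJ x : toC (Cconj x) = (toC x)^*. Proof. by case: x. Qed.
Lemma toC_sum n (F : 'I_n -> Defs.C) : toC (csum F) = \sum_i toC (F i).
Proof. exact: (big_morph toC toCD). Qed.

Variable d : nat.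
Definition cm (A : cmat d) : 'M[K]_d := \matrix_(i, j) toC (A i j).
Definition mc (M : 'M[K]_d) : cmat d := fun i j => ofC (M i j).
Lemma cmK : cancel cm mc.
Proof. by move=> A; apply/funext => i; apply/funext => j; rewrite /mc mxE toCK. Qed.
Lemma mcK : cancel mc cm.
Proof. by move=> M; apply/matrixP => i j; rewrite mxE ofCK. Qed.
Lemma cm_mul A B : cm (cmatmul A B) = cm A *m cm B.
Proof. by apply/matrixP => i j; rewrite !mxE toC_sum; apply: eq_bigr => k _; rewrite !mxE toCM. Qed.
Lemma cm_adj A : cm (cadj A) = (cm A)^t*.
Proof. by apply/matrixP => i j; rewrite !mxE toCJ. Qed.
Lemma cm_id : cm (@Defs.cid d) = 1%:M.
Proof. by apply/matrixP => i j; rewrite !mxE /Defs.cid -val_eqE; case: eqP. Qed.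
Lemma cm_scale a A : cm (cscale a A) = toC a *: cm A.
Proof. by apply/matrixP => i j; rewrite !mxE toCM. Qed.
Lemma cm_tr A : toC (ctrace A) = \tr (cm A).
Proof. by rewrite toC_sum; apply: eq_bigr => i _; rewrite mxE. Qed.
Lemma cm_lin (a b : R) A B : cm (clincomb a b A B) = (a%:C)%C *: cm A + (b%:C)%C *: cm B.
Proof. by apply/matrixP => i j; rewrite !mxE toCD !toCM. Qed.

Lemma unitaryE U : Defs.unitary U <-> cm U \is unitarymx.
Proof.
split=> [[h _]|h]; first by apply/unitarymxP; rewrite -cm_adj -cm_mul h cm_id.
by split; apply: (can_inj cmK); rewrite cm_mul cm_adj cm_id; [exact/unitarymxP | exact: unitarymx_adjl].
Qed.

Lemma hermitianE A : Defs.hermitian A <-> (cm A)^t* = cm A.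
Proof.
split=> h; first by apply/matrixP => i j; rewrite !mxE -toCJ -h.
move=> i j; apply: (can_inj toCK); rewrite toCJ.
by have /matrixP/(_ i j) := h; rewrite !mxE.
Qed.

(** [Cexpi] uses the sine and cosine of Stdlib, [expi] those of the analysis library. Only their
    common range, the unit circle, matters, so the two are never compared. *)
Lemma unitc_Cexpi (z : K) : unitc z <-> exists t : R, z = toC (Cexpi t).
Proof.
split=> [/unitcE h|[t ->]]; last first.
  apply/unitcE => /=; rewrite addrC; exact: sin2_cos2.
have h1 : -1 <= complex.Re z <= 1.
  by move: (complex.Re z) (complex.Im z) h => a b h; apply/andP; split; nra.
have h2 : Rle (IZR (-1)) (complex.Re z) /\ Rle (complex.Re z) (IZR 1).
  by case/andP: h1 => /RleP ? /RleP ?; split.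
have hc := Ratan.cos_acos _ h2; have hs := Ratan.sin_acos _ h2.
have e : Rminus (IZR 1) (Rsqr (complex.Re z)) = complex.Im z ^+ 2.
  by rewrite /Rsqr RminusE RmultE R1E -h; ring.
rewrite e RsqrtE sqrtr_sqr in hs.
case: (lerP 0 (complex.Im z)) => hI.
  by exists (Ratan.acos (complex.Re z)); apply: complex_ext; rewrite /= ?hc // hs ger0_norm.
exists (Ropp (Ratan.acos (complex.Re z))); apply: complex_ext; rewrite /= ?Rtrigo1.cos_neg ?Rtrigo1.sin_neg ?hc //.
by rewrite hs ltr0_norm // RoppE opprK.
Qed.
End CBridge.

(** * From a copy of PU(d) to a Hilbert qplex *)

Section DBridge.
Local Notation R := Rdefinitions.R.
Local Notation K := R[i].
Variable m : nat.
Local Notation d := m.+2.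

Lemma quadE (A : cmat d) (v : 'I_d -> Defs.C) :
  toC (csum (fun i => csum (fun j => Cmul (Cmul (Cconj (v i)) (A i j)) (v j)))) =
  ((\col_i toC (v i))^t* *m cm A *m (\col_i toC (v i))) 0 0.
Proof.
rewrite toC_sum mxE; under eq_bigr => i _ do rewrite toC_sum.
rewrite exchange_big /=; apply: eq_bigr => j _; rewrite !mxE mulr_suml; apply: eq_bigr => i _.
by rewrite !mxE !toCM toCJ.
Qed.

Lemma densityE (A : cmat d) : Defs.density A <-> dens (cm A).
Proof.
have tr1 : ctrace A = Defs.C1 <-> \tr (cm A) = 1.
  rewrite -cm_tr; split=> [->|h]; first by [].
  by apply: (can_inj toCK); rewrite h.
split=> [[h1 [h2 /tr1 h3]]|[h1 h3 h2]].
  have hA : (cm A)^t* = cm A by apply/hermitianE.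
  split=> // v; set z := (_ 0 0).
  have zr : z^* = z.
    rewrite {2}/z -hA; set w := _ *m _; rewrite /z.
    have -> : w = ((v^t* *m cm A *m v)^t*).
      by rewrite /w !trmx_mul !map_mxM trmxCK mulmxA.
    by rewrite [RHS]mxE [in RHS]mxE.
  have im0 : complex.Im z = 0.
    by have /(congr1 (@complex.Im _)) := zr; rewrite cIm_conj; lra.
  rewrite lecE im0 eqxx /=.
  have := h2 (fun i => ofC (v i 0)) => /RleP.
  have := quadE A (fun i => ofC (v i 0)).
  have -> : \col_i toC (ofC (v i 0)) = v by apply/matrixP => i j; rewrite mxE ofCK ord1.
  by rewrite -/z => <-.
split; first by apply/hermitianE.
split; last by apply/tr1.
move=> v; apply/RleP; have := h2 (\col_i toC (v i)); rewrite -quadE lecE => /andP[_].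
by [].
Qed.

Lemma reflD (A B : 'M[K]_d) : refl (A + B) = refl A + refl B.
Proof. by rewrite /refl mxtraceD mulrDr raddfD opprD addrACA. Qed.
Lemma reflZ c (A : 'M[K]_d) : refl (c *: A) = c *: refl A.
Proof. by rewrite /refl mxtraceZ mulrCA scalerBr scale_scalar_mx. Qed.

Lemma tr_herm_real (A B : 'M[K]_d) : A^t* = A -> B^t* = B -> complex.Im (\tr (A *m B)) = 0.
Proof.
move=> hA hB; have : (\tr (A *m B))^* = \tr (A *m B).
  have -> : (\tr (A *m B))^* = \tr ((A *m B)^t*).
    by rewrite /mxtrace rmorph_sum; apply: eq_bigr => i _; rewrite !mxE.
  by rewrite trmx_mul map_mxM hA hB mxtrace_mulC.
by move/(congr1 (@complex.Im _)); rewrite cIm_conj; lra.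
Qed.

Lemma contains_PU_hilbert (Q : vec (D d) -> Prop) : qplex Q ->
  contains_PU (preservation_group Q) -> hilbert_qplex Q.
Proof.
move=> hQ [Hs [phi [[HsG [Hs1 [HsM HsV]]] [phiH [phiM [phiK phiS]]]]]].
have d0 : (0 < d)%N by [].
pose n := D d.
have uM (U : 'M[K]_d) : U \is unitarymx -> Defs.unitary (mc U) by move=> h; apply/unitaryE; rewrite mcK.
have u1 : Defs.unitary (@Defs.cid d) by apply/unitaryE; rewrite cm_id; exact: unitarymx1.
(* The image of the identity is idempotent and invertible. *)
have phi1 : phi (@Defs.cid d) = @rid n.
  have e : phi (@Defs.cid d) = rmatmul (phi (@Defs.cid d)) (phi (@Defs.cid d)).
    rewrite -phiM //; congr phi; apply: (can_inj (@cmK d)).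
    by rewrite cm_mul cm_id mulmx1.
  have [B [hB [h1 h2]]] := HsV _ (phiH _ u1).
  apply: rm_inj; rewrite rm_id -(rm_id d) -h1 [in RHS]e rm_mul -[LHS]mulmx1 rm_mul -mulmxA -rm_mul h1 rm_id.
  by rewrite mulmx1.
pose phi' (U : 'M[K]_d) : 'M[K]_n := map_mx (real_complex R) (rm (phi (mc U))).
have inv U : Defs.unitary U -> exists2 B, preservation_group Q B & rm (phi U) *m rm B = 1%:M.
  move=> hU; have [B [hB [h1 h2]]] := HsV _ (phiH _ hU); exists B; first exact: HsG.
  by rewrite -rm_mul h1 rm_id.
have orth U : Defs.unitary U -> rm (phi U) *m (rm (phi U))^T = 1%:M.
  by move=> hU; have [B hB h] := inv U hU; rewrite -(G_orth d0 hQ (HsG _ (phiH _ hU)) hB h).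
have real_adj (M : 'M[R]_n) : (map_mx (real_complex R) M)^t* = map_mx (real_complex R) M^T.
  by apply/matrixP => i j; rewrite !mxE cconjCE oppr0.
have phiU' U : U \is unitarymx -> phi' U \is unitarymx.
  by move=> hU; apply/unitarymxP; rewrite real_adj -map_mxM orth ?map_mx1 //; exact: uM.
have phiR' U : U \is unitarymx -> map_mx Num.conj (phi' U) = phi' U.
  by move=> _; apply/matrixP => i j; rewrite !mxE cconjCE oppr0.
have phiM' U V : U \is unitarymx -> V \is unitarymx -> phi' (U *m V) = phi' U *m phi' V.
  move=> hU hV; rewrite /phi' -map_mxM -rm_mul -phiM; try exact: uM.
  by congr (map_mx _ (rm (phi _))); apply: (can_inj (@cmK d)); rewrite cm_mul !mcK.
have phiK' U : U \is unitarymx -> (phi' U = 1%:M <-> exists2 z, unitc z & U = z%:M).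
  move=> hU; have e : phi' U = 1%:M <-> phi (mc U) = phi (@Defs.cid d).
    rewrite phi1; split=> h; last by rewrite /phi' h rm_id map_mx1.
    apply: rm_inj; rewrite rm_id; apply/matrixP => i j; have /matrixP/(_ i j) := h.
    by rewrite !mxE; case: eqP => _ [].
  rewrite e (phiK _ _ (uM _ hU) u1); split=> [[t ht]|[z /unitc_Cexpi[t ht] eU]].
    exists (toC (Cexpi t)); first by apply/unitc_Cexpi; exists t.
    by rewrite -(mcK U) ht cm_scale cm_id scalemx1.
  by exists t; apply: (can_inj (@cmK d)); rewrite mcK cm_scale cm_id scalemx1 eU ht.
pose cR : R := (d%:R * d%:R)^-1.
have dR0 : (d%:R : R) != 0 by rewrite pnatr_eq0.
pose c0 : 'cV[K]_n := const_mx (cR%:C)%C.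
have cR0 : cR != 0 by rewrite invr_eq0 mulf_neq0.
have c00 : c0 != 0.
  apply/eqP => /matrixP/(_ (Ordinal (isT : (0 < n)%N)) 0); rewrite !mxE => /eqP.
  by rewrite fmorph_eq0 (negPf cR0).
have phic U : U \is unitarymx -> phi' U *m c0 = c0.
  move=> hU; have [B hB h] := inv _ (uM _ hU).
  have := G_fix d0 hQ (HsG _ (phiH _ (uM _ hU))) hB h.
  move/(congr1 (fun M => (cR%:C)%C *: map_mx (real_complex R) M)).
  rewrite map_mxM scalemxAr -/(phi' U) => e.
  have ec : (cR%:C)%C *: map_mx (real_complex R) (const_mx 1) = c0.
    by apply/matrixP => i j; rewrite !mxE mulr1.
  by move: e; rewrite ec.
have c0R : map_mx Num.conj c0 = c0 by apply/matrixP => i j; rewrite !mxE cconjCE oppr0.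
(* The polar constant. Since 1/d^2 = sg (1 + 1/d), the normalised form becomes sg (tr(AB) + tr A tr
   B), the inner product required of a Hilbert qplex. *)
pose sg : R := (d%:R * (d%:R + 1))^-1.
have d1 : 0 < d%:R + 1 :> R by rewrite addr_gt0 ?ltr0n.
have sg0 : 0 < sg by rewrite invr_gt0 mulr_gt0 ?ltr0n.
have [h [[hD hZ hC hE] [hc hform]]] :=
  normalized_exists phiU' phiR' phiM' phiK' c00 phic (leqnn (d * d)) c0R sg0.
have cc : (c0^T *m c0) 0 0 = (cR%:C)%C.
  rewrite mxE (eq_bigr (fun=> ((cR * cR)%:C)%C)); last by move=> i _; rewrite !mxE -rmorphM.
  rewrite sumr_const card_ord -rmorphMn; congr (_%:C)%C.
  by rewrite -mulr_natr /n /D natrM /cR; move: (d%:R : R) dR0 => x x0; field.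
have hdot A B : ((h A)^T *m h B) 0 0 = (sg%:C)%C * (\tr (A *m B) + \tr A * \tr B).
  rewrite hform cc.
  have e1 : (cR%:C)%C = (sg%:C)%C * (1 + d%:R^-1) :> K.
    rewrite -[d%:R](rmorph_nat (real_complex R)) -fmorphV -[1](rmorph1 (real_complex R)) -rmorphD -rmorphM.
    congr (_%:C)%C; rewrite /cR /sg; move: (d%:R : R) dR0 d1 => x x0 /lt0r_neq0 x1.
    by field; rewrite x0 x1.
  by rewrite e1; ring.
pose hr A : vec (D d) := fun i => complex.Re (h A i 0).
have hreal A i : A^t* = A -> h A i 0 = ((hr A i)%:C)%C.
  move=> hA; apply: complex_ext => //=.
  have /matrixP/(_ i 0) := hC A; rewrite hA mxE => /(congr1 (@complex.Im _)).
  by rewrite cIm_conj; lra.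
have hrsum A : A^t* = A -> \sum_i hr A i = complex.Re (\tr A).
  move=> hA; have := hc A; rewrite cc mxE (eq_bigr (fun i => (cR%:C)%C * h A i 0)); last by move=> i _; rewrite !mxE.
  rewrite -mulr_sumr mulrC => /mulIf e; rewrite -e ?fmorph_eq0 // cRe_sum.
  by [].
have hrdot A B : A^t* = A -> B^t* = B ->
    \sum_i hr A i * hr B i = sg * (complex.Re (\tr (A *m B)) + complex.Re (\tr A * \tr B)).
  move=> hA hB; have := hdot A B => /(congr1 (@complex.Re _)).
  rewrite cReM /= mul0r subr0 cReD => <-; rewrite mxE cRe_sum; apply: eq_bigr => i _.
  by rewrite mxE (hreal A i hA) (hreal B i hB) cReM /= mul0r subr0.
have hB0 A B : h (A - B) = h A - h B by rewrite hD -scaleN1r hZ scaleN1r.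
(* Paired with the adjoint of A, the form is sg times the sum of the squared Frobenius norm and |tr
   A|^2, hence definite. *)
have hinj0 A : h A = 0 -> A = 0.
  move=> h0; have := hdot A (A^t*); rewrite h0 trmx0 mul0mx mxE => /esym/(congr1 (@complex.Re _)).
  rewrite cReM /= mul0r subr0 => /eqP; rewrite mulf_eq0 gt_eqF //= => /eqP.
  have -> : \tr (A^t*) = (\tr A)^*.
    by rewrite /mxtrace rmorph_sum; apply: eq_bigr => i _; rewrite !mxE.
  rewrite cReD -F2_tr mul_conjCc /= => e.
  have f0 : F2 A = 0.
    have := F2_ge0 A; have := sqr_ge0 (complex.Re (\tr A)); have := sqr_ge0 (complex.Im (\tr A)); lra.
  have g0 i j : 0 <= complex.Re (A i j) ^+ 2 + complex.Im (A i j) ^+ 2 by rewrite addr_ge0 ?sqr_ge0.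
  have g1 i : 0 <= \sum_j (complex.Re (A i j) ^+ 2 + complex.Im (A i j) ^+ 2) by apply: sumr_ge0.
  apply/matrixP => i j; rewrite mxE.
  have h1 := psumr_eq0P (fun i _ => g1 i) f0; have {}h1 := h1 i isT.
  have h2 := psumr_eq0P (fun j _ => g0 i j) h1; have e2 := h2 j isT.
  apply: complex_ext => /=; apply/eqP; rewrite -sqrf_eq0; apply/eqP;
  have := sqr_ge0 (complex.Re (A i j)); have := sqr_ge0 (complex.Im (A i j)); lra.
have hinj A B : h A = h B -> A = B.
  by move=> e; apply/eqP; rewrite -subr_eq0; apply/eqP/hinj0; rewrite hB0 e subrr.
(* Injectivity between spaces of equal dimension d^2 gives surjectivity; compatibility with
   conjugation makes the preimage of a real vector Hermitian. *)
have hsurj v : exists2 A, A^t* = A & hr A = v.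
  pose Mh : 'M[K]_(d * d) := \matrix_(k, i) h (vec_mx (delta_mx 0 k)) i 0.
  have hMh (u : 'rV[K]_(d * d)) : u *m Mh = (h (vec_mx u))^T.
    have h00 : h 0 = 0 by rewrite -(scale0r (0 : 'M[K]_d)) hZ scale0r.
    rewrite {2}[u]row_sum_delta linear_sum (big_morph h hD h00).
    apply/matrixP => i j; rewrite ord1 !mxE summxE; apply: eq_bigr => k _.
    by rewrite linearZ hZ !mxE.
  have Mu : Mh \in unitmx.
    rewrite -row_free_unit -kermx_eq0; apply/eqP/row_matrixP => i; rewrite row0.
    have : row i (kermx Mh) *m Mh = 0 by rewrite -row_mul mulmx_ker row0.
    rewrite hMh => /(congr1 trmx); rewrite trmxK trmx0 => /hinj0 /(congr1 mxvec).
    by rewrite vec_mxK linear0.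
  pose w : 'rV[K]_(d * d) := \row_i ((v i)%:C)%C.
  pose A := vec_mx (w *m invmx Mh).
  have hA : h A = w^T by rewrite -[h A]trmxK -hMh mulmxKV.
  have AA : A^t* = A.
    by apply: hinj; rewrite -hC hA; apply/matrixP => i j; rewrite !mxE cconjCE oppr0.
  by exists A => //; apply/funext => i; rewrite /hr hA !mxE.
pose T A := [/\ A^t* = A, \tr A = 1 & Q (hr A)].
have hrQ A : A^t* = A -> Q (hr A) -> \tr A = 1.
  move=> hA /(Q_sum hQ); rewrite hrsum // => e; apply: complex_ext => //=.
  have h1 : (1%:M : 'M[K]_d)^t* = 1%:M by rewrite trmx1 map_mx1.
  by have := tr_herm_real hA h1; rewrite mulmx1.
(* The term tr A tr B = 1 exactly offsets the polar threshold, which leaves the condition Tr(AB) >=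
   0. *)
have pos x : sg <= sg * (x + 1) <-> 0 <= x.
  by rewrite mulrDr mulr1 lerDr pmulr_rge0.
have sd : selfdual T.
  split.
  - by move=> A [].
  - move=> A hA trA; split=> [[_ _ qA] B [hB trB qB]|H].
      have := ((Q_polar hQ (hr A)).1 qA).2 _ qB; rewrite -/sg hrdot // trA trB mulr1 /= => /pos e.
      by rewrite lecE tr_herm_real // eqxx.
    split=> //; apply/(Q_polar hQ); split; first by rewrite hrsum // trA.
    move=> v qv; have [B hB eB] := hsurj v; rewrite -eB in qv *.
    have trB := hrQ B hB qv.
    rewrite -/sg hrdot // trA trB mulr1 /=; apply/pos.
    have : T B by [].
    by move/H; rewrite lecE => /andP[].
  move=> U A hU [hA trA qA]; split.
  - by rewrite !trmx_mul !map_mxM trmxCK hA mulmxA.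
  - by rewrite mxtrace_mulC mulmxA (unitarymx_adjl hU) mul1mx.
  have := G_act hQ (HsG _ (phiH _ (uM _ hU))) qA; congr Q; apply/funext => i.
  rewrite /hr -hE // /phi' [in RHS]mxE cRe_sum mxE; apply: eq_bigr => j _.
  by rewrite !mxE (hreal A j hA) -rmorphM.
(* A basis distribution has squared norm 2 sg, the largest possible in the out-ball, so its preimage
   has Tr A^2 = 1. *)
have ex : exists2 A, T A & \tr (A *m A) = 1.
  pose k0 : 'I_(D d) := Ordinal (isT : (0 < D d)%N).
  have [A hA eA] := hsurj (ebas k0); have qA : Q (hr A) by rewrite eA; exact: Q_ebas.
  have trA := hrQ A hA qA; exists A => //.
  have := hrdot A A hA hA; rewrite trA mulr1 /= eA dot_ebas ?sum_ebas // /ebas eqxx => e.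
  apply: complex_ext; last exact: tr_herm_real.
  have : sg * (complex.Re (\tr (A *m A)) + 1) = sg * 2.
    rewrite -e /sg (_ : true%:R = 1 :> R) //; move: (d%:R : R) dR0 d1 => x x0 /lt0r_neq0 x1.
    by field; rewrite x0 x1.
  by move/(mulfI (lt0r_neq0 sg0)) => e2; apply: (addIr 1); rewrite e2.
(* L stands for the identity or for the reflection. Both are linear involutions preserving adjoints,
   traces and the trace form, so one argument serves both cases. *)
suff finish (L : 'M[K]_d -> 'M[K]_d) : (forall A B, L (A + B) = L A + L B) ->
    (forall c A, L (c *: A) = c *: L A) -> (forall A, (L A)^t* = L (A^t*)) ->
    (forall A, L (L A) = A) -> (forall A, \tr (L A) = \tr A) ->
    (forall A B, \tr (L A *m L B) = \tr (A *m B)) -> (forall A, T (L A) <-> dens A) -> hilbert_qplex Q.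
  case: (selfdual_dens sd ex) => H; first exact: (finish id).
  apply: (finish (@refl _ m)) => //; [exact: reflD | exact: reflZ | exact: refl_adj | exact: reflK
    | exact: tr_refl | exact: tr_refl_mul].
move=> LD LZ LA LK Ltr LM LT.
have LH A : Defs.hermitian A -> (L (cm A))^t* = L (cm A) by move/hermitianE => e; rewrite LA e.
exists (fun A => hr (L (cm A))); split; [|split; [|split; [|split; [|split]]]].
- move=> a b A B hA hB; apply/funext => i.
  rewrite cm_lin LD !LZ /hr hD !hZ !mxE cReD !cReM /= !mul0r !subr0.
  by [].
- move=> A B hA hB e; apply: (can_inj (@cmK d)); rewrite -[cm A]LK -[cm B]LK; congr L.
  apply: hinj; apply/matrixP => i j; rewrite ord1 (hreal _ i (LH A hA)) (hreal _ i (LH B hB)).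
  by have := congr1 (fun f => f i) e => /= ->.
- move=> v; have [A hA eA] := hsurj v; exists (mc (L A)); split.
    by apply/hermitianE; rewrite mcK LA hA.
  by rewrite mcK LK.
- by move=> rho /densityE /LT[].
- move=> q qq; have [A hA eA] := hsurj q; exists (mc (L A)); split; last by rewrite mcK LK.
  apply/densityE; rewrite mcK; apply/LT; rewrite LK; rewrite -eA in qq.
  by split=> //; exact: hrQ.
move=> rho rho' /densityE h1 /densityE h2; have [g1 t1 _] := h1; have [g2 t2 _] := h2.
rewrite dotE hrdot ?LA ?g1 ?g2 // LM !Ltr t1 t2 mulr1 (_ : complex.Re (1 : K) = 1) // RdivE dRE.
have -> : Defs.Re (ctrace (cmatmul rho rho')) = complex.Re (\tr (cm rho *m cm rho')).
  by rewrite -cm_mul -cm_tr.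
exact: (mulrC sg (complex.Re (\tr (cm rho *m cm rho')) + 1)).
Qed.

End DBridge.

(** * Unitary conjugation acting on a Hilbert qplex *)

Section Converse.
Local Notation R := Rdefinitions.R.
Local Notation K := R[i].
Variable m : nat.
Local Notation d := m.+2.
Local Notation n := (D d).

Lemma hermD (A B : 'M[K]_d) : A^t* = A -> B^t* = B -> (A + B)^t* = A + B.
Proof. by move=> hA hB; rewrite raddfD raddfD /= hA hB. Qed.

Lemma hermZ (a : R) (A : 'M[K]_d) : A^t* = A -> (a%:C%C *: A)^t* = a%:C%C *: A.
Proof.
by move=> hA; apply/matrixP => i j; rewrite -{2}hA !mxE rmorphM /= cconjCE oppr0.
Qed.

Lemma herm0 : (0 : 'M[K]_d)^t* = 0.
Proof. by rewrite trmx0 map_mx0. Qed.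

Lemma herm_conj (U A : 'M[K]_d) : A^t* = A -> (U *m A *m U^t*)^t* = U *m A *m U^t*.
Proof. by move=> hA; rewrite !trmx_mul !map_mxM trmxCK hA mulmxA. Qed.

Lemma dens_conj (U A : 'M[K]_d) : U \is unitarymx -> dens A -> dens (U *m A *m U^t*).
Proof.
move=> hU [hA trA psd]; split; first exact: herm_conj.
  by rewrite mxtrace_mulC mulmxA (unitarymx_adjl hU) mul1mx.
by move=> v; have := psd (U^t* *m v); rewrite trmx_mul map_mxM trmxCK !mulmxA.
Qed.

(** Hermitian matrices span all matrices over the complex numbers, so W is central, and comparison
    with matrix units makes it scalar. *)
Lemma cent_herm_scalar (W : 'M[K]_d) : (forall A, A^t* = A -> W *m A = A *m W) -> W = (W 0 0)%:M.
Proof.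
move=> h; have hZ Z : W *m Z = Z *m W.
  have h1 := h _ (herm1P Z); have h2 := h _ (herm2P Z).
  rewrite [Z]hermE; move: (herm1 Z) (herm2 Z) h1 h2 => X Y h1 h2.
  by rewrite mulmxDr mulmxDl -scalemxAr -scalemxAl h1 h2.
apply/matrixP => a b; have /matrixP/(_ a 0) := hZ (delta_mx b 0); rewrite !mxE.
rewrite (bigD1 b) //= big1 => [|k kb]; last by rewrite !mxE (negPf kb) mulr0.
rewrite mxE !eqxx mulr1 addr0 => ->.
rewrite (bigD1 0) //= big1 => [|k kb]; last by rewrite !mxE (negPf kb) andbF mul0r.
by rewrite mxE eqxx andbT addr0 mulr_natl.
Qed.

Variable Q : vec n -> Prop.
Hypothesis hQ : qplex Q.
Variable F : 'M[K]_d -> vec n.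
Variable G : vec n -> 'M[K]_d.
Hypothesis FL : forall (a b : R) A B i, A^t* = A -> B^t* = B ->
  F (a%:C%C *: A + b%:C%C *: B) i = a * F A i + b * F B i.
Hypothesis Finj : forall A B, A^t* = A -> B^t* = B -> (forall i, F A i = F B i) -> A = B.
Hypothesis GH : forall v, (G v)^t* = G v.
Hypothesis FG : forall v i, F (G v) i = v i.
Hypothesis FQ : forall A, dens A -> Q (F A).
Hypothesis QF : forall q, Q q -> exists2 A, dens A & F A = q.
Hypothesis Fdot : forall A, dens A ->
  \sum_i F A i * F A i = (complex.Re (\tr (A *m A)) + 1) / (d%:R * (d%:R + 1)).

Lemma F_sum (I : Type) (r : seq I) (v : I -> R) (B : I -> 'M[K]_d) : (forall j, (B j)^t* = B j) ->
  let S := \sum_(j <- r) (v j)%:C%C *: B j in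
  S^t* = S /\ forall i, F S i = \sum_(j <- r) v j * F (B j) i.
Proof.
move=> hB /=; elim: r => [|j r [IH1 IH2]].
  rewrite !big_nil; split=> [|i]; first exact: herm0.
  by have := FL 0 0 i herm0 herm0; rewrite !scaler0 addr0 !mul0r addr0 big_nil.
rewrite !big_cons; split=> [|i]; first by apply: hermD => //; exact: hermZ.
by rewrite big_cons -IH2; have := FL (v j) 1 i (hB j) IH1; rewrite rmorph1 scale1r mul1r.
Qed.

Definition delta_vec (j i : 'I_n) : R := (i == j)%:R.
(** The matrix of A -> U A U^* in the coordinates given by [F]: column j is the image of the j-th
    standard basis vector. *)
Definition adj_rep (U : 'M[K]_d) : rmat n := fun i j => F (U *m G (delta_vec j) *m U^t*) i.

Lemma adj_rep_mul U A i : A^t* = A -> \sum_j adj_rep U i j * F A j = F (U *m A *m U^t*) i.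
Proof.
move=> hA; have [s1 s2] := F_sum (index_enum 'I_n) (F A) (fun j => GH (delta_vec j)).
have eA : A = \sum_j (F A j)%:C%C *: G (delta_vec j).
  apply: Finj => // k; rewrite s2 (bigD1 k) //= FG /delta_vec eqxx mulr1 big1 ?addr0 // => j jk.
  by rewrite FG /delta_vec eq_sym (negPf jk) mulr0.
have -> : U *m A *m U^t* = \sum_j (F A j)%:C%C *: (U *m G (delta_vec j) *m U^t*).
  rewrite {1}eA mulmx_sumr mulmx_suml; apply: eq_bigr => j _.
  by rewrite -scalemxAr -scalemxAl.
have [_ ->] := F_sum (index_enum 'I_n) (F A) (fun j => herm_conj U (GH (delta_vec j))).
by apply: eq_bigr => j _; rewrite mulrC.
Qed.

Lemma adj_repM U V : rmatmul (adj_rep U) (adj_rep V) = adj_rep (U *m V).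
Proof.
apply/funext => i; apply/funext => j.
transitivity (\sum_k adj_rep U i k * F (V *m G (delta_vec j) *m V^t*) k); first by [].
rewrite adj_rep_mul; last exact: herm_conj.
by rewrite /adj_rep trmx_mul map_mxM !mulmxA.
Qed.

Lemma adj_rep1 : adj_rep 1%:M = @rid n.
Proof.
apply/funext => i; apply/funext => j; rewrite /adj_rep mul1mx trmx1 map_mx1 mulmx1 FG /delta_vec /rid -val_eqE /=.
by case: (_ == _).
Qed.

(** If U and V conjugate alike, then V^* U commutes with all Hermitian matrices and is a unit
    scalar. *)
Lemma adj_rep_eq U V : U \is unitarymx -> V \is unitarymx ->
  (adj_rep U = adj_rep V <-> exists2 z, unitc z & U = z *: V).
Proof.
move=> hU hV; split=> [e|[z hz ->]]; last first.
  apply/funext => i; apply/funext => j; congr (F _ i).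
  rewrite linearZ map_mxZ -scalemxAl -scalemxAl -scalemxAr scalerA.
  by have -> : z * z^* = 1 by []; rewrite scale1r.
have eA A : A^t* = A -> U *m A *m U^t* = V *m A *m V^t*.
  by move=> hA; apply: Finj => [||i]; try exact: herm_conj; rewrite -!adj_rep_mul // e.
pose W := V^t* *m U; have hW : W *m W^t* = 1%:M.
  rewrite /W trmx_mul map_mxM trmxCK mulmxA -[_ *m U *m _]mulmxA (unitarymxP hU) mulmx1.
  exact: unitarymx_adjl.
have hW' : W^t* *m W = 1%:M by apply: mulmx1C.
have cW : W = (W 0 0)%:M.
  apply: cent_herm_scalar => A hA.
  have : W *m A *m W^t* = A.
    have -> : W *m A *m W^t* = V^t* *m (U *m A *m U^t*) *m V.
      by rewrite /W trmx_mul map_mxM trmxCK !mulmxA.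
    by rewrite eA // !mulmxA (unitarymx_adjl hV) mul1mx -mulmxA (unitarymx_adjl hV) mulmx1.
  by move/(congr1 (fun M => M *m W)); rewrite -[_ *m _ *m W]mulmxA hW' mulmx1.
exists (W 0 0).
  have := hW; rewrite cW tr_scalar_mx map_scalar_mx -scalar_mxM => /matrixP/(_ 0 0).
  by rewrite !mxE eqxx !mulr1n.
have -> : U = V *m W by rewrite /W mulmxA (unitarymxP hV) mul1mx.
by rewrite {1}cW mul_mx_scalar.
Qed.

Lemma Q_adj_rep U q : U \is unitarymx -> Q q -> Q (fun i => \sum_j adj_rep U i j * q j).
Proof.
move=> hU /QF[A hA <-]; have := FQ (dens_conj hU hA); congr Q; apply/funext => i.
by case: hA => hA _ _; rewrite adj_rep_mul.
Qed.

(** The image of the maximally mixed state has d^2 coordinates with sum 1 and squared norm 1/d^2.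
    This is the equality case of Cauchy-Schwarz, so it is the centre. *)
Lemma F_mixed i : F (d%:R^-1)%:M i = (d%:R * d%:R)^-1.
Proof.
have dp : 0 < (d%:R : R) by rewrite ltr0n.
have dpC : 0 < (d%:R : K) by rewrite ltr0n.
have hA : dens ((d%:R^-1)%:M : 'M[K]_d).
  split.
  - by rewrite tr_scalar_mx map_scalar_mx /= fmorphV /= conjC_nat.
  - by rewrite mxtrace_scalar -[_ *+ d]mulr_natr mulVf // lt0r_neq0.
  move=> v; rewrite mul_mx_scalar -scalemxAl !mxE mulr_ge0 ?invr_ge0 ?(ltW dpC) //.
  by apply: sumr_ge0 => k _; rewrite !mxE mulrC -normCK exprn_ge0.
have e1 := Q_sum hQ (FQ hA); have e2 := Fdot hA.
have tr : complex.Re (\tr ((d%:R^-1)%:M *m (d%:R^-1)%:M : 'M[K]_d)) = d%:R^-1.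
  rewrite -scalar_mxM mxtrace_scalar -[_ *+ d]mulr_natr -mulrA mulVf ?lt0r_neq0 // mulr1.
  by rewrite -(rmorph_nat (real_complex R)) -fmorphV.
rewrite tr in e2.
have {}e2 : \sum_i F (d%:R^-1)%:M i * F (d%:R^-1)%:M i = (d%:R * d%:R)^-1.
  rewrite e2; have d1 : d%:R + 1 != 0 :> R by rewrite lt0r_neq0 // addr_gt0.
  by move: (d%:R : R) dp d1 => z /lt0r_neq0 z0 z1; field; rewrite z0 z1.
move: (F _) e1 e2 => c e1 e2.
have aux (z : R) : z != 0 -> (z * z)^-1 * (z * z)^-1 * (z * z) = (z * z)^-1 by move=> z0; field.
have := aux _ (lt0r_neq0 dp); move: (d%:R * d%:R)^-1 e2 => w e2 ww.
have s0 : \sum_k (c k - w) ^+ 2 = 0.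
  transitivity (\sum_k (c k * c k - (2 * w) * c k + w * w)).
    by apply: eq_bigr => k _; ring.
  rewrite big_split sumrB -mulr_sumr /= sumr_const card_ord e1 e2.
  have -> : w * w *+ D d = w by rewrite -[_ *+ _]mulr_natr /D natrM ww.
  by ring.
have h1 := psumr_eq0P (fun k _ => sqr_ge0 (c k - w)) s0; move/eqP: (h1 i isT).
by rewrite sqrf_eq0 subr_eq0 => /eqP.
Qed.

(** Conjugation fixes the maximally mixed state, whose coordinates are all equal and nonzero. *)
Lemma adj_rep_row U i : U \is unitarymx -> \sum_j adj_rep U i j = 1.
Proof.
move=> hU; have dp : (d%:R : R) != 0 by rewrite pnatr_eq0.
have h : ((d%:R^-1)%:M : 'M[K]_d)^t* = (d%:R^-1)%:M.
  by rewrite tr_scalar_mx map_scalar_mx /= fmorphV /= conjC_nat.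
have := adj_rep_mul U i h; rewrite mul_mx_scalar -scalemxAl (unitarymxP hU) scalemx1.
rewrite (eq_bigr (fun j => adj_rep U i j * (d%:R * d%:R)^-1)); last by move=> j _; rewrite F_mixed.
rewrite F_mixed -mulr_suml -[RHS]mul1r => /mulIf; apply.
by rewrite invr_eq0 mulf_neq0.
Qed.

(** The measurement is recovered by taking for r(.|j) the image of the j-th basis distribution. This
    is a point of Q, hence nonnegative and normalised, and as the rows of [adj_rep U] sum to one,
    stretching r returns that matrix. *)
Lemma adj_rep_preserves U : U \is unitarymx -> preservation_group Q (adj_rep U).
Proof.
move=> hU; have d0 : (0 < d)%N by [].
have dp : 0 < (d%:R : R) by rewrite ltr0n.
have d1 : d%:R + 1 != 0 :> R by rewrite lt0r_neq0 // addr_gt0.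
pose r : rmat n := fun i j => \sum_k adj_rep U i k * ebas j k.
have rE i j : r i j = (adj_rep U i j + d%:R^-1) / (d%:R + 1).
  rewrite -(dot_ebas j (adj_rep_row i hU)); apply: eq_bigr => k _; exact: mulrC.
have rQ j : Q (fun i => r i j) by exact: Q_adj_rep (Q_ebas d0 hQ j).
have rrow i : \sum_j r i j = 1.
  rewrite (eq_bigr _ (fun j _ => rE i j)) -mulr_suml big_split /= adj_rep_row // sumr_const card_ord.
  rewrite -[_ *+ _]mulr_natr /D natrM mulKf ?lt0r_neq0 // addrC divff //.
have sE : adj_rep U = stretched r.
  apply/funext => i; apply/funext => j; rewrite /stretched Rdiv1E dRE rsumE rrow rE.
  rewrite !(RmultE, RplusE, RminusE) R1E mulr1 mulrC divfK // addrK //.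
exists r; split; last split=> //.
  split=> [i j|j]; first by apply/RleP; exact: Q_ge0 i (rQ j).
  exact: Q_sum (rQ j).
have qE q : Q q -> q_r r q = fun i => \sum_j adj_rep U i j * q j.
  by move=> hq; apply/funext => i; rewrite (stretched_mul r i (Q_sum hQ hq)) -sE.
split=> [q hq|q hq]; first by rewrite qE //; exact: Q_adj_rep.
have hU' : U^t* \is unitarymx by rewrite trmxC_unitary.
have [A hA eA] := QF hq; have hA' := dens_conj hU' hA.
exists (F (U^t* *m A *m U^t*^t*)); split; first exact: FQ.
rewrite qE; last exact: FQ.
apply/funext => i; rewrite adj_rep_mul; last by case: hA'.
by rewrite trmxCK !mulmxA (unitarymxP hU) mul1mx -mulmxA (unitarymxP hU) mulmx1 eA.
Qed.
End Converse.

Lemma hilbert_contains_PU m (Q : vec (D m.+2) -> Prop) : qplex Q ->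
  hilbert_qplex Q -> contains_PU (preservation_group Q).
Proof.
move=> hQ [f [fL [fI [fS [fQ [Qf fdot]]]]]].
pose F (A : 'M[Rdefinitions.R[i]]_m.+2) : vec (D m.+2) := f (mc A).
have hm (A : 'M[Rdefinitions.R[i]]_m.+2) : A^t* = A -> Defs.hermitian (mc A).
  by move=> hA; apply/hermitianE; rewrite mcK.
have FL (a b : Rdefinitions.R) A B i : A^t* = A -> B^t* = B ->
    F (a%:C%C *: A + b%:C%C *: B) i = a * F A i + b * F B i.
  move=> hA hB; have := fL a b _ _ (hm _ hA) (hm _ hB).
  have -> : clincomb a b (mc A) (mc B) = mc (a%:C%C *: A + b%:C%C *: B).
    by apply: (can_inj (@cmK _)); rewrite cm_lin !mcK.
  by rewrite -/(F _) => ->.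
have Finj A B : A^t* = A -> B^t* = B -> (forall i, F A i = F B i) -> A = B.
  move=> hA hB h; apply: (can_inj (@mcK _)); apply: fI; try exact: hm.
  by apply/funext.
have /choice[G0 hG0] := fS.
pose G v := cm (G0 v).
have GH v : (G v)^t* = G v by apply/hermitianE; case: (hG0 v).
have FG v i : F (G v) i = v i by rewrite /F cmK; case: (hG0 v) => _ ->.
have dm (A : 'M[Rdefinitions.R[i]]_m.+2) : dens A -> Defs.density (mc A).
  by move=> hA; apply/densityE; rewrite mcK.
have FQ A : dens A -> Q (F A) by move/dm; exact: fQ.
have QF q : Q q -> exists2 A, dens A & F A = q.
  by move/Qf => [rho [/densityE h e]]; exists (cm rho) => //; rewrite /F cmK.
have Fdot A : dens A ->
    \sum_i F A i * F A i = (complex.Re (\tr (A *m A)) + 1) / (m.+2%:R * (m.+2%:R + 1)).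
  move=> hA; have := fdot _ _ (dm _ hA) (dm _ hA); rewrite dotE => ->.
  have -> : Defs.Re (ctrace (cmatmul (mc A) (mc A))) = complex.Re (\tr (A *m A)).
    by rewrite -[LHS]/(complex.Re (toC _)) cm_tr cm_mul mcK.
  by rewrite dRE RdivE.
pose phi U := adj_rep F G (cm U).
have u1 : Defs.unitary (@Defs.cid m.+2) by apply/unitaryE; rewrite cm_id; exact: unitarymx1.
have p1 : phi (@Defs.cid m.+2) = @rid _ by rewrite /phi cm_id adj_rep1.
have pM U V : phi (cmatmul U V) = rmatmul (phi U) (phi V).
  by rewrite /phi (adj_repM FL Finj GH FG) cm_mul.
have uM U V : Defs.unitary U -> Defs.unitary V -> Defs.unitary (cmatmul U V).
  by move=> /unitaryE hU /unitaryE hV; apply/unitaryE; rewrite cm_mul mul_unitarymx.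
exists (fun M => exists U, Defs.unitary U /\ phi U = M), phi; split; last first.
  split; first by move=> U hU; exists U.
  split; first by move=> U V _ _; exact: pM.
  split=> // U V /unitaryE hU /unitaryE hV; rewrite (adj_rep_eq FL Finj GH FG hU hV).
  split=> [[z /unitc_Cexpi[t ->] e]|[t ->]].
    by exists t; apply: (can_inj (@cmK _)); rewrite cm_scale.
  exists (toC (Cexpi t)); first by apply/unitc_Cexpi; exists t.
  by rewrite cm_scale.
split; first by move=> M [U [/unitaryE hU <-]]; exact: (adj_rep_preserves hQ FL Finj GH FG FQ QF Fdot hU).
split; first by exists (@Defs.cid _).
split; first by move=> _ _ [U [hU <-]] [V [hV <-]]; exists (cmatmul U V); split=> //; exact: uM.
move=> _ [U [hU <-]]; exists (phi (cadj U)).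
have hU' : Defs.unitary (cadj U).
  by apply/unitaryE; rewrite cm_adj trmxC_unitary; apply/unitaryE.
split; first by exists (cadj U).
by case: hU => e1 e2; rewrite -!pM e1 e2 p1.
Qed.

Theorem mainTheorem19 (d : nat) (hd : (2 <= d)%N) (Q : vec (D d) -> Prop)
  (hQ : qplex Q) :
  contains_PU (preservation_group Q) <-> hilbert_qplex Q.
Proof.
case: d hd Q hQ => [|[|m]] // _ Q hQ.
by split; [exact: contains_PU_hilbert | exact: hilbert_contains_PU].
Qed.
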